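(* Let $N,d\in\mathbb N$ and for $\epsilon>0$ let $$\Phi_{N,d,\epsilon}(A,B)=2^{dN}\pi^{dN^2}\exp\left(-\frac12\left(\binom{A}{B},K_\epsilon\binom{A}{B}\right)_{Mat^h_{N,2d}}\right),\quad A,B\in Mat^h_{N,d},$$ $$K_\epsilon=-\left((1-\epsilon)\,\mathrm{Id}_{Mat^h_{N,2d}}+i\begin{pmatrix}0&\mathrm{Id}_{Mat^h_{N,d}}\\ \mathrm{Id}_{Mat^h_{N,d}}&0\end{pmatrix}\right),$$ regarded as an element of the space of Hida distributions $(Mat^h_{N,2d})'$. Then there exists a Hida distribution $\Phi_{N,d}\in(Mat^h_{N,2d})'$ such that $$\lim_{\epsilon\to0}\Phi_{N,d,\epsilon}=\Phi_{N,d}$$ in the strong topology of $(Mat^h_{N,2d})'$. The $T$-transform of $\Phi_{N,d}$ is given by $$T\Phi_{N,d}(F,G)=2^{dN}\pi^{dN^2}\exp\left(-i\sum_{\mu=1}^d Tr(F_\mu G_\mu)\right),\qquad (F,G)\in Mat^h_{N,2d}.$$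
   Context: $Mat^h_N(\mathbb C)$ is the real Euclidean space of Hermitian $N\times N$ complex matrices with inner product $(A,B)=Tr(BA)$. For $m\in\mathbb N$, $Mat^h_{N,m}=(Mat^h_N(\mathbb C))^m$ with the product inner product $(A,B)_{Mat^h_{N,m}}=\sum_{\mu=1}^m Tr(A_\mu B_\mu)$, extended bilinearly to the complexification. Elements of $Mat^h_{N,2d}$ are written $\binom{A}{B}$ or $(A,B)$ with $A=(A_\mu)_{\mu=1}^d$, $B=(B_\mu)_{\mu=1}^d\in Mat^h_{N,d}$. Let $\mu_{N,d}$ be the standard Gaussian measure on $Mat^h_{N,2d}$ (characteristic function $\exp(-\frac12|F|^2)$). Hida triple. For a finite-dimensional real Euclidean space $V$ with standard Gaussian measure $\mu$, Wick monomials are defined by $\exp(\langle A,F\rangle-\frac12|F|^2)=\sum_{n\ge0}\frac1{n!}\langle :A^{\otimes n}:,F^{\otimes n}\rangle$, and each $f\in L^2(\mu)$ has a unique chaos decomposition $f=\sum_n\langle :A^{\otimes n}:,f^{(n)}\rangle$ with $f^{(n)}\in V_{\mathbb C}^{\hat\otimes n}$ (symmetric tensor power). The space of test functions $(V)\subset L^2(\mu)$ consists of all $\varphi$ with $\|\varphi\|_q^2=\sum_n n!\,2^{nq}|\varphi^{(n)}|^2<\infty$ for all $q\in\mathbb N$, with the topology given by these norms. Its topological dual $(V)'\supset L^2(\mu)$ is the space of Hida distributions, with bilinear dual pairing $\langle\!\langle\cdot,\cdot\rangle\!\rangle$ extending $\langle\!\langle f,\varphi\rangle\!\rangle=\int f\varphi\,d\mu$.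 The $T$-transform of $\Phi\in(V)'$ is $T\Phi(F)=\langle\!\langle\Phi,\exp(i\langle\cdot,F\rangle)\rangle\!\rangle$, $F\in V$; it determines $\Phi$ uniquely. The functions $\Phi_{N,d,\epsilon}$ lie in $L^1(\mu_{N,d})$ and are identified with the Hida distribution in $(Mat^h_{N,2d})'$ whose $T$-transform is $F\mapsto\int\exp(i\langle A,F\rangle)\Phi_{N,d,\epsilon}(A)\,d\mu_{N,d}(A)$. Strong convergence means convergence in the strong dual topology of $(V)'$. *)

(* Defs.v *)
From HB Require Import structures.
From mathcomp Require Import all_boot all_order all_fingroup all_algebra.
From mathcomp Require Import complex.
From mathcomp Require Import all_classical all_reals all_analysis.
From mathcomp Require Import ring lra zify.

Set Implicit Arguments.
Unset Strict Implicit.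
Unset Printing Implicit Defensive.

Import Order.TTheory GRing.Theory Num.Theory.
Import numFieldNormedType.Exports.
Import Normc.

Local Open Scope classical_set_scope.
Local Open Scope ring_scope.
Local Open Scope complex_scope.

Definition cexp (R : realType) (z : R[i]) : R[i] :=
  (expR (complex.Re z))%:C * (cos (complex.Im z) +i* sin (complex.Im z)).

(* The orthonormal basis is only used to write tensors as arrays of
   coefficients and to define the Borel sets and the Gaussian measure; these
   notions do not depend on its choice. *)
Record euclidean (R : realType) := Euclidean {
  esort :> lmodType R ;
  eip : esort -> esort -> R ;
  edim : nat ;
  ebasis : 'I_edim -> esort ;
  eipC : forall x y, eip x y = eip y x ;
  eip_linear : forall a x y z, eip (a *: x + y) z = a * eip x z + eip y z ;
  ebasis_orthonormal : forall i j, eip (ebasis i) (ebasis j) = (i == j)%:R ;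
  ebasis_span : forall x, x = \sum_i eip x (ebasis i) *: ebasis i }.
Arguments eip {R e} _ _.
Arguments ebasis {R e} _.

Section EuclideanTheory.
Variables (R : realType) (V : euclidean R).

Lemma eip0l (x : V) : eip 0 x = 0.
Proof.
have := eip_linear (-1) (0 : V) 0 x.
by rewrite scaler0 addr0 mulN1r addNr.
Qed.

Lemma eip0r (x : V) : eip x 0 = 0.
Proof. by rewrite eipC eip0l. Qed.

End EuclideanTheory.

Section Product.
Variables (R : realType) (V W : euclidean R).
Local Notation E := (V * W)%type.

Definition prod_ip (x y : E) : R := eip x.1 y.1 + eip x.2 y.2.

Definition prod_basis (k : 'I_(edim V + edim W)) : E :=
  match fintype.split k with
  | inl i => (ebasis i, 0)
  | inr j => (0, ebasis j)
  end.

Fact prod_ipC x y : prod_ip x y = prod_ip y x.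
Proof. by rewrite /prod_ip eipC (eipC x.2). Qed.

Fact prod_ip_linear a x y z :
  prod_ip (a *: x + y) z = a * prod_ip x z + prod_ip y z.
Proof. by rewrite /prod_ip /= !eip_linear; ring. Qed.

Fact prod_basis_orthonormal i j :
  prod_ip (prod_basis i) (prod_basis j) = (i == j)%:R.
Proof.
rewrite /prod_ip /prod_basis -(inj_eq (can_inj (@splitK _ _))).
case: (fintype.split i) => i'; case: (fintype.split j) => j' /=;
  by rewrite ?(eip0l, eip0r, ebasis_orthonormal, addr0, add0r).
Qed.

Fact prod_basis_span x : x = \sum_i prod_ip x (prod_basis i) *: prod_basis i.
Proof.
rewrite big_split_ord /= /prod_ip /prod_basis.
under eq_bigr => i _ do rewrite (unsplitK (inl i)) /= eip0r addr0.
under [X in _ + X]eq_bigr => i _ do rewrite (unsplitK (inr i)) /= eip0r add0r.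
case: x => x y /=.
have -> : \sum_i eip x (ebasis i) *: (ebasis i, 0 : W) = (x, 0).
  rewrite {2}(ebasis_span x).
  elim/big_rec2: _ => // i c p _ ->; case: p => a b /=.
  by congr pair; rewrite /= ?scaler0 ?addr0.
have -> : \sum_i eip y (ebasis i) *: (0 : V, ebasis i) = (0, y).
  rewrite {2}(ebasis_span y).
  elim/big_rec2: _ => // i c p _ ->; case: p => a b /=.
  by congr pair; rewrite /= ?scaler0 ?addr0.
by congr pair; rewrite /= ?addr0 ?add0r.
Qed.

Definition euclidean_prod : euclidean R :=
  Euclidean prod_ipC prod_ip_linear prod_basis_orthonormal prod_basis_span.

End Product.

Section Power.
Variables (R : realType) (m : nat) (V : euclidean R).
Local Notation E := {ffun 'I_m -> V}.

Definition pow_ip (x y : E) : R := \sum_mu eip (x mu) (y mu).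

(* The inverse of (mu, i) |-> mxvec_index mu i. *)
Definition unmxvec (p q : nat) (k : 'I_(p * q)) : 'I_p * 'I_q :=
  enum_val (cast_ord (esym (mxvec_cast p q)) k).

Definition pow_basis (k : 'I_(m * edim V)) : E :=
  [ffun nu => if nu == (unmxvec k).1 then ebasis (unmxvec k).2 else 0].

Fact unmxvecK p q : cancel (@unmxvec p q) (fun u => mxvec_index u.1 u.2).
Proof.
move=> k; rewrite /unmxvec /mxvec_index -surjective_pairing enum_valK.
by rewrite cast_ordKV.
Qed.

Fact mxvec_indexK p q i j : @unmxvec p q (mxvec_index i j) = (i, j).
Proof. by rewrite /unmxvec /mxvec_index cast_ordK enum_rankK. Qed.

Fact unmxvec_eq p q (k l : 'I_(p * q)) :
  (k == l) = ((unmxvec k).1 == (unmxvec l).1) &&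
             ((unmxvec k).2 == (unmxvec l).2).
Proof. by rewrite -xpair_eqE -!surjective_pairing (can_eq (@unmxvecK _ _)). Qed.

Fact sum_unmxvec (A : nmodType) p q (F : 'I_p -> 'I_q -> A) :
  \sum_(k < p * q) F (unmxvec k).1 (unmxvec k).2 = \sum_i \sum_j F i j.
Proof.
rewrite pair_bigA /= (reindex (fun u : 'I_p * 'I_q => mxvec_index u.1 u.2)) /=.
  by apply: eq_bigr => -[i j] _; rewrite mxvec_indexK.
exists (@unmxvec p q) => [[i j]|k] _; first by rewrite mxvec_indexK.
by rewrite unmxvecK.
Qed.

Fact pow_ipC x y : pow_ip x y = pow_ip y x.
Proof. by apply: eq_bigr => mu _; rewrite eipC. Qed.

Fact pow_ip_linear a x y z :
  pow_ip (a *: x + y) z = a * pow_ip x z + pow_ip y z.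
Proof.
rewrite /pow_ip mulr_sumr -big_split /=.
by apply: eq_bigr => mu _; rewrite !ffunE eip_linear.
Qed.

Fact pow_ip_basis x k :
  pow_ip x (pow_basis k) = eip (x (unmxvec k).1) (ebasis (unmxvec k).2).
Proof.
rewrite /pow_ip (bigD1 (unmxvec k).1) //= big1 => [|mu /negPf nmu].
  by rewrite ffunE eqxx addr0.
by rewrite ffunE nmu eip0r.
Qed.

Fact pow_basis_orthonormal i j :
  pow_ip (pow_basis i) (pow_basis j) = (i == j)%:R.
Proof.
rewrite pow_ip_basis ffunE unmxvec_eq eq_sym; case: eqP => _ /=.
  exact: ebasis_orthonormal.
by rewrite eip0l.
Qed.

Fact pow_basis_span x : x = \sum_i pow_ip x (pow_basis i) *: pow_basis i.
Proof.
apply/ffunP => nu; rewrite sum_ffunE {1}(ebasis_span (x nu)).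
under [RHS]eq_bigr => k _ do rewrite pow_ip_basis !ffunE.
rewrite (sum_unmxvec (fun mu j =>
  eip (x mu) (ebasis j) *: (if nu == mu then ebasis j else 0))).
rewrite (bigD1 nu) //= [X in _ + X]big1 ?addr0 => [|mu /negPf nmu].
  by under [RHS]eq_bigr do rewrite eqxx.
by rewrite big1 // => j _; rewrite eq_sym nmu scaler0.
Qed.

Definition euclidean_pow : euclidean R :=
  Euclidean pow_ipC pow_ip_linear pow_basis_orthonormal pow_basis_span.

End Power.

Section Hermitian.
Variables (R : realType) (N : nat).
Local Notation C := R[i].

Definition is_herm : {pred 'M[C]_N} := fun A => A \is hermsymmx.

Record herm := Herm { mx_of_herm :> 'M[C]_N ; _ : mx_of_herm \in is_herm }.

HB.instance Definition _ := [isSub for mx_of_herm].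
HB.instance Definition _ := [Choice of herm by <:].

Fact hermP (A : 'M[C]_N) : reflect (forall i j, A i j = (A j i)^*)
  (A \in is_herm).
Proof.
apply: (iffP (is_hermitianmxP _ _ _)) => [AE i j|AE].
  by rewrite {1}AE expr0 scale1r !mxE.
by apply/matrixP => i j; rewrite expr0 scale1r !mxE AE.
Qed.

Fact herm_zmod_closed : zmod_closed is_herm.
Proof.
split=> [|A B]; first by apply/hermP => i j; rewrite !mxE conjc0.
by move=> /hermP hA /hermP hB; apply/hermP => i j; rewrite !mxE rmorphB /= hA hB.
Qed.

HB.instance Definition _ := GRing.isZmodClosed.Build 'M[C]_N is_herm
  herm_zmod_closed.
HB.instance Definition _ := [SubChoice_isSubZmodule of herm by <:].

Fact herm_scale_subproof (a : R) (A : herm) :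
  a%:C *: (A : 'M[C]_N) \in is_herm.
Proof.
case: A => A /= /hermP hA; apply/hermP => i j.
by rewrite !mxE rmorphM /= -hA oppr0.
Qed.

Definition herm_scale (a : R) (A : herm) : herm := Herm (herm_scale_subproof a A).

Fact herm_scaleA a b A : herm_scale a (herm_scale b A) = herm_scale (a * b) A.
Proof. by apply/val_inj; rewrite /= scalerA -rmorphM. Qed.

Fact herm_scale1 : left_id 1 herm_scale.
Proof. by move=> A; apply/val_inj; rewrite /= scale1r. Qed.

Fact herm_scaleDr : right_distributive herm_scale +%R.
Proof. by move=> a A B; apply/val_inj; rewrite /= scalerDr. Qed.

Fact herm_scaleDl A : {morph herm_scale^~ A : a b / a + b}.
Proof. by move=> a b; apply/val_inj; rewrite /= rmorphD scalerDl. Qed.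

HB.instance Definition _ := GRing.Zmodule_isLmodule.Build R herm
  herm_scaleA herm_scale1 herm_scaleDr herm_scaleDl.

Definition herm_ip (A B : herm) : R :=
  complex.Re (\tr ((B : 'M[C]_N) *m (A : 'M[C]_N))).

(* The trace is real, so taking the real part loses nothing. *)
Lemma herm_ipE (A B : herm) :
  (herm_ip A B)%:C = \tr ((B : 'M[C]_N) *m (A : 'M[C]_N)).
Proof.
rewrite /herm_ip; set z := \tr _.
suff : z = z^*.
  by case: z => a b [] /eqP; rewrite -addr_eq0 -mulr2n mulrn_eq0 /= => /eqP ->.
have zE : z = \sum_i \sum_j B i j * A j i.
  by rewrite /z /mxtrace; apply: eq_bigr => i _; rewrite mxE.
rewrite {1}zE zE [LHS]exchange_big rmorph_sum /=; apply: eq_bigr => i _.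
rewrite rmorph_sum /=; apply: eq_bigr => j _; rewrite rmorphM /=.
by case: A B {z zE} => A /hermP hA [B /hermP hB] /=; rewrite -hA -hB.
Qed.

Fact herm_ipC A B : herm_ip A B = herm_ip B A.
Proof. by rewrite /herm_ip mxtrace_mulC. Qed.

Fact herm_ip_linear a A B D :
  herm_ip (a *: A + B) D = a * herm_ip A D + herm_ip B D.
Proof.
rewrite /herm_ip.
have -> : mx_of_herm (a *: A + B) = a%:C *: (A : 'M[C]_N) + B by [].
rewrite mulmxDr -scalemxAr.
rewrite mxtraceD mxtraceZ; case: (\tr _) => x y; case: (\tr _) => u v /=.
by rewrite mul0r subr0.
Qed.

Definition herm_basis_mx (j k : 'I_N) : 'M[C]_N :=
  if j == k then delta_mx j j
  else if (j < k)%N then (Num.sqrt 2)^-1%:C *: (delta_mx j k + delta_mx k j)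
  else (Num.sqrt 2)^-1%:C *: ('i%C *: (delta_mx j k - delta_mx k j)).

Fact herm_basis_subproof j k : herm_basis_mx j k \in is_herm.
Proof.
apply/hermP => a b; rewrite /herm_basis_mx.
case: eqP => [_|_]; first by rewrite !mxE conjc_nat andbC.
case: ifP => _; rewrite !mxE (andbC (b == j)) (andbC (b == k)).
  by rewrite rmorphM /= rmorphD /= !conjc_nat oppr0 addrC.
rewrite !rmorphM rmorphB /= !conjc_nat oppr0; congr (_ * _).
by rewrite -[RHS]opprK -mulrN opprB -mulNr; congr (_ * _); rewrite /GRing.opp /= oppr0 opprK.
Qed.

Definition herm_basis (k : 'I_(N * N)) : herm :=
  Herm (herm_basis_subproof (unmxvec k).1 (unmxvec k).2).

Definition herm_coord (A : 'M[C]_N) (j k : 'I_N) : R :=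
  if j == k then complex.Re (A j j)
  else Num.sqrt 2 * (if (j < k)%N then complex.Re (A j k)
                     else complex.Im (A j k)).

Fact mxtrace_delta_mul (A : 'M[C]_N) j k : \tr (delta_mx j k *m A) = A k j.
Proof.
rewrite /mxtrace (bigD1 j) //= big1 => [|i /negPf ij].
  rewrite mxE (bigD1 k) //= big1 => [|l /negPf lk].
    by rewrite !mxE !eqxx mul1r !addr0.
  by rewrite !mxE lk andbF mul0r.
by rewrite mxE big1 // => l _; rewrite !mxE ij mul0r.
Qed.

Fact herm_ip_basis (A : herm) k :
  herm_ip A (herm_basis k) = herm_coord A (unmxvec k).1 (unmxvec k).2.
Proof.
rewrite /herm_ip /= /herm_basis_mx /herm_coord; case: (unmxvec k) => i j /=.
have s2 : Num.sqrt 2 != 0 :> R by rewrite sqrtr_eq0 -ltNge.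
have sV : (Num.sqrt 2)^-1 = Num.sqrt 2 / 2 :> R.
  by apply: (mulfI s2); rewrite divff // mulrA -expr2 sqr_sqrtr // divff.
case: A => A /= /hermP hA.
case: eqP => [_|_]; first by rewrite mxtrace_delta_mul.
case: ifP => _; rewrite -!scalemxAl !mxtraceZ ?mulmxDl ?mulmxBl ?mxtraceD ?raddfN /= ?mulNmx ?raddfN /=;
  rewrite !mxtrace_delta_mul (hA j i); case: (A i j) => x y /=.
  by rewrite sV; field.
by rewrite sV; field.
Qed.

Fact herm_basis_orthonormal i j :
  herm_ip (herm_basis i) (herm_basis j) = (i == j)%:R.
Proof.
rewrite herm_ip_basis /= /herm_basis_mx /herm_coord unmxvec_eq.
case: (unmxvec i) (unmxvec j) => a b [c d] /=.
have s2 : Num.sqrt 2 != 0 :> R by rewrite sqrtr_eq0 -ltNge.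
rewrite -!val_eqE /=.
case: (ltngtP (a : nat) (b : nat)) => ab; case: (ltngtP (c : nat) (d : nat)) => cd;
  rewrite !mxE -!val_eqE /=;
  case: (eqVneq (c : nat) (a : nat)) => ca; case: (eqVneq (d : nat) (b : nat)) => db;
  case: (eqVneq (c : nat) (b : nat)) => cb; case: (eqVneq (d : nat) (a : nat)) => da;
  try (exfalso; lia).
all: by [rewrite /=; ring | rewrite /=; field; exact: s2].
Qed.

Fact herm_basis_span A : A = \sum_i herm_ip A (herm_basis i) *: herm_basis i.
Proof.
apply/val_inj/matrixP => a b.
have -> : val (\sum_i herm_ip A (herm_basis i) *: herm_basis i) =
    \sum_i (herm_ip A (herm_basis i))%:C *: (herm_basis i : 'M[C]_N).
  by rewrite raddf_sum.
rewrite summxE.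
under eq_bigr => k _ do rewrite herm_ip_basis mxE /=.
rewrite (sum_unmxvec (fun j k =>
  (herm_coord A j k)%:C * herm_basis_mx j k a b)) pair_bigA /=.
have s2 : Num.sqrt 2 != 0 :> R by rewrite sqrtr_eq0 -ltNge.
have hA : forall i j, (A : 'M[C]_N) i j = ((A : 'M[C]_N) j i)^*.
  by move=> i j; case: A => A /= h; have /hermP := h; apply.
rewrite (bigD1 (a, b)) //=; have [ab|ab] := eqVneq a b.
  subst b; rewrite big1 => [|[j k]]; rewrite /herm_coord /herm_basis_mx /=.
    rewrite eqxx mxE eqxx mulr1 addr0; have := hA a a.
    case: (_ a a) => x y [] /eqP.
    by rewrite -addr_eq0 -mulr2n mulrn_eq0 /= => /eqP ->.
  rewrite xpair_eqE -(val_eqE j a) -(val_eqE k a) -!val_eqE /= => ne; case: (ltngtP (j : nat) (k : nat)) => jk;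
    rewrite !mxE -!val_eqE /=;
    case: (eqVneq (a : nat) (j : nat)) => aj; case: (eqVneq (a : nat) (k : nat)) => ak;
    try (exfalso; lia); rewrite /=; ring.
rewrite (bigD1 (b, a)) /=; last by rewrite xpair_eqE eq_sym negb_and ab.
rewrite big1 => [|[j k]] /=.
  rewrite addr0 /herm_coord /herm_basis_mx -!val_eqE /= (hA b a).
  move: ab; rewrite -val_eqE; case: (ltngtP (a : nat) (b : nat)) => //= ab _;
    rewrite !mxE !eqxx -!val_eqE /= ?(gtn_eqF ab) ?(ltn_eqF ab) /=;
    case: (_ a b) => x y /=; apply/eqP; rewrite eq_complex /=;
    by apply/andP; split; apply/eqP; field; exact: s2.
rewrite !xpair_eqE -(val_eqE j a) -(val_eqE k b) -(val_eqE j b) -(val_eqE k a).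
rewrite /herm_coord /herm_basis_mx -!val_eqE /= => ne.
case: (ltngtP (j : nat) (k : nat)) => jk; rewrite !mxE -!val_eqE /=;
    case: (eqVneq (a : nat) (j : nat)) => aj; case: (eqVneq (a : nat) (k : nat)) => ak;
    case: (eqVneq (b : nat) (j : nat)) => bj; case: (eqVneq (b : nat) (k : nat)) => bk;
    try (exfalso; lia); rewrite /=; ring.
Qed.

Definition euclidean_herm : euclidean R :=
  Euclidean herm_ipC herm_ip_linear herm_basis_orthonormal herm_basis_span.

End Hermitian.

Section Gaussian.
Variable R : realType.
Local Notation T := (measurableTypeR R).

Definition tuple_cons n (p : T * n.-tuple T) : n.+1.-tuple T :=
  [tuple of p.1 :: p.2].

Fact measurable_tuple_cons n : measurable_fun setT (@tuple_cons n).
Proof. exact: measurable_cons. Qed.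

HB.instance Definition _ n := isMeasurableFun.Build _ _ _ _ (@tuple_cons n)
  (@measurable_tuple_cons n).

Fixpoint gauss_tuple n : probability (n.-tuple T) R :=
  if n is m.+1
  then distribution (normal_prob (0 : R) 1 \x gauss_tuple m)%E (@tuple_cons m)
  else \d_[tuple].

Variable V : euclidean R.

Definition ecoord (x : V) : (edim V).-tuple T :=
  [tuple eip x (ebasis i) | i < edim V].

Definition evec (t : (edim V).-tuple T) : V :=
  \sum_i tnth t i *: ebasis i.

Definition epointed : Type := V.
HB.instance Definition _ := Choice.on epointed.
HB.instance Definition _ := isPointed.Build epointed 0.

(* V with its Borel sigma-algebra: the one generated by the coordinates. *)
Definition borel : Type :=
  @g_sigma_algebra_preimageType _ epointed _ ecoord.

Lemma ecoordK : cancel ecoord evec.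
Proof.
move=> x; rewrite /evec [RHS]ebasis_span.
by apply: eq_bigr => i _; rewrite tnth_mktuple.
Qed.

Lemma evecK : cancel evec ecoord.
Proof.
move=> t; apply: eq_from_tnth => i; rewrite tnth_mktuple /evec.
have -> : eip (\sum_j tnth t j *: ebasis j) (ebasis i) =
    \sum_j tnth t j * eip (ebasis j : V) (ebasis i).
  elim/big_rec2: _ => [|j x y _ <-]; first exact: eip0l.
  exact: eip_linear.
rewrite (bigD1 i) //= ebasis_orthonormal eqxx mulr1 big1 ?addr0 // => j /negPf ji.
by rewrite ebasis_orthonormal ji mulr0.
Qed.

Fact measurable_evec : measurable_fun setT (evec : _ -> borel).
Proof.
move=> _ _ [A mA <-]; rewrite !setTI.
by rewrite -comp_preimage (_ : _ \o _ = id) //; apply/funext/evecK.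
Qed.

HB.instance Definition _ := isMeasurableFun.Build _ _ _ _
  (evec : _ -> borel) measurable_evec.

(* The standard normal law in orthonormal coordinates, i.e. the probability
   measure with characteristic function exp (- |y|^2 / 2). *)
Definition gauss : probability borel R :=
  distribution (gauss_tuple (edim V)) (evec : _ -> borel).

End Gaussian.

Section Hida.
Variables (R : realType) (V : euclidean R).
Local Notation C := R[i].
Local Notation mu := (gauss V).
Implicit Types (f g phi psi : V -> C).

Definition cmeasurable f :=
  measurable_fun setT (fun x : borel V => complex.Re (f x)) /\
  measurable_fun setT (fun x : borel V => complex.Im (f x)).

Definition cL1 f :=
  mu.-integrable setT (fun x => (complex.Re (f x))%:E) /\
  mu.-integrable setT (fun x => (complex.Im (f x))%:E).

Definition cL2 f :=
  cmeasurable f /\ (\int[mu]_x (normc (f x) ^+ 2)%:E < +oo)%E.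

Definition cintegral f : C :=
  (\int[mu]_x complex.Re (f x))%R +i* (\int[mu]_x complex.Im (f x))%R.

(* The n-th tensor power of V (K = R) or of its complexification (K = C), as
   arrays of coefficients in the basis e_(i_1) (x) ... (x) e_(i_n). *)
Definition tensor (K : Type) (n : nat) := {ffun n.-tuple 'I_(edim V) -> K}.

Definition tsym (K : Type) n (t : tensor K n) :=
  forall (s : 'S_n) i, t [tuple tnth i (s k) | k < n] = t i.

Definition tpair (K : pzRingType) n (t u : tensor K n) : K := \sum_i t i * u i.

Definition tnorm n (t : tensor C n) : R := Num.sqrt (\sum_i normc (t i) ^+ 2).

Definition tpow n (x : V) : tensor R n :=
  [ffun i : n.-tuple 'I_(edim V) => \prod_(k < n) eip x (ebasis (tnth i k))].

Definition is_wick (x : V) (w : forall n, tensor R n) :=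
  (forall n, tsym (w n)) /\
  forall y : V,
    series (fun n => (n`!%:R)^-1 * tpair (w n) (tpow n y)) @ \oo -->
      expR (eip x y - eip y y / 2).

(* wick x n is :x^{(x) n}:, given by the generating function of is_wick. *)
Definition wick (x : V) : forall n, tensor R n :=
  xget (fun n => 0 : tensor R n) [set w | is_wick x w].

Definition wick_pair n (t : tensor C n) (x : V) : C :=
  tpair [ffun i => (wick x n i)%:C] t.

(* f is the sum in L^2(mu) of the <:x^{(x) n}:, k n>. *)
Definition is_chaos f (k : forall n, tensor C n) :=
  (forall n, tsym (k n)) /\
  (fun M => \int[mu]_x
     (normc (f x - \sum_(n < M) wick_pair (k n) x) ^+ 2)%:E)%E @ \oo --> 0%E.

Definition chaos f : forall n, tensor C n :=
  xget (fun n => 0 : tensor C n) [set k | is_chaos f k].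

Definition chaos_norm2 (q : nat) (k : forall n, tensor C n) : \bar R :=
  (\sum_(0 <= n <oo) (n`!%:R * 2 ^+ (n * q) * tnorm (k n) ^+ 2)%:E)%E.

(* Functions are not quotiented by almost everywhere equality: two members of
   test_fun that agree mu-almost everywhere have the same kernels, hence are
   at distance 0 for all the norms below. *)
Definition test_fun : set (V -> C) := [set phi | cL2 phi /\
  exists2 k, is_chaos phi k & forall q, (chaos_norm2 q k < +oo)%E].

Definition hida_norm (q : nat) phi : R :=
  Num.sqrt (fine (chaos_norm2 q (chaos phi))).

(* Only the values on test_fun are meaningful. As the norms increase with q,
   the sets {psi | hida_norm q (psi - phi) < delta} are a basis of
   neighbourhoods of phi. *)
Record hida_distribution := HidaDistribution {
  hida_pair :> (V -> C) -> C ;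
  hida_linear : forall (a : C) phi psi, test_fun phi -> test_fun psi ->
    hida_pair (fun x => a * phi x + psi x) = a * hida_pair phi + hida_pair psi ;
  hida_continuous : forall phi, test_fun phi -> forall e : R, 0 < e ->
    exists q, exists2 delta : R, 0 < delta & forall psi, test_fun psi ->
      hida_norm q (fun x => psi x - phi x) < delta ->
      normc (hida_pair psi - hida_pair phi) < e }.

Definition Ttransform (Phi : hida_distribution) (y : V) : C :=
  Phi (fun x => cexp ('i%C * (eip x y)%:C)).

(* Phi is the Hida distribution identified with the function f. *)
Definition represents (Phi : hida_distribution) f :=
  cL1 f /\ forall y, Ttransform Phi y =
    cintegral (fun x => cexp ('i%C * (eip x y)%:C) * f x).

Definition hida_bounded (B : set (V -> C)) :=
  B `<=` test_fun /\
  forall q, exists M : R, forall phi, B phi -> hida_norm q phi <= M.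

Definition strong_cvg (F : set_system R) (Psi : R -> hida_distribution)
    (Phi : hida_distribution) :=
  forall B, hida_bounded B -> forall e : R, 0 < e ->
    \forall t \near F, forall phi, B phi -> normc (Psi t phi - Phi phi) < e.

End Hida.

Section Phi.
Variables (R : realType) (N d : nat).
Local Notation C := R[i].

Definition Math (m : nat) : euclidean R := euclidean_pow m (euclidean_herm R N).

(* Mat^h_(N,2d), whose elements are the pairs (A, B) with A, B in Math d. *)
Definition Math2 : euclidean R := euclidean_prod (Math d) (Math d).

(* The complexification of Mat^h_N is the space of all complex matrices. *)
Definition Matc2 : lmodType C :=
  ({ffun 'I_d -> 'M[C]_N} * {ffun 'I_d -> 'M[C]_N})%type.

Definition complexify (X : Math2) : Matc2 :=
  ([ffun mu => mx_of_herm (X.1 mu)], [ffun mu => mx_of_herm (X.2 mu)]).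

Definition Matc2_form (X Y : Matc2) : C :=
  \sum_mu \tr (X.1 mu *m Y.1 mu) + \sum_mu \tr (X.2 mu *m Y.2 mu).

Lemma Matc2_formE (X Y : Math2) :
  Matc2_form (complexify X) (complexify Y) = (eip X Y)%:C.
Proof.
rewrite /= /prod_ip /= /pow_ip rmorphD !rmorph_sum /Matc2_form /=.
by congr (_ + _); apply: eq_bigr => mu _; rewrite !ffunE herm_ipE mxtrace_mulC.
Qed.

Definition K_eps (eps : R) (X : Matc2) : Matc2 :=
  - ((1 - eps)%:C *: X + 'i%C *: ((X.2, X.1) : Matc2)).

Definition Phi_eps (eps : R) (X : Math2) : C :=
  (2 ^+ (d * N)%N * pi ^+ (d * N ^ 2)%N)%:C *
  cexp (- 2^-1 * Matc2_form (complexify X) (K_eps eps (complexify X))).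

End Phi.

(* Main.v *)
(** The kernels [G] of a Hida distribution are paired with the chaos kernels of a
    test function through [sum_n n! <G_n, phi_n>]; a geometric bound on
    [n! |G_n|^2] makes this sum converge absolutely and be dominated by a single
    Hida norm, with a constant that is linear in the bound.  The exponential
    [exp(i<x,y>)] has kernels [exp(-|y|^2/2) (i y)^{(x)n} / n!], so the kernels
    [c (-1/2)^m Q^{(x)m} / m!] (in degree [2m], and [0] in odd degree) have
    T-transform [c exp(-|y|^2/2 + Q(y,y)/2)].  A direct Gaussian integration
    (first over [B], then over [A]) gives
      [T Phi_eps (y) = c (1+eps^2)^{-n/2}
         exp(-(eps |y|^2 / 2 + i (y_1,y_2)) / (1+eps^2)),   n = d N^2,]
    which is of this form for every [eps >= 0].  At [eps = 0] it is the asserted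
    T-transform, and the constants and the entries of [Q] are Lipschitz in [eps]
    at [0], so the difference of the kernels has a bound of order [eps]: this is
    strong convergence.  That the distribution representing [Phi_eps] may be
    computed from its kernels follows from the injectivity of the T-transform,
    which is a power series along rays whose coefficients are the values on the
    Wick powers of [y]; these span all Wick polynomials by polarization. *)

From HB Require Import structures.
Require Import Defs.
From mathcomp Require Import all_boot all_order all_algebra.
From mathcomp Require Import complex.
From mathcomp Require Import all_classical all_reals all_analysis.
From mathcomp Require Import measurable_realfun perm ring lra zify.

Set Implicit Arguments.
Unset Strict Implicit.
Unset Printing Implicit Defensive.

Import Order.TTheory GRing.Theory Num.Theory.
Import numFieldNormedType.Exports.
Import Normc.

Local Open Scope classical_set_scope.
Local Open Scope ring_scope.
Local Open Scope complex_scope.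

(** * Complex sequences and power series *)

(** In nonzero dimension, at [eps = 0] the weight [exp(|x|^2/2)] cancels the Gaussian density, so
    the limit is not an integrable function, and [|Phi_eps|^2] is integrable only for [eps > 1/2].
    For small [eps] there is thus no chaos expansion in L^2 to read the kernels from: they are
    guessed from the T-transform and tied to [Phi_eps] by injectivity. Wick tensors and chaos
    kernels are chosen by [xget] from a defining property, so existence must be shown before
    anything is computed with them. The Wick tensors are then identified by comparing coefficients
    of power series in [t] along the rays [t *: y]. The same device gives the orthogonality
    relations and the characteristic function: the real Laplace transform of a Gaussian pair is
    expanded in Hermite polynomials, without analytic continuation. The weight [2^(n q)] of a Hida
    norm has to pay for the growth of the kernel entries and for the [D^n] entries of a tensor of
    degree [n], [D] being the dimension. Both are geometric in [n], so one [q] suffices. *)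

Section RealSequences.
Variable R : realType.
Implicit Types u v : nat -> R.

Lemma normr_cvg0 u : u @ \oo --> 0 -> (fun n => `|u n|) @ \oo --> 0.
Proof. by move=> h; rewrite -(normr0 R); exact: cvg_norm. Qed.

Lemma cvg_le_dist u v l : (forall n, `|u n - l| <= v n) -> v @ \oo --> 0 ->
  u @ \oo --> l.
Proof.
move=> le h; apply/(subr_cvg0 u l).
have h' : (fun n => - v n) @ \oo --> (0 : R) by rewrite -oppr0; exact: cvgN.
apply: (squeeze_cvgr _ h' h).
by near=> n; rewrite -ler_norml.
Unshelve. all: by end_near. Qed.

Lemma cvg0_le u v : (forall n, 0 <= u n <= v n) -> v @ \oo --> 0 ->
  u @ \oo --> 0.
Proof.
move=> le; apply: cvg_le_dist => n; have /andP[u0 uv] := le n.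
by rewrite subr0 ger0_norm.
Qed.

End RealSequences.

Section ComplexSequences.
Variable R : realType.
Local Notation C := R[i].
Implicit Types (z w : C) (u v a b : nat -> C).

Lemma normc_ge0 z : 0 <= normc z.
Proof. by case: z => x y; exact: sqrtr_ge0. Qed.

Lemma normc_real (x : R) : normc x%:C = `|x|.
Proof. by rewrite /= expr0n /= addr0 sqrtr_sqr. Qed.

Lemma normc_i : normc ('i%C : C) = 1.
Proof. by rewrite /= expr0n /= add0r expr1n sqrtr1. Qed.

Lemma normcX z n : normc (z ^+ n) = normc z ^+ n.
Proof.
by elim: n => [|n IH]; [rewrite !expr0 normc1|rewrite !exprS normcM IH].
Qed.

Lemma sqr_normcE z : normc z ^+ 2 = complex.Re z ^+ 2 + complex.Im z ^+ 2.
Proof. by case: z => x y; rewrite sqr_sqrtr // addr_ge0 // sqr_ge0. Qed.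

Lemma normr_Re_le z : `|complex.Re z| <= normc z.
Proof.
by case: z => x y /=; rewrite -sqrtr_sqr ler_wsqrtr // lerDl sqr_ge0.
Qed.

Lemma normr_Im_le z : `|complex.Im z| <= normc z.
Proof.
by case: z => x y /=; rewrite -sqrtr_sqr ler_wsqrtr // lerDr sqr_ge0.
Qed.

Lemma normc_le_ReIm z : normc z <= `|complex.Re z| + `|complex.Im z|.
Proof.
rewrite -(@ler_pXn2r _ 2) ?nnegrE ?normc_ge0 ?addr_ge0 //.
rewrite sqr_normcE sqrrD !real_normK ?num_real // addrAC lerDl.
by rewrite mulrn_wge0 // mulr_ge0.
Qed.

Lemma normc_sum (I : Type) (r : seq I) (P : pred I) (F : I -> C) :
  normc (\sum_(i <- r | P i) F i) <= \sum_(i <- r | P i) normc (F i).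
Proof.
elim/big_rec2: _ => [|i x y _ le]; first by rewrite normc0.
by apply: (le_trans (le_normcD _ _)); rewrite lerD2l.
Qed.

Lemma normc_distC z w : normc (z - w) = normc (w - z).
Proof. by rewrite -normcN opprB. Qed.

(** Stated through the modulus, so that every limit is one of a real sequence and splits into real
    and imaginary parts. *)
Definition ccvg u (l : C) := (fun n => normc (u n - l)) @ \oo --> (0 : R).

Lemma ccvgP u l : ccvg u l <->
  ((fun n => complex.Re (u n)) @ \oo --> complex.Re l) /\
  ((fun n => complex.Im (u n)) @ \oo --> complex.Im l).
Proof.
split=> [h|[hr hi]]; last first.
  have h : (fun n => `|complex.Re (u n) - complex.Re l| +
                    `|complex.Im (u n) - complex.Im l|) @ \oo --> (0 : R).
    rewrite -(addr0 0); apply: cvgD.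
      by apply: normr_cvg0; apply/(subr_cvg0 (fun n => complex.Re (u n))).
    by apply: normr_cvg0; apply/(subr_cvg0 (fun n => complex.Im (u n))).
  apply: (cvg0_le _ h) => n.
  rewrite normc_ge0 /=; apply: (le_trans (normc_le_ReIm _)).
  by case: (u n) l {h hr hi} => x y [].
have aux (f : C -> R) : (forall n, `|f (u n) - f l| <= normc (u n - l)) ->
    (fun n => f (u n)) @ \oo --> f l.
  by move=> le; exact: cvg_le_dist h.
split; apply: aux => n.
  by apply: le_trans (normr_Re_le _); case: (u n) l {h} => x y [].
by apply: le_trans (normr_Im_le _); case: (u n) l {h} => x y [].
Qed.

Lemma ccvg_unique u l l' : ccvg u l -> ccvg u l' -> l = l'.
Proof.
case: l l' => x y [x' y'] /ccvgP[/= r i] /ccvgP[/= r' i'].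
have e := @norm_hausdorff R R^o.
by rewrite (cvg_unique _ r r') // (cvg_unique _ i i').
Qed.

Lemma complexReD z w : complex.Re (z + w) = complex.Re z + complex.Re w.
Proof. by case: z w => ? ? []. Qed.

Lemma complexImD z w : complex.Im (z + w) = complex.Im z + complex.Im w.
Proof. by case: z w => ? ? []. Qed.

Lemma complexReM z w :
  complex.Re (z * w) = complex.Re z * complex.Re w - complex.Im z * complex.Im w.
Proof. by case: z w => ? ? []. Qed.

Lemma complexImM z w :
  complex.Im (z * w) = complex.Re z * complex.Im w + complex.Im z * complex.Re w.
Proof. by case: z w => ? ? []. Qed.

Lemma ccvgD u v l m : ccvg u l -> ccvg v m -> ccvg (fun n => u n + v n) (l + m).
Proof.
move=> /ccvgP[r i] /ccvgP[r' i']; apply/ccvgP.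
rewrite complexReD complexImD; under eq_fun do rewrite complexReD.
by under [X in _ /\ X @ _ --> _]eq_fun do rewrite complexImD; split; exact: cvgD.
Qed.

Lemma ccvgMl c u l : ccvg u l -> ccvg (fun n => c * u n) (c * l).
Proof.
rewrite /ccvg => h; under eq_fun do rewrite -mulrBr normcM.
by rewrite -(mulr0 (normc c)); apply: cvgM => //; exact: cvg_cst.
Qed.

Lemma ccvgB u v l m : ccvg u l -> ccvg v m -> ccvg (fun n => u n - v n) (l - m).
Proof.
move=> hu hv; rewrite -mulN1r; under [X in ccvg X]eq_fun do rewrite -mulN1r.
by apply: ccvgD => //; exact: ccvgMl.
Qed.

Lemma ccvgM u v l m : ccvg u l -> ccvg v m -> ccvg (fun n => u n * v n) (l * m).
Proof.
move=> /ccvgP[r i] /ccvgP[r' i']; apply/ccvgP.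
rewrite complexReM complexImM; under eq_fun do rewrite complexReM.
under [X in _ /\ X @ _ --> _]eq_fun do rewrite complexImM; split.
  by apply: cvgB; exact: cvgM.
by apply: cvgD; exact: cvgM.
Qed.

Lemma ccvg_normc u l : ccvg u l -> (fun n => normc (u n)) @ \oo --> normc l.
Proof.
move=> h; apply: (cvg_le_dist _ h) => n.
rewrite ler_norml; apply/andP; split.
  rewrite lerNl opprB lerBlDr normc_distC.
  by have := le_normcD (l - u n) (u n); rewrite subrK.
by rewrite lerBlDr; have := le_normcD (u n - l) l; rewrite subrK.
Qed.

Definition csum u n : C := \sum_(k < n) u k.

Lemma Re_sum (I : Type) (r : seq I) (P : pred I) (F : I -> C) :
  complex.Re (\sum_(i <- r | P i) F i) = \sum_(i <- r | P i) complex.Re (F i).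
Proof. exact: raddf_sum. Qed.

Lemma Im_sum (I : Type) (r : seq I) (P : pred I) (F : I -> C) :
  complex.Im (\sum_(i <- r | P i) F i) = \sum_(i <- r | P i) complex.Im (F i).
Proof. exact: raddf_sum. Qed.

Lemma ccvg_sumP u l : ccvg (csum u) l <->
  (series (fun n => complex.Re (u n)) @ \oo --> complex.Re l) /\
  (series (fun n => complex.Im (u n)) @ \oo --> complex.Im l).
Proof.
have -> : series (fun n => complex.Re (u n)) = (fun n => complex.Re (csum u n)).
  by apply/funext => n; rewrite /series /= /csum Re_sum big_mkord.
have -> : series (fun n => complex.Im (u n)) = (fun n => complex.Im (csum u n)).
  by apply/funext => n; rewrite /series /= /csum Im_sum big_mkord.
exact: ccvgP.
Qed.

Lemma bounded_ccvg_csum u (M : R) :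
  (forall n, \sum_(k < n) normc (u k) <= M) -> exists l, ccvg (csum u) l.
Proof.
move=> hM.
have aux (f : C -> R) : (forall z, `|f z| <= normc z) -> cvgn (series (f \o u)).
  move=> fle; apply: normed_cvg.
  apply: (@series_le_cvg _ _ (fun n => normc (u n))) => [n|n|n|] //=.
  - exact: normc_ge0.
  - apply: (@nondecreasing_is_cvgn _ (series (fun n => normc (u n)))).
      by apply/nondecreasing_seqP => n; rewrite /series /= big_nat_recr //= lerDl normc_ge0.
    by exists M => _ [n _ <-]; rewrite /series /= big_mkord.
have := aux _ normr_Re_le; set lr := limn _ => hr.
have := aux _ normr_Im_le; set li := limn _ => hi.
by exists (lr +i* li); apply/ccvg_sumP.
Qed.

Lemma normc_csum_le u l (M : R) :
  (forall n, \sum_(k < n) normc (u k) <= M) -> ccvg (csum u) l -> normc l <= M.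
Proof.
move=> hM h.
have hn := ccvg_normc h.
rewrite -(cvg_lim _ hn) //; apply: limr_le; first by apply/cvg_ex; exists (normc l).
by near=> n; apply: (le_trans (normc_sum _ _ _)).
Unshelve. all: by end_near. Qed.

Lemma ccvg_term0 u l : ccvg (csum u) l -> ccvg u 0.
Proof.
move=> /ccvg_sumP[hr hi]; apply/ccvgP; split.
  by apply: cvg_series_cvg_0; apply/cvg_ex; exists (complex.Re l).
by apply: cvg_series_cvg_0; apply/cvg_ex; exists (complex.Im l).
Qed.

(** Both sides run over the pairs with [i + j < N], by antidiagonals and by rows. *)
Lemma sum_triangle (A : nmodType) (f : nat -> nat -> A) N :
  \sum_(n < N) \sum_(k < n.+1) f k (n - k)%N = \sum_(i < N) \sum_(j < N - i) f i j.
Proof.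
elim: N => [|N IH]; first by rewrite !big_ord0.
rewrite big_ord_recr /= IH [RHS]big_ord_recr /= subSnn.
rewrite [X in _ + X]big_ord_recr /= addrA subnn big_ord1; congr (_ + _).
rewrite -big_split /=; apply: eq_bigr => i _.
by rewrite subSn ?big_ord_recr //= ltnW.
Qed.

(** What remains of the square is the corner [i + j >= N]. *)
Lemma sum_square_sub_triangle (K : pzRingType) (a' b' : nat -> K) N :
  (\sum_(i < N) a' i) * (\sum_(j < N) b' j) -
    \sum_(n < N) \sum_(k < n.+1) a' k * b' (n - k)%N =
  \sum_(i < N) \sum_(N - i <= j < N) a' i * b' j.
Proof.
rewrite (sum_triangle (fun i j => a' i * b' j)) mulr_suml -sumrB.
apply: eq_bigr => i _; rewrite mulr_sumr.
rewrite -!(big_mkord xpredT (fun j => a' i * b' j)).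
by rewrite [X in X - _](@big_cat_nat _ _ _ (N - i)) ?leq_subr //= addrAC subrr add0r.
Qed.

Lemma sum_triangle_le (a' b' : nat -> R) N :
  (forall n, 0 <= a' n) -> (forall n, 0 <= b' n) ->
  \sum_(n < N) \sum_(k < n.+1) a' k * b' (n - k)%N <=
  (\sum_(i < N) a' i) * (\sum_(j < N) b' j).
Proof.
move=> a0 b0; rewrite -subr_ge0 sum_square_sub_triangle.
by do 2 (apply: sumr_ge0 => ? _); rewrite mulr_ge0.
Qed.

(** The difference between the product of the partial sums and the partial sum of the Cauchy product
    lives on the corner [i + j >= N]. Its modulus is bounded by the same corner for the moduli,
    which tends to [0] because square sums and triangle sums of nonnegative terms interlace. *)
Lemma ccvg_cauchy_prod a b (A B : C) (Ma Mb : R) :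
  (forall n, \sum_(k < n) normc (a k) <= Ma) ->
  (forall n, \sum_(k < n) normc (b k) <= Mb) ->
  ccvg (csum a) A -> ccvg (csum b) B ->
  ccvg (csum (fun n => \sum_(k < n.+1) a k * b (n - k)%N)) (A * B).
Proof.
move=> ha hb cA cB.
pose a' n := normc (a n); pose b' n := normc (b n).
have a0 n : 0 <= a' n by exact: normc_ge0.
have b0 n : 0 <= b' n by exact: normc_ge0.
pose S N := (\sum_(i < N) a' i) * (\sum_(j < N) b' j).
pose T N := \sum_(n < N) \sum_(k < n.+1) a' k * b' (n - k)%N.
have Ma0 : 0 <= Ma by have := ha 0%N; rewrite big_ord0.
have T_le N : T N <= S N by exact: sum_triangle_le.
(* Indices below [N] have sum below [2 N], so the square of side [N] fits in the triangle of side
   [2 N]. *)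
have S_le N : S N <= T N.*2.
  rewrite /S /T (sum_triangle (fun i j => a' i * b' j)) mulr_suml.
  rewrite -addnn big_split_ord /= -[leLHS]addr0 lerD //; last first.
    by do 2 (apply: sumr_ge0 => ? _); rewrite mulr_ge0.
  apply: ler_sum => i _; rewrite mulr_sumr.
  have le : (N <= N + N - i)%N by rewrite -addnBA ?leq_addr // ltnW.
  rewrite -!(big_mkord xpredT (fun j => a' i * b' j)).
  rewrite (@big_cat_nat _ _ _ N 0 (N + N - i)) //= lerDl.
  by apply: sumr_ge0 => ? _; rewrite mulr_ge0.
have S_bnd N : S N <= Ma * Mb by rewrite ler_pM ?sumr_ge0.
have T_nd : nondecreasing_seq T.
  apply/nondecreasing_seqP => n; rewrite /T big_ord_recr /= lerDl.
  by apply: sumr_ge0 => ? _; rewrite mulr_ge0.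
have T_cvg : cvgn T.
  apply: nondecreasing_is_cvgn => //.
  by exists (Ma * Mb) => _ [n _ <-]; apply: le_trans (S_bnd n).
have T2_cvg : (fun n => T n.*2) @ \oo --> limn T.
  apply: (@cvg_comp _ _ _ double T \oo \oo) T_cvg.
  by apply/cvgnyPge => n; near=> m; rewrite -addnn; apply: leq_trans (leq_addr _ _); near: m; exact: nbhs_infty_ge.
(* Squeezed by [T (2 n) - T n], whose two terms have the same limit. *)
have D_cvg : (fun n => S n - T n) @ \oo --> (0 : R).
  have h : (fun n => T n.*2 - T n) @ \oo --> (0 : R).
    by rewrite -(subrr (limn T)); exact: cvgB.
  by apply: (cvg0_le _ h) => n; rewrite subr_ge0 T_le lerB.
have E_cvg : ccvg (fun n => csum a n * csum b n -
    csum (fun n => \sum_(k < n.+1) a k * b (n - k)%N) n) 0.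
  apply: (cvg0_le _ D_cvg) => n.
  rewrite normc_ge0 subr0 /= /csum sum_square_sub_triangle /S /T.
  rewrite sum_square_sub_triangle.
  apply: (le_trans (normc_sum _ _ _)); apply: ler_sum => i _.
  apply: (le_trans (normc_sum _ _ _)); apply: ler_sum => j _.
  by rewrite normcM.
have := ccvgB (ccvgM cA cB) E_cvg; rewrite subr0.
by under [X in ccvg X]eq_fun do rewrite opprB addrC subrK.
Unshelve. all: by end_near. Qed.

Lemma sum_exp_coeff_le (x : R) n : 0 <= x -> \sum_(k < n) x ^+ k / k`!%:R <= expR x.
Proof.
move=> x0; have := @nondecreasing_cvgn_le _ (series (exp_coeff x)) _ _ n.
rewrite /series /= big_mkord /exp_coeff /=; apply; last exact: is_cvg_series_exp_coeff.
apply/nondecreasing_seqP => m; rewrite big_nat_recr //= lerDl.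
exact: exp_coeff_ge0.
Qed.

Definition cexp_coeff z n : C := z ^+ n / n`!%:R.

Lemma normc_nat n : normc (n%:R : C) = n%:R.
Proof. by rewrite -[n%:R](rmorph_nat (real_complex R)) normc_real normr_nat. Qed.

Lemma normc_cexp_coeff z n : normc (cexp_coeff z n) = normc z ^+ n / n`!%:R.
Proof. by rewrite normcM normcX normcV normc_nat. Qed.

Lemma sum_normc_cexp_coeff z n :
  \sum_(k < n) normc (cexp_coeff z k) <= expR (normc z).
Proof.
under eq_bigr do rewrite normc_cexp_coeff.
exact: sum_exp_coeff_le (normc_ge0 z).
Qed.

Lemma cexp_coeffD z w n :
  cexp_coeff (z + w) n = \sum_(k < n.+1) cexp_coeff z k * cexp_coeff w (n - k).
Proof.
rewrite /cexp_coeff addrC exprDn mulr_suml.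
apply: eq_bigr => -[i /= lt_in] _.
have fn0 m : m`!%:R != 0 :> C by rewrite pnatr_eq0 -lt0n fact_gt0.
have := bin_fact (lt_in : (i <= n)%N).
have := fn0 (n - i)%N; have := fn0 i; have := fn0 n.
move: (n`!) (i`!) ((n - i)`!) ('C(n, i)) => a b c e a0 b0 c0 E.
rewrite -mulr_natr.
have {}E : e%:R * (b%:R * c%:R) = a%:R :> C by rewrite -!natrM E.
have e0 : e%:R != 0 :> C by apply: contra_neq a0 => e0; rewrite -E e0 mul0r.
rewrite -E.
move: (w ^+ _) (z ^+ _) b0 c0 e0 => p q.
move: (_%:R) (_%:R) (_%:R) => x y t b0 c0 e0.
by field; rewrite b0 c0 e0.
Qed.

Lemma cexp_coeff_real (x : R) n : cexp_coeff x%:C n = (exp_coeff x n)%:C.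
Proof. by rewrite /cexp_coeff /exp_coeff /= rmorphM rmorphXn fmorphV rmorph_nat. Qed.

Lemma ccvg_cexp_real (x : R) : ccvg (csum (cexp_coeff x%:C)) (expR x)%:C.
Proof.
apply/ccvg_sumP; split.
  by under eq_fun do rewrite cexp_coeff_real /=; exact: is_cvg_series_exp_coeff.
under eq_fun do rewrite cexp_coeff_real /=.
rewrite (_ : series _ = fun=> 0); first exact: cvg_cst.
by apply/funext => n; rewrite /series /= big1.
Qed.

Lemma expr_i n : ('i%C : C) ^+ n =
  (~~ odd n)%:R * (-1) ^+ n./2 + 'i%C * ((odd n)%:R * (-1) ^+ n./2).
Proof.
rewrite -{1}(odd_double_half n) exprD -mul2n exprM complex.sqr_i.
by case: (odd n); rewrite /= ?expr1 ?expr0; ring.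
Qed.

Lemma cexp_coeff_im (x : R) n : cexp_coeff ('i%C * x%:C) n = cos_coeff x n +i* sin_coeff x n.
Proof.
rewrite /cexp_coeff exprMn expr_i /cos_coeff /sin_coeff /=.
have -> : (-1) ^+ n./2 = ((-1) ^+ n./2)%:C :> C by rewrite rmorphXn rmorphN1.
rewrite -!(rmorph_nat (real_complex R)) -rmorphXn -!fmorphV.
case: n => [|n] /=; first by apply/eqP; rewrite eq_complex /=; apply/andP; split; apply/eqP; ring.
rewrite uphalf_half; case: (odd n) => /=; rewrite ?add0n ?add1n; apply/eqP; rewrite eq_complex /=; apply/andP; split; apply/eqP; rewrite ?(mul0r,mul1r,add0r,subr0,mulr0,addr0); ring.
Qed.

(** [cexp] is defined from [expR], [cos] and [sin]; this identifies it with the exponential series,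
    by a Cauchy product of the series at the real and imaginary parts. Additivity then comes from
    Cauchy products as well. *)
Lemma ccvg_cexp z : ccvg (csum (cexp_coeff z)) (cexp z).
Proof.
case: z => x y.
have -> : cexp (x +i* y) = (expR x)%:C * (cos y +i* sin y) by [].
have -> : x +i* y = x%:C + 'i%C * y%:C.
  by apply/eqP; rewrite eq_complex /=; apply/andP; split; apply/eqP; ring.
rewrite (funext (cexp_coeffD _ _)).
apply: (ccvg_cauchy_prod (sum_normc_cexp_coeff _) (sum_normc_cexp_coeff _)).
  exact: ccvg_cexp_real.
apply/ccvg_sumP; split; under eq_fun do rewrite cexp_coeff_im /=.
  by rewrite cos.unlock; exact: is_cvg_series_cos_coeff.
by rewrite sin.unlock; exact: is_cvg_series_sin_coeff.
Qed.

Lemma cexpD z w : cexp (z + w) = cexp z * cexp w.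
Proof.
apply: (ccvg_unique (ccvg_cexp _)).
rewrite (funext (cexp_coeffD _ _)).
by apply: (ccvg_cauchy_prod (sum_normc_cexp_coeff _) (sum_normc_cexp_coeff _));
  exact: ccvg_cexp.
Qed.

Lemma cexp_real (x : R) : cexp x%:C = (expR x)%:C.
Proof. exact: ccvg_unique (ccvg_cexp _) (ccvg_cexp_real _). Qed.

Lemma cexp0 : cexp (0 : C) = 1.
Proof. by rewrite -[0](rmorph0 (real_complex R)) cexp_real expR0. Qed.

Lemma normc_cexp z : normc (cexp z) = expR (complex.Re z).
Proof.
rewrite /cexp normcM normc_real ger0_norm ?expR_ge0 //=.
by rewrite cos2Dsin2 sqrtr1 mulr1.
Qed.

End ComplexSequences.

(** * Comparison of coefficients, and Hermite polynomials through their generating function *)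

Section PowerSeries.
Variable R : realType.
Local Notation C := R[i].
Implicit Types (z s : C) (u v t : R) (a b : nat -> C).

Lemma geometric_half_le n : \sum_(k < n) (2^-1 : R) ^+ k <= 2.
Proof.
suff -> : \sum_(k < n) (2^-1 : R) ^+ k = 2 - 2 * 2^-1 ^+ n.
  by rewrite gerBl mulr_ge0 // exprn_ge0 // invr_ge0.
elim: n => [|n IH]; first by rewrite big_ord0 expr0; ring.
by rewrite big_ord_recr /= IH exprS; field.
Qed.

Lemma ccvg_eq a b (l : C) : a =1 b -> ccvg a l -> ccvg b l.
Proof. by move=> /funext ->. Qed.

Lemma ccvg_shift b l n : ccvg b l -> ccvg (fun k => b (n + k)%N) l.
Proof.
rewrite /ccvg => h; under eq_fun do rewrite addnC.
by move: h; rewrite -(cvg_shiftn n).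
Qed.

(** Convergence at [t = 1] bounds all coefficients by some [B]. For [t <= 1/2] the terms of positive
    degree then add up to at most [2 B t] by a geometric series, and [t] tends to [0]. *)
Lemma power_series_coef0 b :
  (forall t, 0 < t -> ccvg (csum (fun n => t%:C ^+ n * b n)) 0) -> b 0 = 0.
Proof.
move=> h.
have [B hB] : exists B : R, forall n, normc (b n) <= B.
  have /ccvg_term0 := h 1 ltr01.
  under [X in ccvg X]eq_fun do rewrite expr1n mul1r.
  move=> /ccvg_normc; rewrite normc0 => h0.
  have /cvg_seq_bounded : cvgn (fun n => normc (b n)).
    by apply/cvg_ex; exists 0.
  case=> M [_ hM]; exists (M + 1) => n.
  have := hM (M + 1); rewrite ltrDl ltr01 => /(_ isT n I) /=.
  by rewrite ger0_norm ?normc_ge0.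
have B0 : 0 <= B := le_trans (normc_ge0 _) (hB 0%N).
have bnd t : 0 < t -> t <= 2^-1 -> normc (b 0%N) <= 2 * B * t.
  move=> t0 t2.
  have bn N : normc (b 0%N) <= normc (csum (fun n => t%:C ^+ n * b n) N.+1) + 2 * B * t.
    rewrite /csum big_ord_recl /= expr0 mul1r.
    set r := \sum_(_ < _) _.
    have -> : b 0%N = (b 0%N + r) + - r by rewrite addrK.
    apply: (le_trans (le_normcD _ _)); rewrite addrK lerD2l normcN.
    apply: (le_trans (normc_sum _ _ _)).
    apply: (@le_trans _ _ (\sum_(i < N) 2^-1 ^+ i * (B * t))).
      apply: ler_sum => i _; rewrite normcM normcX normc_real (ger0_norm (ltW t0)).
      rewrite /bump add1n exprSr -mulrA [B * t]mulrC.
      have t0' := ltW t0; apply: ler_pM; rewrite ?exprn_ge0 ?mulr_ge0 ?normc_ge0 //.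
        by rewrite lerXn2r // nnegrE // invr_ge0.
      exact: ler_wpM2l.
    rewrite -mulr_suml -mulrA ler_wpM2r ?geometric_half_le //.
    by rewrite mulr_ge0 // ltW.
  have /ccvg_normc := h t t0; rewrite normc0 => c0.
  have c1 : (fun N => normc (csum (fun n => t%:C ^+ n * b n) N.+1) + 2 * B * t) @ \oo --> 2 * B * t.
    rewrite -[X in _ --> X]add0r; apply: cvgD; last exact: cvg_cst.
    by move: c0; rewrite -cvg_shiftS.
  rewrite -(cvg_lim _ c1) //; apply: limr_ge; first by apply/cvg_ex; exists (2 * B * t).
  by near=> N.
apply: eq0_normc; apply/eqP; rewrite eq_le normc_ge0 andbT.
apply/ler_addgt0Pl => e e0; rewrite addr0.
have D0 : 0 < 2 * B + 1 by rewrite ltr_wpDl // mulr_ge0.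
(* The cap [1/2] is for the geometric series; the [+ 1] keeps the denominator positive when
   [B = 0]. *)
pose t := Num.min 2^-1 (e / (2 * B + 1)).
have t0 : 0 < t by rewrite lt_min invr_gt0 ltr0n /= divr_gt0.
apply: (le_trans (bnd t t0 _)); first by rewrite ge_min lexx.
have : t <= e / (2 * B + 1) by rewrite ge_min lexx orbT.
rewrite ler_pdivlMr // mulrC mulrDl mul1r => le.
by apply: le_trans le; rewrite lerDl ltW.
Unshelve. all: by end_near. Qed.

(** Strong induction: once the coefficients below [n] vanish, dividing by [t ^+ n] makes [a n] the
    constant term. Only [t > 0] is required, as sums are later known along rays. *)
Lemma power_series_eq0 a :
  (forall t, 0 < t -> ccvg (csum (fun n => t%:C ^+ n * a n)) 0) ->
  forall n, a n = 0.
Proof.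
move=> h n; have [m] := ubnP n; elim: m n => // m IH n; rewrite ltnS => nm.
have := @power_series_coef0 (fun k => a (n + k)%N); rewrite addn0; apply=> t t0.
have tn0 : t%:C ^+ n != 0 :> C.
  by rewrite expf_neq0 // -(rmorph0 (real_complex R)) (inj_eq (@complexI R)) gt_eqF.
have := ccvgMl (t%:C ^- n) (ccvg_shift n (h t t0)); rewrite mulr0.
apply: ccvg_eq => N; rewrite /csum big_split_ord /= big1 => [|i _]; last first.
  by rewrite IH ?mulr0 //; apply: leq_trans nm.
rewrite add0r mulr_sumr; apply: eq_bigr => i _.
by rewrite exprD mulrA mulrA mulVf // mul1r.
Qed.

(* The coefficients of [f (t^2)] when [c] are those of [f t]. *)
Definition evencoef (A : nmodType) (c : nat -> A) n : A :=
  if odd n then 0 else c n./2.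

Lemma sum_evencoef (A : nmodType) (c : nat -> A) n :
  \sum_(k < n) evencoef c k = \sum_(k < uphalf n) c k.
Proof.
elim: n => [|n IH]; first by rewrite !big_ord0.
rewrite big_ord_recr /= IH /evencoef uphalf_half; case: (odd n) => /=.
  by rewrite addr0.
by rewrite add0n big_ord_recr.
Qed.

Lemma ccvg_evencoef a l : ccvg (csum a) l -> ccvg (csum (evencoef a)) l.
Proof.
move=> h; rewrite /ccvg.
have -> : csum (evencoef a) = csum a \o uphalf by apply/funext => n; exact: sum_evencoef.
apply: (@cvg_comp _ _ _ uphalf (fun n => normc (csum a n - l)) \oo \oo) h.
apply/cvgnyPge => n; near=> m.
have : (n.*2 <= m)%N by near: m; exact: nbhs_infty_ge.
by move=> /half_leq; rewrite doubleK uphalf_half => /leq_trans; apply; exact: leq_addl.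
Unshelve. all: by end_near. Qed.

(* The coefficients of [exp (t u - t^2 v / 2)]: Hermite polynomials over [n!]. *)
Definition hcoef u v n : R :=
  \sum_(k < n.+1) exp_coeff u k * evencoef (exp_coeff (- v / 2)) (n - k).

Lemma exp_coeffM t u n : exp_coeff (t * u) n = t ^+ n * exp_coeff u n.
Proof. by rewrite /exp_coeff /= exprMn mulrA. Qed.

Lemma evencoef_scale (K : pzRingType) (x : K) (c : nat -> K) n :
  x ^+ n * evencoef c n = evencoef (fun k => x ^+ 2 ^+ k * c k) n.
Proof.
rewrite /evencoef; case: ifP => on; first by rewrite mulr0.
by congr (_ * _); rewrite -exprM mul2n -{1}(odd_double_half n) on.
Qed.

(** Homogeneity, with [v] counted twice: replacing [y] by [t *: y] multiplies the degree [n] part by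
    [t ^+ n], so functions on a ray become power series in [t]. *)
Lemma hcoef_scale t u v n : hcoef (t * u) (t ^+ 2 * v) n = t ^+ n * hcoef u v n.
Proof.
rewrite /hcoef mulr_sumr; apply: eq_bigr => -[k /= kn] _.
rewrite -{2}(subnKC (kn : (k <= n)%N)) exprD exp_coeffM mulrACA; congr (_ * _).
rewrite (evencoef_scale t _ (n - k)) /evencoef; case: ifP => //= _.
by rewrite mulrA -exprMn; congr (_ ^+ _ / _); ring.
Qed.

Lemma cexp_coeffM z s n : cexp_coeff (z * s) n = z ^+ n * cexp_coeff s n.
Proof. by rewrite /cexp_coeff exprMn mulrA. Qed.

(** The parameter [s] is complex although [u] and [v] are real: real [s] gives the Laplace side,
    imaginary [s] the Fourier side. *)
Lemma hcoef_prod s u v n : s ^+ n * (hcoef u v n)%:C =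
  \sum_(k < n.+1) cexp_coeff (s * u%:C) k *
    evencoef (cexp_coeff (- (s ^+ 2 * (v / 2)%:C))) (n - k).
Proof.
rewrite /hcoef rmorph_sum mulr_sumr; apply: eq_bigr => -[k /= kn] _.
rewrite -{1}(subnKC (kn : (k <= n)%N)) exprD rmorphM /= cexp_coeffM cexp_coeff_real.
rewrite mulrACA; congr (_ * _).
have -> : (evencoef (exp_coeff (- v / 2)) (n - k))%:C =
          evencoef (cexp_coeff (- (v / 2)%:C)) (n - k) :> C.
  rewrite /evencoef; case: ifP => //= _.
  by rewrite -rmorphN cexp_coeff_real mulNr.
rewrite (evencoef_scale s _ (n - k)) /evencoef; case: ifP => //= _.
by rewrite -cexp_coeffM mulrN.
Qed.

Lemma ccvg_hcoef s u v :
  ccvg (csum (fun n => s ^+ n * (hcoef u v n)%:C))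
       (cexp (s * u%:C - s ^+ 2 * (v / 2)%:C)).
Proof.
rewrite (funext (hcoef_prod s u v)) cexpD.
apply: (@ccvg_cauchy_prod _ _ _ _ _ (expR (normc (s * u%:C))) (expR (normc (s ^+ 2 * (v / 2)%:C)))).
- exact: sum_normc_cexp_coeff.
- move=> n; under eq_bigr => k _.
    rewrite (_ : normc _ = evencoef (fun m => normc (cexp_coeff (- (s ^+ 2 * (v / 2)%:C)) m)) k).
      over.
    by rewrite /evencoef; case: ifP => // _; rewrite normc0.
  rewrite sum_evencoef -(normcN (s ^+ 2 * _)); exact: sum_normc_cexp_coeff.
- exact: ccvg_cexp.
- by apply: ccvg_evencoef; exact: ccvg_cexp.
Qed.

(** Taking moduli in the Cauchy product turns [- v] into [v]. The bound is uniform in [n] and, for a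
    Gaussian [u], integrable, so it serves as majorant in every later dominated convergence over
    Hermite series. *)
Lemma sum_hcoef_le s u v n : 0 <= v ->
  \sum_(k < n) normc (s ^+ k * (hcoef u v k)%:C) <=
  expR (normc s * `|u|) * expR (normc s ^+ 2 * (v / 2)).
Proof.
pose a' j := normc (cexp_coeff (s * u%:C) j).
pose b' := evencoef (fun m => normc (cexp_coeff (- (s ^+ 2 * (v / 2)%:C)) m)).
move=> v0; under eq_bigr do rewrite hcoef_prod.
apply: (@le_trans _ _ (\sum_(k < n) \sum_(j < k.+1) a' j * b' (k - j)%N)).
  apply: ler_sum => k _; apply: (le_trans (normc_sum _ _ _)).
  apply: ler_sum => j _; rewrite normcM /a' /b' /evencoef.
  by case: ifP => // _; rewrite normc0.
apply: (le_trans (@sum_triangle_le _ a' b' _ _ _)) => [m|m|].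
- exact: normc_ge0.
- by rewrite /b' /evencoef; case: ifP => // _; exact: normc_ge0.
rewrite /b' sum_evencoef; apply: ler_pM.
- by apply: sumr_ge0 => ? _; exact: normc_ge0.
- by apply: sumr_ge0 => ? _; exact: normc_ge0.
- by apply: (le_trans (sum_normc_cexp_coeff _ _)); rewrite normcM normc_real.
apply: (le_trans (sum_normc_cexp_coeff _ _)).
by rewrite normcN normcM normcX normc_real ger0_norm // divr_ge0.
Qed.

Lemma ccvg_hcoef_real t u v :
  series (fun n => t ^+ n * hcoef u v n) @ \oo --> expR (t * u - t ^+ 2 * (v / 2)).
Proof.
have := ccvg_hcoef t%:C u v.
have -> : t%:C * u%:C - t%:C ^+ 2 * (v / 2)%:C = (t * u - t ^+ 2 * (v / 2))%:C.
  by rewrite rmorphB (rmorphM _ t u) (rmorphM _ (t ^+ 2)) (rmorphXn _ 2%N t).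
rewrite cexp_real => /ccvg_sumP[+ _].
have -> : (fun n => complex.Re (t%:C ^+ n * (hcoef u v n)%:C)) =
          (fun n => t ^+ n * hcoef u v n).
  by apply/funext => n; rewrite -rmorphXn -rmorphM.
by [].
Qed.

Lemma sum_hcoef_real_le t u v n : 0 <= v ->
  \sum_(k < n) `|t ^+ k * hcoef u v k| <=
  expR (`|t| * `|u|) * expR (t ^+ 2 * (v / 2)).
Proof.
move=> v0; have := @sum_hcoef_le t%:C u v n v0.
rewrite normc_real real_normK ?num_real //.
by under eq_bigr do rewrite -rmorphXn -rmorphM normc_real.
Qed.

End PowerSeries.

(** * Real and complex integrals *)

Section RealIntegrals.
Context d (T : measurableType d) (R : realType).
Variable mu : {measure set T -> \bar R}.
Implicit Types (f g : T -> R).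

Definition integ f := mu.-integrable setT (EFin \o f).
Local Notation I f := (Rintegral mu setT f).
Local Notation mfun f := (measurable_fun setT f).

Lemma integ_mfun f : integ f -> mfun f.
Proof. by move=> /integrableP[/measurable_EFinP]. Qed.

Lemma Rintegral_EFin f : integ f -> (\int[mu]_x (f x)%:E)%E = (I f)%:E.
Proof. by move=> h; rewrite /Rintegral fineK // integrable_fin_num. Qed.

Lemma integD f g : integ f -> integ g -> integ (fun x => f x + g x).
Proof. by move=> hf hg; have := integrableD measurableT hf hg. Qed.

Lemma integZ (k : R) f : integ f -> integ (fun x => k * f x).
Proof. by move=> hf; have := integrableZl measurableT k hf. Qed.

Lemma integN f : integ f -> integ (fun x => - f x).
Proof.
by move=> /(integZ (-1)); congr integ; apply/funext => x; rewrite mulN1r.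
Qed.

Lemma integB f g : integ f -> integ g -> integ (fun x => f x - g x).
Proof. by move=> hf hg; apply: integD => //; exact: integN. Qed.

Lemma integ_le f g : mfun f -> (forall x, `|f x| <= g x) -> integ g -> integ f.
Proof.
move=> mf le; apply: le_integrable => //; first exact/measurable_EFinP.
by move=> x _ /=; rewrite lee_fin (le_trans (le x)) // ler_norm.
Qed.

Lemma integ0 : integ (fun=> 0).
Proof. exact: integrable0. Qed.

Lemma measurable_sum_fun (J : Type) (s : seq J) (P : pred J) (F : J -> T -> R) :
  (forall j, P j -> mfun (F j)) -> mfun (fun x => \sum_(j <- s | P j) F j x).
Proof.
move=> h; elim: s => [|j s IH].
  by under eq_fun do rewrite big_nil; exact: measurable_cst.
case Pj: (P j); under eq_fun do rewrite big_cons Pj //; last exact: IH.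
by apply: measurable_funD => //; exact: h.
Qed.

Lemma integ_sum (J : Type) (s : seq J) (P : pred J) (F : J -> T -> R) :
  (forall j, P j -> integ (F j)) -> integ (fun x => \sum_(j <- s | P j) F j x).
Proof.
move=> h; elim: s => [|j s IH].
  by under eq_fun do rewrite big_nil; exact: integ0.
case Pj: (P j); under eq_fun do rewrite big_cons Pj //; last exact: IH.
by apply: integD => //; exact: h.
Qed.

Lemma Rintegral_sum (J : Type) (s : seq J) (P : pred J) (F : J -> T -> R) :
  (forall j, P j -> integ (F j)) ->
  I (fun x => \sum_(j <- s | P j) F j x) = \sum_(j <- s | P j) I (F j).
Proof.
move=> h; elim: s => [|j s IH].
  rewrite big_nil -[RHS](fine0) -(integral0 mu setT); congr fine.
  by apply: eq_integral => x _; rewrite big_nil.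
rewrite big_cons -IH; case: ifP => Pj; last first.
  by congr fine; apply: eq_integral => x _; rewrite big_cons Pj.
rewrite -RintegralD //; last by apply: integ_sum.
  by congr fine; apply: eq_integral => x _; rewrite big_cons Pj.
exact: h.
Qed.

Lemma mfun_expR f : mfun f -> mfun (fun x => expR (f x)).
Proof. by move=> h; apply: measurableT_comp. Qed.

Lemma mfunZ (k : R) f : mfun f -> mfun (fun x => k * f x).
Proof. by move=> h; apply: measurable_funM. Qed.

Lemma mfun_cos f : mfun f -> mfun (fun x => cos (f x)).
Proof.
move=> h; apply: (measurableT_comp _ h).
by apply: continuous_measurable_fun; exact: continuous_cos.
Qed.

Lemma mfun_sin f : mfun f -> mfun (fun x => sin (f x)).
Proof.
move=> h; apply: (measurableT_comp _ h).
by apply: continuous_measurable_fun; exact: continuous_sin.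
Qed.

Lemma mfun_hcoef f (v : R) n : mfun f -> mfun (fun x => hcoef (f x) v n).
Proof.
move=> h; apply: measurable_sum_fun => k _; apply: measurable_funM => //.
by apply: measurable_funM => //; exact: measurable_funX.
Qed.

(** Termwise integration: [g] dominates all absolute partial sums, hence also each single term, and
    dominated convergence is applied to the partial sums. *)
Lemma series_dominated (a : nat -> T -> R) f g :
  (forall n, mfun (a n)) -> integ g ->
  (forall x n, \sum_(k < n) `|a k x| <= g x) ->
  (forall x, series (a^~ x) @ \oo --> f x) ->
  [/\ integ f, forall n, integ (a n) &
      series (fun n => I (a n)) @ \oo --> I f].
Proof.
move=> ma ig le cv.
pose s n x := \sum_(k < n) a k x.
have ms n : mfun (s n) by apply: measurable_sum_fun.
have les x n : `|s n x| <= g x.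
  by apply: (le_trans _ (le x n)); exact: ler_norm_sum.
have ia n : integ (a n).
  apply: (integ_le _ _ ig) => // x; apply: (le_trans _ (le x n.+1)).
  by rewrite big_ord_recr /= lerDr sumr_ge0.
have cvs x : s^~ x @ \oo --> f x.
  have -> : s^~ x = series (a^~ x); last exact: cv.
  by apply/funext => n; rewrite /series /= big_mkord.
have mf : mfun f by apply: (measurable_fun_cvg ms) => x _; exact: cvs.
have ms' n : measurable_fun setT (fun x => (s n x)%:E) by exact/measurable_EFinP.
have mf' : measurable_fun setT (EFin \o f) by exact/measurable_EFinP.
have cvs' : {ae mu, forall x, setT x -> (fun n => (s n x)%:E) @ \oo --> (EFin \o f) x}.
  by apply: aeW => x _ /=; apply: cvg_EFin; [exact: nearW|exact: cvs].
have les' : {ae mu, forall x, forall n, setT x -> (`|(s n x)%:E| <= (EFin \o g) x)%E}.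
  by apply: aeW => x n _ /=; rewrite lee_fin.
have [if_ _ cvI] := dominated_convergence measurableT ms' mf' cvs' ig les'.
split=> //; have -> : series (fun n => I (a n)) =
    fine \o (fun n => \int[mu]_x (s n x)%:E)%E.
  apply/funext => n /=; rewrite /series /= big_mkord -Rintegral_sum //.
by apply: fine_cvg; rewrite -Rintegral_EFin.
Qed.

End RealIntegrals.

Lemma power_series_inj (R : realType) (a b : nat -> R) (l : R -> R) :
  (forall t, 0 < t -> series (fun n => t ^+ n * a n) @ \oo --> l t) ->
  (forall t, 0 < t -> series (fun n => t ^+ n * b n) @ \oo --> l t) -> a =1 b.
Proof.
move=> ha hb n; apply/eqP; rewrite -subr_eq0 -(inj_eq (@complexI R)) rmorph0; apply/eqP.
apply: (@power_series_eq0 _ (fun n => (a n - b n)%:C)) => t t0.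
have E : (fun n => t%:C ^+ n * (a n - b n)%:C) = (fun n => (t ^+ n * a n - t ^+ n * b n)%:C).
  by apply/funext => m; rewrite -mulrBr rmorphM rmorphXn.
rewrite E; apply/ccvg_sumP; split => /=; last first.
  rewrite (_ : series _ = fun=> 0); first exact: cvg_cst.
  by apply/funext => m; rewrite /series /= big1.
rewrite -(subrr (l t)).
have -> : series (fun n => t ^+ n * a n - t ^+ n * b n) =
   (fun m => series (fun n => t ^+ n * a n) m - series (fun n => t ^+ n * b n) m).
  by apply/funext => m; rewrite /series /= -sumrB.
by apply: cvgB; [exact: ha|exact: hb].
Qed.

Lemma cvg_exp_series (R : realType) (t x : R) :
  series (fun n => t ^+ n * (x ^+ n / n`!%:R)) @ \oo --> expR (t * x).
Proof.
have -> : (fun n => t ^+ n * (x ^+ n / n`!%:R)) = exp_coeff (t * x).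
  by apply/funext => n; rewrite exp_coeffM.
exact: is_cvg_series_exp_coeff.
Qed.

(** * Orthogonality of Hermite polynomials of two jointly Gaussian variables *)

Section GaussianPair.
Context d (T : measurableType d) (R : realType) (P : probability T R).
Variables (X Y : T -> R) (vx vy c : R).
Hypotheses (mX : measurable_fun setT X) (mY : measurable_fun setT Y).
Hypotheses (vx0 : 0 <= vx) (vy0 : 0 <= vy).
Hypothesis mgf : forall s t : R, (\int[P]_x (expR (s * X x + t * Y x))%:E =
  (expR (s ^+ 2 * (vx / 2) + s * t * c + t ^+ 2 * (vy / 2)))%:E)%E.
Local Notation I f := (Rintegral P setT f).

Lemma integ_exp (s t : R) : integ P (fun x => expR (s * X x + t * Y x)).
Proof.
apply/integrableP; split.
  apply/measurable_EFinP; apply: mfun_expR.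
  by apply: measurable_funD; exact: mfunZ.
under eq_integral do rewrite /= ger0_norm ?expR_ge0 //.
by rewrite mgf ltry.
Qed.

Lemma expR_abs_le (a x : R) : 0 <= a -> expR (a * `|x|) <= expR (a * x) + expR (- a * x).
Proof.
move=> a0; case: (ler0P x) => x0; last by rewrite lerDl expR_ge0.
by rewrite mulrN mulNr lerDr expR_ge0.
Qed.

(** Each factor is at most the sum of the exponentials with both signs, so four instances of the
    moment generating function suffice. *)
Lemma integ_exp_abs (a b : R) : 0 <= a -> 0 <= b ->
  integ P (fun x => expR (a * `|X x|) * expR (b * `|Y x|)).
Proof.
move=> a0 b0.
pose g x := (expR (a * X x + b * Y x) + expR (a * X x + - b * Y x)) +
            (expR (- a * X x + b * Y x) + expR (- a * X x + - b * Y x)).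
have ig : integ P g by do 2 apply: integD; exact: integ_exp.
apply: (integ_le _ _ ig) => [|x].
  by apply: measurable_funM; apply: mfun_expR; apply: mfunZ; exact: measurableT_comp.
rewrite ger0_norm ?mulr_ge0 ?expR_ge0 // /g !expRD -!mulrDr -mulrDl.
by apply: ler_pM; rewrite ?expR_ge0 // expR_abs_le.
Qed.

(** A single term of the absolute generating series at [t = 1]. *)
Lemma hcoef_abs_le (u v : R) n : 0 <= v -> `|hcoef u v n| <= expR (1 * `|u|) * expR (v / 2).
Proof.
move=> v0; have := @sum_hcoef_real_le _ 1 u v n.+1 v0.
rewrite normr1 expr1n !mul1r; apply: le_trans.
by rewrite big_ord_recr /= expr1n mul1r lerDr sumr_ge0.
Qed.

(* Multiplied by [s ^+ m] and summed over [m], both sides are [expR (s * (t * c))]. *)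
Lemma E_hcoef_exp (t : R) m :
  integ P (fun x => hcoef (X x) vx m * expR (t * Y x - t ^+ 2 * (vy / 2))) /\
  I (fun x => hcoef (X x) vx m * expR (t * Y x - t ^+ 2 * (vy / 2))) =
  (t * c) ^+ m / m`!%:R.
Proof.
pose e x := expR (t * Y x - t ^+ 2 * (vy / 2)).
have me : measurable_fun setT e.
  by apply: mfun_expR; apply: measurable_funB => //; exact: mfunZ.
have main s : 0 < s ->
    (forall n, integ P (fun x => s ^+ n * hcoef (X x) vx n * e x)) /\
    series (fun n => I (fun x => s ^+ n * hcoef (X x) vx n * e x)) @ \oo --> expR (s * (t * c)).
  move=> s0.
  have := @series_dominated _ _ _ P (fun n x => s ^+ n * hcoef (X x) vx n * e x)
    (fun x => expR (s * X x - s ^+ 2 * (vx / 2)) * e x)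
    (fun x => (expR (s ^+ 2 * (vx / 2)) * expR (- (t ^+ 2 * (vy / 2)))) *
       (expR (s * `|X x|) * expR (`|t| * `|Y x|))).
  case.
  - by move=> n; apply: measurable_funM => //; apply: mfunZ; exact: mfun_hcoef.
  - by apply: integZ; apply: integ_exp_abs => //; exact: ltW.
  - move=> x n; under eq_bigr do rewrite normrM.
    rewrite -mulr_suml (ger0_norm (expR_ge0 _)) /e.
    apply: (@le_trans _ _ ((expR (s * `|X x|) * expR (s ^+ 2 * (vx / 2))) *
      (expR (`|t| * `|Y x|) * expR (- (t ^+ 2 * (vy / 2)))))); last first.
      by rewrite le_eqVlt; apply/orP; left; apply/eqP; ring.
    apply: ler_pM; rewrite ?sumr_ge0 ?expR_ge0 //.
      by have := @sum_hcoef_real_le _ s (X x) vx n vx0; rewrite (gtr0_norm s0).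
    rewrite expRD ler_wpM2r ?expR_ge0 // ler_expR -normrM; exact: ler_norm.
  - move=> x; have := @ccvg_hcoef_real _ s (X x) vx => h.
    have -> : series (fun n => s ^+ n * hcoef (X x) vx n * e x) =
       (fun N => series (fun n => s ^+ n * hcoef (X x) vx n) N * e x).
      by apply/funext => N; rewrite /series /= mulr_suml.
    by apply: cvgM => //; exact: cvg_cst.
  move=> ig ia cv; split=> //.
  (* The subtracted variance terms cancel those of [mgf]; only the mixed term [s * t * c]
     survives. *)
  have E : I (fun x => expR (s * X x - s ^+ 2 * (vx / 2)) * e x) = expR (s * (t * c)).
    pose k := expR (- (s ^+ 2 * (vx / 2)) - t ^+ 2 * (vy / 2)).
    transitivity (I (fun x => k * expR (s * X x + t * Y x))).
      congr fine; apply: eq_integral => x _; congr EFin.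
      by rewrite /e /k -!expRD; congr expR; ring.
    rewrite RintegralZl //; last exact: integ_exp.
    by rewrite /Rintegral mgf /= /k -expRD; congr expR; field.
  by rewrite -E.
have i1 n : integ P (fun x => hcoef (X x) vx n * e x).
  have [/(_ n) + _] := main 1 ltr01.
  by congr integ; apply/funext => x; rewrite expr1n mul1r.
split; first exact: i1.
apply: (@power_series_inj _ (fun m => I (fun x => hcoef (X x) vx m * e x))
  (fun m => (t * c) ^+ m / m`!%:R) (fun s => expR (s * (t * c)))) => s s0.
  have [_] := main s s0.
  have -> // : (fun n => I (fun x => s ^+ n * hcoef (X x) vx n * e x)) =
    (fun n => s ^+ n * I (fun x => hcoef (X x) vx n * e x)).
  apply/funext => n; rewrite -RintegralZl //; last exact: i1.
  by congr fine; apply: eq_integral => x _; rewrite mulrA.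
exact: cvg_exp_series.
Qed.

(** The exponential in [Y] in [E_hcoef_exp] is itself expanded in powers of [t]. Since the integral
    is a multiple of [t ^+ m], only the coefficient [n = m] is nonzero. *)
Lemma E_hcoefM m n :
  integ P (fun x => hcoef (X x) vx m * hcoef (Y x) vy n) /\
  I (fun x => hcoef (X x) vx m * hcoef (Y x) vy n) =
  if m == n then c ^+ m / m`!%:R else 0.
Proof.
pose K := expR (vx / 2).
have main t : 0 < t ->
    (forall n, integ P (fun x => hcoef (X x) vx m * (t ^+ n * hcoef (Y x) vy n))) /\
    series (fun n => I (fun x => hcoef (X x) vx m * (t ^+ n * hcoef (Y x) vy n))) @ \oo -->
      t ^+ m * (c ^+ m / m`!%:R).
  move=> t0.
  have := @series_dominated _ _ _ P (fun n x => hcoef (X x) vx m * (t ^+ n * hcoef (Y x) vy n))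
    (fun x => hcoef (X x) vx m * expR (t * Y x - t ^+ 2 * (vy / 2)))
    (fun x => (K * expR (t ^+ 2 * (vy / 2))) * (expR (1 * `|X x|) * expR (t * `|Y x|))).
  case.
  - by move=> k; apply: measurable_funM; [|apply: mfunZ]; exact: mfun_hcoef.
  - by apply: integZ; apply: integ_exp_abs => //; exact: ltW.
  - move=> x k; under eq_bigr do rewrite normrM.
    rewrite -mulr_sumr.
    apply: (@le_trans _ _ ((expR (1 * `|X x|) * K) *
      (expR (t * `|Y x|) * expR (t ^+ 2 * (vy / 2))))); last first.
      by rewrite le_eqVlt; apply/orP; left; apply/eqP; ring.
    apply: ler_pM; rewrite ?sumr_ge0 //; first exact: hcoef_abs_le.
    by have := @sum_hcoef_real_le _ t (Y x) vy k vy0; rewrite (gtr0_norm t0).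
  - move=> x; have := @ccvg_hcoef_real _ t (Y x) vy => h.
    have -> : series (fun n => hcoef (X x) vx m * (t ^+ n * hcoef (Y x) vy n)) =
       (fun N => hcoef (X x) vx m * series (fun n => t ^+ n * hcoef (Y x) vy n) N).
      by apply/funext => N; rewrite /series /= mulr_sumr.
    by apply: cvgM => //; exact: cvg_cst.
  move=> ig ia cv; split=> //.
  by have [_ E] := E_hcoef_exp t m; move: cv; rewrite E exprMn mulrA.
have i1 k : integ P (fun x => hcoef (X x) vx m * hcoef (Y x) vy k).
  have [/(_ k) + _] := main 1 ltr01.
  by congr integ; apply/funext => x; rewrite expr1n mul1r.
split; first exact: i1.
apply: (@power_series_inj _ (fun n => I (fun x => hcoef (X x) vx m * hcoef (Y x) vy n))
  (fun n => if m == n then c ^+ m / m`!%:R else 0)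
  (fun t => t ^+ m * (c ^+ m / m`!%:R))) => t t0.
  have [_] := main t t0.
  have -> // : (fun n => I (fun x => hcoef (X x) vx m * (t ^+ n * hcoef (Y x) vy n))) =
    (fun n => t ^+ n * I (fun x => hcoef (X x) vx m * hcoef (Y x) vy n)).
  apply/funext => k; rewrite -RintegralZl //; last exact: i1.
  by congr fine; apply: eq_integral => x _; rewrite mulrCA.
(* The series has one nonzero term, of index [m], so its partial sums are constant from [m.+1]
   on. *)
rewrite -(cvg_shiftn m.+1) (_ : [sequence _]_n = fun=> t ^+ m * (c ^+ m / m`!%:R)); first exact: cvg_cst.
apply/funext => N; rewrite /series /= big_mkord.
have lt : (m < N + m.+1)%N by rewrite addnS ltnS leq_addl.
rewrite (bigD1 (Ordinal lt)) //= eqxx big1 ?addr0 // => i ne.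
by rewrite (_ : (m == i) = false) ?mulr0 //; apply: contraNF ne => /eqP e; apply/eqP/val_inj.
Qed.

End GaussianPair.

(** * Characteristic function from the moment generating function *)

Section CharacteristicFunction.
Context d (T : measurableType d) (R : realType) (P : probability T R).
Variables (X : T -> R) (v : R).
Hypotheses (mX : measurable_fun setT X) (v0 : 0 <= v).
Hypothesis mgf : forall s : R,
  (\int[P]_x (expR (s * X x))%:E = (expR (s ^+ 2 * (v / 2)))%:E)%E.
Local Notation I f := (Rintegral P setT f).

(** The results on pairs are reused with a degenerate second variable, constantly [0]. *)
Let mgf0 (s t : R) : (\int[P]_x (expR (s * X x + t * (fun=> 0) x))%:E =
  (expR (s ^+ 2 * (v / 2) + s * t * 0 + t ^+ 2 * (0 / 2)))%:E)%E.
Proof.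
under eq_integral do rewrite mulr0 addr0.
by rewrite mgf mul0r !mulr0 !addr0.
Qed.

Let E_hcoef n : integ P (fun x => hcoef (X x) v n) /\
  I (fun x => hcoef (X x) v n) = (n == 0)%:R.
Proof.
have [] := E_hcoef_exp mX (measurable_cst (0 : R)) v0 mgf0 0 n.
have -> : (fun x => hcoef (X x) v n * expR (0 * (fun=> 0 : R) x - 0 ^+ 2 * (0 / 2))) =
          (fun x => hcoef (X x) v n).
  by apply/funext => x; rewrite mul0r expr0n mul0r subrr expR0 mulr1.
by move=> ih ->; split=> //; rewrite mul0r expr0n; case: n {ih} => [|n]; rewrite /= ?fact0 ?divr1 ?mul0r.
Qed.

(* [exp (i s X + s^2 v / 2)] is expanded in Hermite polynomials, whose
   expectations vanish in positive degree: no complex analysis is needed. *)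
Lemma char_fun (s : R) :
  I (fun x => cos (s * X x)) = expR (- (s ^+ 2 * (v / 2))) /\
  I (fun x => sin (s * X x)) = 0.
Proof.
pose A : R[i] := 'i%C * s%:C.
pose f x := cexp (A * (X x)%:C - A ^+ 2 * (v / 2)%:C).
pose g x := expR (s ^+ 2 * (v / 2)) * (expR (`|s| * `|X x|) * expR (0 * `|(fun=> 0 : R) x|)).
have nA : normc A = `|s| by rewrite /A normcM normc_i mul1r normc_real.
have ig : integ P g.
  exact: (integZ _ (integ_exp_abs mX (measurable_cst (0 : R)) mgf0 (normr_ge0 s) (lexx 0))).
have le x n : \sum_(k < n) normc (A ^+ k * (hcoef (X x) v k)%:C) <= g x.
  have := @sum_hcoef_le _ A (X x) v n v0.
  by rewrite nA real_normK ?num_real // /g mul0r expR0 mulr1 mulrC.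
have step (F : R[i] -> R) : (forall z, `|F z| <= normc z) ->
    (forall z (r : R), F (z * r%:C) = F z * r) ->
    (forall x, series (fun n => F (A ^+ n * (hcoef (X x) v n)%:C)) @ \oo --> F (f x)) ->
    I (fun x => F (f x)) = F 1.
  move=> Fle FZ Fcv.
  have := @series_dominated _ _ _ P (fun n x => F (A ^+ n) * hcoef (X x) v n) (F \o f) g.
  case=> //.
  - by move=> n; apply: mfunZ; exact: mfun_hcoef.
  - move=> x n; apply: le_trans (le x n); apply: ler_sum => k _.
    by rewrite -FZ.
  - by move=> x; have := Fcv x; under eq_fun do rewrite FZ.
  move=> iF ih cv.
  suff cv1 : series (fun n => I (fun x => F (A ^+ n) * hcoef (X x) v n)) @ \oo --> F 1.
    by rewrite (cvg_unique _ cv cv1).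
  rewrite -cvg_shiftS (_ : [sequence _]_n = fun=> F 1); first exact: cvg_cst.
  apply/funext => N; rewrite /series /=.
  have E n : I (fun x => F (A ^+ n) * hcoef (X x) v n) = (n == 0)%:R * F 1.
    have [ihn hn] := E_hcoef n; rewrite RintegralZl // hn mulrC.
    by case: n {ihn hn} => [|n]; rewrite ?expr0 ?mul0r.
  rewrite big_nat_recl //= E mul1r big1 ?addr0 //.
  by move=> ? _; rewrite E mul0r.
pose k := expR (s ^+ 2 * (v / 2)).
have k0 : k != 0 by rewrite gt_eqF // expR_gt0.
(* Since [A ^+ 2 = - s ^+ 2], the correction in the exponent is the real factor [k]. *)
have fE x : f x = k%:C * (cos (s * X x) +i* sin (s * X x)).
  rewrite /f /cexp; congr ((expR _)%:C * (cos _ +i* sin _));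
    rewrite /A expr2 /=; ring.
have mc : measurable_fun setT (fun x => cos (s * X x)) by apply: mfun_cos; exact: mfunZ.
have ms : measurable_fun setT (fun x => sin (s * X x)) by apply: mfun_sin; exact: mfunZ.
have i1 : integ P (fun=> 1) by exact: finite_measure_integrable_cst.
have ic : integ P (fun x => cos (s * X x)).
  by apply: (integ_le mc _ i1) => x; rewrite ler_norml cos_geN1 cos_le1.
have is_ : integ P (fun x => sin (s * X x)).
  by apply: (integ_le ms _ i1) => x; rewrite ler_norml sin_geN1 sin_le1.
have hRe : I (fun x => complex.Re (f x)) = 1.
  apply: (step (@complex.Re R)) => [z|z r|x].
  - exact: normr_Re_le.
  - by rewrite complexReM /= mulr0 subr0.
  - by have /ccvg_sumP[] := ccvg_hcoef A (X x) v.
have hIm : I (fun x => complex.Im (f x)) = 0.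
  apply: (step (@complex.Im R)) => [z|z r|x].
  - exact: normr_Im_le.
  - by rewrite complexImM /= mulr0 add0r.
  - by have /ccvg_sumP[] := ccvg_hcoef A (X x) v.
rewrite expRN -/k; split; apply: (mulfI k0); rewrite -RintegralZl // ?divff // ?mulr0.
  by rewrite -hRe; congr fine; apply: eq_integral => x _; rewrite fE complexReM /= mul0r subr0.
by rewrite -hIm; congr fine; apply: eq_integral => x _; rewrite fE complexImM /= mul0r addr0.
Qed.

End CharacteristicFunction.

Section Integrability.
Context d (T : measurableType d) (R : realType).

Lemma integ_abs (mu : {measure set T -> \bar R}) (f : T -> R) : integ mu f -> integ mu (fun x => `|f x|).
Proof.
move=> h; apply/integrableP; have /integrableP[m l] := h; split.
  by apply/measurable_EFinP/measurableT_comp => //; exact: integ_mfun h.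
by under eq_integral do rewrite /= normr_id; exact: l.
Qed.

Lemma integ_ge0 (mu : {measure set T -> \bar R}) (f : T -> R) : measurable_fun setT f ->
  (forall x, 0 <= f x) -> (\int[mu]_x (f x)%:E < +oo)%E -> integ mu f.
Proof.
move=> mf f0 h; apply/integrableP; split; first exact/measurable_EFinP.
by under eq_integral do rewrite /= ger0_norm ?f0 //.
Qed.

Lemma integ_lty (mu : {measure set T -> \bar R}) (f : T -> R) : (forall x, 0 <= f x) ->
  integ mu f -> (\int[mu]_x (f x)%:E < +oo)%E.
Proof.
move=> f0 /integrableP[_]; under eq_integral do rewrite /= ger0_norm ?f0 //.
by [].
Qed.

End Integrability.

Section RealIntegralsProduct.
Context d (T : measurableType d) d' (U : measurableType d') (R : realType).

Lemma Rintegral_distribution (P : probability T R) (X : {mfun T >-> U}) (f : U -> R) :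
  measurable_fun setT f -> integ P (f \o X) ->
  integ (distribution P X) f /\
  Rintegral (distribution P X) setT f = Rintegral P setT (f \o X).
Proof.
move=> mf i; split; last first.
  by rewrite /Rintegral integral_distribution //; exact/measurable_EFinP.
apply/integrableP; split; first exact/measurable_EFinP.
rewrite ge0_integral_distribution //; last exact/measurable_EFinP/measurableT_comp.
by have /integrableP[] := i.
Qed.

Lemma Rintegral_prod (P : probability T R) (Q : probability U R)
    (f : T -> R) (g : U -> R) :
  integ P f -> integ Q g ->
  integ (P \x Q)%E (fun z => f z.1 * g z.2) /\
  Rintegral (P \x Q)%E setT (fun z => f z.1 * g z.2) = Rintegral P setT f * Rintegral Q setT g.
Proof.
move=> hf hg; have mf := integ_mfun hf; have mg := integ_mfun hg.
have mfg : measurable_fun setT (fun z : T * U => f z.1 * g z.2).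
  by apply: measurable_funM; [apply: (measurableT_comp mf)|apply: (measurableT_comp mg)].
have if' := integ_abs hf; have ig' := integ_abs hg.
have ifg : integ (P \x Q)%E (fun z => f z.1 * g z.2).
  apply/integrable12ltyP; first exact/measurable_EFinP.
  have E x : (\int[Q]_y `|(EFin \o (fun z : T * U => (f z.1 * g z.2)%R)) (x, y)| =
    (`|f x| * Rintegral Q setT (fun y => `|g y|))%:E)%E.
    under eq_integral do rewrite /= normrM.
    rewrite -RintegralZl //.
    by rewrite -Rintegral_EFin //; exact: integZ ig'.
  under eq_integral do rewrite E.
  apply: integ_lty => [x|].
    by rewrite mulr_ge0 // Rintegral_ge0.
  under [X in integ _ X]eq_fun do rewrite mulrC.
  exact: integZ if'.
split=> //.
rewrite /Rintegral -integral12_prod_meas1 //= /fubini_F /=.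
have E x : (\int[Q]_y (f x * g y)%:E = (Rintegral Q setT g * f x)%:E)%E.
  by rewrite mulrC -RintegralZl // -Rintegral_EFin //; exact: integZ.
under eq_integral do rewrite E.
by rewrite -/(Rintegral _ _ _) RintegralZl // mulrC.
Qed.

End RealIntegralsProduct.

Section ComplexIntegrals.
Context d (T : measurableType d) (R : realType).
Local Notation C := R[i].

Definition cinteg (mu : {measure set T -> \bar R}) (f : T -> C) :=
  integ mu (fun x => complex.Re (f x)) /\ integ mu (fun x => complex.Im (f x)).

Definition cint (mu : {measure set T -> \bar R}) (f : T -> C) : C :=
  Rintegral mu setT (fun x => complex.Re (f x)) +i*
  Rintegral mu setT (fun x => complex.Im (f x)).

Lemma eq_cint mu (f g : T -> C) : f =1 g -> cint mu f = cint mu g.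
Proof. by move=> /funext ->. Qed.

Lemma cinteg_cst (P : probability T R) (z : C) : cinteg P (fun=> z).
Proof. by split; exact: finite_measure_integrable_cst. Qed.

Lemma cint_cst (P : probability T R) (z : C) : cint P (fun=> z) = z.
Proof.
rewrite /cint !Rintegral_cst //= probability_setT /= !mulr1.
by case: z.
Qed.

Lemma cintegZ mu (z : C) (f : T -> C) : cinteg mu f ->
  cinteg mu (fun x => z * f x) /\ cint mu (fun x => z * f x) = z * cint mu f.
Proof.
move=> [hr hi]; rewrite /cinteg /cint.
have ER : (fun x => complex.Re (z * f x)) =
    (fun x => complex.Re z * complex.Re (f x) - complex.Im z * complex.Im (f x)).
  by apply/funext => x; rewrite complexReM.
have EI : (fun x => complex.Im (z * f x)) =
    (fun x => complex.Re z * complex.Im (f x) + complex.Im z * complex.Re (f x)).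
  by apply/funext => x; rewrite complexImM.
rewrite ER EI; have rr := integZ (complex.Re z) hr; have ri := integZ (complex.Re z) hi.
have ir := integZ (complex.Im z) hr; have ii := integZ (complex.Im z) hi.
split; first by split; [exact: integB|exact: integD].
rewrite RintegralB // RintegralD // !RintegralZl //.
by apply/eqP; rewrite eq_complex complexReM complexImM /= !eqxx.
Qed.

Lemma cinteg_real mu (f : T -> R) : integ mu f ->
  cinteg mu (fun x => (f x)%:C) /\ cint mu (fun x => (f x)%:C) = (Rintegral mu setT f)%:C.
Proof.
move=> h; split; first by split=> //; exact: integ0.
apply/eqP; rewrite eq_complex /= eqxx /= /Rintegral.
by rewrite integral0.
Qed.

Lemma cinteg_le mu (f : T -> C) (g : T -> R) : measurable_fun setT (fun x => complex.Re (f x)) ->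
  measurable_fun setT (fun x => complex.Im (f x)) -> (forall x, normc (f x) <= g x) ->
  integ mu g -> cinteg mu f.
Proof.
move=> mr mi le ig; split.
  by apply: (integ_le mr _ ig) => x; exact: le_trans (normr_Re_le _) (le x).
by apply: (integ_le mi _ ig) => x; exact: le_trans (normr_Im_le _) (le x).
Qed.

End ComplexIntegrals.

Section ComplexIntegralsProduct.
Context d (T : measurableType d) d' (U : measurableType d') (R : realType).
Local Notation C := R[i].

Lemma cint_prod (P : probability T R) (Q : probability U R) (f : T -> C) (g : U -> C) :
  cinteg P f -> cinteg Q g ->
  cinteg (P \x Q)%E (fun z => f z.1 * g z.2) /\
  cint (P \x Q)%E (fun z => f z.1 * g z.2) = cint P f * cint Q g.
Proof.
move=> [fr fi] [gr gi]; rewrite /cinteg /cint.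
have [rr Err] := Rintegral_prod fr gr.
have [ri Eri] := Rintegral_prod fr gi.
have [ir Eir] := Rintegral_prod fi gr.
have [ii Eii] := Rintegral_prod fi gi.
have ER : (fun z : T * U => complex.Re (f z.1 * g z.2)) =
  (fun z => complex.Re (f z.1) * complex.Re (g z.2) - complex.Im (f z.1) * complex.Im (g z.2)).
  by apply/funext => z; rewrite complexReM.
have EI : (fun z : T * U => complex.Im (f z.1 * g z.2)) =
  (fun z => complex.Re (f z.1) * complex.Im (g z.2) + complex.Im (f z.1) * complex.Re (g z.2)).
  by apply/funext => z; rewrite complexImM.
rewrite ER EI; split; first by split; [exact: integB|exact: integD].
rewrite RintegralB // RintegralD // Err Eri Eir Eii.
by apply/eqP; rewrite eq_complex complexReM complexImM /= !eqxx.
Qed.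

Lemma cint_distribution (P : probability T R) (X : {mfun T >-> U}) (f : U -> C) :
  measurable_fun setT (fun x => complex.Re (f x)) ->
  measurable_fun setT (fun x => complex.Im (f x)) -> cinteg P (f \o X) ->
  cinteg (distribution P X) f /\ cint (distribution P X) f = cint P (f \o X).
Proof.
move=> mr mi [ir ii].
have [r Er] := Rintegral_distribution mr ir.
have [i Ei] := Rintegral_distribution mi ii.
by rewrite /cinteg /cint Er Ei.
Qed.

Lemma cint_fubini (P : probability T R) (Q : probability U R) (f : T * U -> C) :
  cinteg (P \x Q)%E f -> (forall x, cinteg Q (fun y => f (x, y))) ->
  cint (P \x Q)%E f = cint P (fun x => cint Q (fun y => f (x, y))).
Proof.
move=> [ir ii] h; rewrite /cint /Rintegral; congr (_ +i* _); congr fine.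
  rewrite -integral12_prod_meas1 //; apply: eq_integral => x _.
  by rewrite /fubini_F /= -Rintegral_EFin //; case: (h x).
rewrite -integral12_prod_meas1 //; apply: eq_integral => x _.
by rewrite /fubini_F /= -Rintegral_EFin //; case: (h x).
Qed.

End ComplexIntegralsProduct.

Lemma cexp_i (R : realType) (r : R) : cexp ('i%C * r%:C) = cos r +i* sin r.
Proof.
rewrite /cexp /= !(mul0r, mul1r) !add0r oppr0 expR0.
by rewrite rmorph1 mul1r.
Qed.

(** The hypothesis covers nonnegative functions; an integrable [g] is the difference of the
    nonnegative functions [g + |g|] and [|g|]. *)
Lemma Rintegral_change_measure d (T : measurableType d) (R : realType)
    (P Q : {measure set T -> \bar R}) (K : R) (f g : T -> R) :
  measurable_fun setT f -> (forall x, 0 <= f x) ->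
  (forall h : T -> R, measurable_fun setT h -> (forall x, 0 <= h x) ->
    (\int[P]_x (f x * h x)%:E = K%:E * \int[Q]_x (h x)%:E)%E) ->
  integ Q g ->
  integ P (fun x => f x * g x) /\
  Rintegral P setT (fun x => f x * g x) = K * Rintegral Q setT g.
Proof.
move=> mf f0 tilt ig; have mg := integ_mfun ig.
have pos h : integ Q h -> (forall x, 0 <= h x) ->
    integ P (fun x => f x * h x) /\
    Rintegral P setT (fun x => f x * h x) = K * Rintegral Q setT h.
  move=> ih h0; have mh := integ_mfun ih.
  have t := tilt h mh h0; rewrite (Rintegral_EFin ih) in t; split.
    apply: integ_ge0 => [|x|]; [exact: measurable_funM|by rewrite mulr_ge0|].
    by rewrite t -EFinM ltry.
  by rewrite [LHS]/Rintegral t.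
have ia := integ_abs ig.
have [i1 e1] := pos _ ia (fun x => normr_ge0 _).
have is_ := integD ig ia.
have [|i2 e2] := pos _ is_; first by move=> x; rewrite -lerBlDl sub0r ler_normr lexx orbT.
have eg : (fun x => f x * g x) = (fun x => f x * (g x + `|g x|) - f x * `|g x|).
  by apply/funext => x; ring.
rewrite eg; split; first exact: integB.
by rewrite RintegralB // e1 e2 RintegralD // -mulrBr addrK.
Qed.

(** * Gaussian integrals *)

Section NormalDistribution.
Variable R : realType.
Local Notation T := (measurableTypeR R).
Local Notation leb := (@lebesgue_measure R).
Local Notation N m s := (normal_prob m s : probability T R).
Implicit Types (m s K : R) (f g : T -> R).

(** Change of variables goes through the Radon-Nikodym derivative, which agrees almost everywhere
    with [normal_pdf] because both have the same integral over every measurable set. *)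
Lemma ge0_integral_normal m s f : s != 0 -> measurable_fun setT f -> (forall x, 0 <= f x) ->
  (\int[N m s]_x (f x)%:E = \int[leb]_x (f x * normal_pdf m s x)%:E)%E.
Proof.
move=> s0 mf f0; have dom := normal_prob_dominates m s.
have mp := measurable_normal_pdf m s.
rewrite -(Radon_Nikodym_SigmaFinite.change_of_variables dom) //; last first.
  exact/measurable_EFinP.
apply: ae_eq_integral => //.
- apply: emeasurable_funM; first exact/measurable_EFinP.
  by have /integrableP[] := Radon_Nikodym_SigmaFinite.f_integrable dom.
- by apply/measurable_EFinP/measurable_funM.
have ae : ae_eq leb setT (Radon_Nikodym_SigmaFinite.f (N m s) leb)
    (fun x => (normal_pdf m s x)%:E).
  apply: integral_ae_eq => //.
  - exact: Radon_Nikodym_SigmaFinite.f_integrable.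
  - exact/measurable_EFinP.
  - by move=> E _ mE; rewrite -Radon_Nikodym_SigmaFinite.f_integral.
by have := ae_eqe_mul2l (fun x => (f x)%:E) ae.
Qed.

Lemma ge0_integral_normal_tilt m s m' s' K f g : s != 0 -> s' != 0 -> 0 <= K ->
  measurable_fun setT f -> (forall x, 0 <= f x) ->
  (forall x, f x * normal_pdf m s x = K * normal_pdf m' s' x) ->
  measurable_fun setT g -> (forall x, 0 <= g x) ->
  (\int[N m s]_x (f x * g x)%:E = K%:E * \int[N m' s']_x (g x)%:E)%E.
Proof.
move=> s0 s'0 K0 mf f0 E mg g0.
have mfg : measurable_fun setT (fun x => f x * g x) by exact: measurable_funM.
have fg0 x : 0 <= f x * g x by rewrite mulr_ge0.
rewrite [LHS](ge0_integral_normal m s0 mfg fg0).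
rewrite [X in (_ = _ * X)%E](ge0_integral_normal m' s'0 mg g0).
rewrite -ge0_integralZl //.
- by apply: eq_integral => x _; rewrite mulrAC E -EFinM; congr EFin; ring.
- by apply/measurable_EFinP/measurable_funM => //; exact: measurable_normal_pdf.
- by move=> x _; rewrite lee_fin mulr_ge0 // normal_pdf_ge0.
Qed.

Lemma Rintegral_normal_tilt m s m' s' K f g : s != 0 -> s' != 0 -> 0 <= K ->
  measurable_fun setT f -> (forall x, 0 <= f x) ->
  (forall x, f x * normal_pdf m s x = K * normal_pdf m' s' x) ->
  integ (N m' s') g ->
  integ (N m s) (fun x => f x * g x) /\
  Rintegral (N m s) setT (fun x => f x * g x) = K * Rintegral (N m' s') setT g.
Proof.
move=> s0 s'0 K0 mf f0 E.
by apply: (Rintegral_change_measure mf f0) => h; exact: ge0_integral_normal_tilt.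
Qed.

(** Completing the square: an exponential tilt moves the mean by [s ^+ 2 * t] and keeps the
    variance. *)
Lemma normal_pdf_mgf m s t x : s != 0 ->
  expR (t * (x - m)) * normal_pdf m s x =
  expR (t ^+ 2 * (s ^+ 2 / 2)) * normal_pdf (m + s ^+ 2 * t) s x.
Proof.
move=> s0; rewrite /normal_pdf (negPf s0) /normal_fun.
rewrite mulrCA [RHS]mulrCA -!expRD; congr (_ * expR _).
by field.
Qed.

Lemma normal_mgf m s t : s != 0 ->
  (\int[N m s]_x (expR (t * (x - m)))%:E = (expR (t ^+ 2 * (s ^+ 2 / 2)))%:E)%E.
Proof.
move=> s0.
have mf : measurable_fun setT (fun x : T => expR (t * (x - m))).
  by apply: mfun_expR; apply: mfunZ; exact: measurable_funB.
have h := @ge0_integral_normal_tilt m s (m + s ^+ 2 * t) s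
  (expR (t ^+ 2 * (s ^+ 2 / 2))) _ (fun=> 1) s0 s0 (expR_ge0 _) mf
  (fun=> expR_ge0 _) (fun x => normal_pdf_mgf m t x s0) (measurable_cst _) (fun=> ler01).
under eq_integral do rewrite -[expR (t * _)]mulr1.
by rewrite h integral_cst //= probability_setT !mule1.
Qed.

Lemma normal_char m s t : s != 0 ->
  cinteg (N m s) (fun x => cexp ('i%C * (t * x)%:C)) /\
  cint (N m s) (fun x => cexp ('i%C * (t * x)%:C)) =
  cexp ('i%C * (t * m)%:C - (t ^+ 2 * (s ^+ 2 / 2))%:C).
Proof.
move=> s0.
have mX : measurable_fun setT (fun x : T => x - m) by exact: measurable_funB.
have v0 : 0 <= s ^+ 2 by rewrite sqr_ge0.
have [ec es] := char_fun mX v0 (fun u => normal_mgf m u s0) t.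
have E x : cexp ('i%C * (t * x)%:C) =
    cexp ('i%C * (t * m)%:C) * (cos (t * (x - m)) +i* sin (t * (x - m))).
  rewrite -cexp_i -cexpD; congr cexp.
  by apply/eqP; rewrite eq_complex /=; apply/andP; split; apply/eqP; ring.
rewrite (funext E); pose e (x : T) := cos (t * (x - m)) +i* sin (t * (x - m)).
have i1 : integ (N m s) (fun=> 1) by exact: finite_measure_integrable_cst.
have ie : cinteg (N m s) e.
  apply: (cinteg_le _ _ _ i1) => /=.
  - by apply: mfun_cos; exact: mfunZ.
  - by apply: mfun_sin; exact: mfunZ.
  - by move=> x; rewrite /= cos2Dsin2 sqrtr1.
have [ize ->] := cintegZ (cexp ('i%C * (t * m)%:C)) ie; split=> //.
by rewrite /cint /= ec es cexpD -rmorphN cexp_real.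
Qed.

End NormalDistribution.

Section GaussianTilt.
Variable R : realType.
Local Notation T := (measurableTypeR R).
Local Notation N m s := (normal_prob m s : probability T R).

(** The coefficient [1 - s ^- 2] removes the standard exponent [- x ^+ 2 / 2] and puts that of
    variance [s ^+ 2] in its place; the factor [s] is the ratio of the two normalizations. *)
Lemma normal_pdf_tilt (m s x : R) : 0 < s ->
  expR ((1 - s ^- 2) * (x ^+ 2 / 2) + m / s ^+ 2 * x) * normal_pdf 0 1 x =
  s * expR (m ^+ 2 / (2 * s ^+ 2)) * normal_pdf m s x.
Proof.
move=> s_gt0; have s0 : s != 0 by rewrite gt_eqF.
rewrite /normal_pdf (negPf s0) oner_eq0.
have -> : normal_peak s = s^-1 * normal_peak 1.
  rewrite /normal_peak -invfM; congr (_^-1).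
  rewrite -mulrnAr sqrtrM ?sqr_ge0 // sqrtr_sqr gtr0_norm //.
  by rewrite expr1n mul1r.
rewrite mulrCA /normal_fun -expRD; set k := normal_peak 1.
have -> : s * expR (m ^+ 2 / (2 * s ^+ 2)) * (s^-1 * k * expR (- (x - m) ^+ 2 / (s ^+ 2 *+ 2))) =
   k * (expR (m ^+ 2 / (2 * s ^+ 2)) * expR (- (x - m) ^+ 2 / (s ^+ 2 *+ 2))).
  by field.
by rewrite -expRD; congr (_ * expR _); field.
Qed.

Lemma cint_normal_tilt (m s : R) (g : T -> R[i]) : 0 < s -> cinteg (N m s) g ->
  let f x := (expR ((1 - s ^- 2) * (x ^+ 2 / 2) + m / s ^+ 2 * x))%:C * g x in
  cinteg (N 0 1) f /\
  cint (N 0 1) f = (s * expR (m ^+ 2 / (2 * s ^+ 2)))%:C * cint (N m s) g.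
Proof.
move=> s_gt0 [gr gi] f; have s0 : s != 0 by rewrite gt_eqF.
pose w (x : T) := expR ((1 - s ^- 2) * (x ^+ 2 / 2) + m / s ^+ 2 * x).
have mw : measurable_fun setT w.
  apply: mfun_expR; apply: measurable_funD; apply: mfunZ => //.
  by under eq_fun do rewrite mulrC; apply: mfunZ; exact: measurable_funX.
have K0 : 0 <= s * expR (m ^+ 2 / (2 * s ^+ 2)) by rewrite mulr_ge0 ?expR_ge0 // ltW.
have tilt := Rintegral_normal_tilt (oner_neq0 R) s0 K0 mw (fun x => expR_ge0 _)
  (fun x => normal_pdf_tilt m x s_gt0).
have [ir er] := tilt _ gr; have [ii ei] := tilt _ gi.
have ER : (fun x => complex.Re (f x)) = (fun x => w x * complex.Re (g x)).
  by apply/funext => x; rewrite /f complexReM /= mul0r subr0.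
have EI : (fun x => complex.Im (f x)) = (fun x => w x * complex.Im (g x)).
  by apply/funext => x; rewrite /f complexImM /= mul0r addr0.
split; first by rewrite /cinteg ER EI.
rewrite /cint ER EI; apply/eqP; rewrite eq_complex complexReM complexImM /=.
rewrite !mul0r subr0 addr0; apply/andP; split; apply/eqP.
  exact: er.
exact: ei.
Qed.

(** The tilted law is normal with [s = p^(-1/2)] and mean [q / p], so the value is the tilting
    constant times its characteristic function. *)
Lemma cint_gauss_quad (p q t : R) : 0 < p ->
  let f x := (expR ((1 - p) * (x ^+ 2 / 2) + q * x))%:C * cexp ('i%C * (t * x)%:C) in
  cinteg (N 0 1) f /\
  cint (N 0 1) f = ((Num.sqrt p)^-1 * expR (q ^+ 2 / (2 * p)))%:C *
    cexp ('i%C * (t * (q / p))%:C - (t ^+ 2 / (2 * p))%:C).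
Proof.
move=> p0 f; have s0 : 0 < (Num.sqrt p)^-1 by rewrite invr_gt0 sqrtr_gt0.
have pn0 : p != 0 by rewrite gt_eqF.
have s2 : (Num.sqrt p)^-1 ^+ 2 = p^-1 by rewrite exprVn sqr_sqrtr // ltW.
have [ic ec] := normal_char (q / p) t (lt0r_neq0 s0).
have [i e] := cint_normal_tilt s0 ic.
have Ef : f = (fun x => (expR ((1 - (Num.sqrt p)^-1 ^- 2) * (x ^+ 2 / 2) +
    q / p / (Num.sqrt p)^-1 ^+ 2 * x))%:C * cexp ('i%C * (t * x)%:C)).
  apply/funext => x; rewrite /f s2 invrK.
  by rewrite divfK.
rewrite Ef; split; first exact: i.
apply: (etrans e); rewrite ec s2.
have -> : (q / p) ^+ 2 / (2 * p^-1) = q ^+ 2 / (2 * p) by field.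
by have -> : t ^+ 2 * (p^-1 / 2) = t ^+ 2 / (2 * p) by field.
Qed.

End GaussianTilt.

(** * Product integrands on Gaussian tuples *)

Section GaussianTuples.
Variable R : realType.
Local Notation T := (measurableTypeR R).
Local Notation C := R[i].
Local Notation N01 := (normal_prob 0 1 : probability T R).
Local Notation G n := (gauss_tuple R n).

Lemma cinteg_mfun d (U : measurableType d) (mu : {measure set U -> \bar R}) (f : U -> C) :
  cinteg mu f -> measurable_fun setT (fun x => complex.Re (f x)) /\
                 measurable_fun setT (fun x => complex.Im (f x)).
Proof. by move=> [r i]; split; [exact: integ_mfun r|exact: integ_mfun i]. Qed.

Definition cmfun d (U : measurableType d) (f : U -> C) :=
  measurable_fun setT (fun x => complex.Re (f x)) /\
  measurable_fun setT (fun x => complex.Im (f x)).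

Lemma cmfunM d (U : measurableType d) (f g : U -> C) : cmfun f -> cmfun g ->
  cmfun (fun x => f x * g x).
Proof.
move=> [fr fi] [gr gi]; split.
  by under eq_fun do rewrite complexReM; apply: measurable_funB; exact: measurable_funM.
by under eq_fun do rewrite complexImM; apply: measurable_funD; exact: measurable_funM.
Qed.

Lemma cmfunD d (U : measurableType d) (f g : U -> C) : cmfun f -> cmfun g ->
  cmfun (fun x => f x + g x).
Proof.
move=> [fr fi] [gr gi]; split.
  by under eq_fun do rewrite complexReD; exact: measurable_funD.
by under eq_fun do rewrite complexImD; exact: measurable_funD.
Qed.

Lemma cmfun_cst d (U : measurableType d) z : cmfun (fun _ : U => z).
Proof. by split; exact: measurable_cst. Qed.

Lemma cmfun_prod d (U : measurableType d) (J : Type) (s : seq J) (F : J -> U -> C) :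
  (forall j, cmfun (F j)) -> cmfun (fun x => \prod_(j <- s) F j x).
Proof.
move=> h; elim: s => [|j s IH].
  by under eq_fun do rewrite big_nil; exact: cmfun_cst.
by under eq_fun do rewrite big_cons; exact: cmfunM.
Qed.

Lemma cmfun_sum d (U : measurableType d) (J : Type) (s : seq J) (F : J -> U -> C) :
  (forall j, cmfun (F j)) -> cmfun (fun x => \sum_(j <- s) F j x).
Proof.
move=> h; elim: s => [|j s IH].
  by under eq_fun do rewrite big_nil; exact: cmfun_cst.
by under eq_fun do rewrite big_cons; exact: cmfunD.
Qed.

Lemma cmfun_comp d (U : measurableType d) d' (W : measurableType d') (f : U -> C) (h : W -> U) :
  cmfun f -> measurable_fun setT h -> cmfun (f \o h).
Proof.
move=> [r i] mh; split.
  exact: (measurableT_comp r mh).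
exact: (measurableT_comp i mh).
Qed.

Lemma cmfun_real d (U : measurableType d) (f : U -> R) : measurable_fun setT f ->
  cmfun (fun x => (f x)%:C).
Proof. by move=> mf; split=> //=; exact: measurable_cst. Qed.

Lemma cmfun_cexp d (U : measurableType d) (f : U -> C) : cmfun f -> cmfun (fun x => cexp (f x)).
Proof.
move=> [r i]; rewrite /cexp; apply: cmfunM; first by apply: cmfun_real; exact: mfun_expR.
by split=> /=; [exact: mfun_cos|exact: mfun_sin].
Qed.

Lemma measurable_tnth_tuple n (j : 'I_n) : measurable_fun setT (fun t : n.-tuple T => tnth t j).
Proof. exact: measurable_tnth. Qed.

Lemma cint_gauss_tuple_prod n (phi : 'I_n -> T -> C) :
  (forall j, cinteg N01 (phi j)) ->
  cinteg (G n) (fun t => \prod_j phi j (tnth t j)) /\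
  cint (G n) (fun t => \prod_j phi j (tnth t j)) = \prod_j cint N01 (phi j).
Proof.
elim: n phi => [|n IH] phi h.
  rewrite big_ord0; under eq_fun do rewrite big_ord0.
  by split; [exact: cinteg_cst|rewrite cint_cst].
have [ig eg] := IH (fun j => phi (lift ord0 j)) (fun j => h _).
have [ip ep] := cint_prod (h ord0) ig.
have E : (fun t : n.+1.-tuple T => \prod_j phi j (tnth t j)) \o @tuple_cons R n =
  (fun z => phi ord0 z.1 * \prod_j phi (lift ord0 j) (tnth z.2 j)).
  apply/funext => -[x t]; rewrite /= big_ord_recl tnth0; congr (_ * _).
  by apply: eq_bigr => j _; rewrite tnthS.
have m : cmfun (fun t : n.+1.-tuple T => \prod_j phi j (tnth t j)).
  apply: cmfun_prod => j; apply: (@cmfun_comp _ _ _ _ (phi j) (fun t => tnth t j)).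
    exact: cinteg_mfun (h j).
  exact: measurable_tnth_tuple.
have [mr mi] := m.
have [|ic ec] := @cint_distribution _ _ _ _ _ (N01 \x G n)%E (@tuple_cons R n) _ mr mi.
  by rewrite E.
split; first exact: ic.
by rewrite big_ord_recl -eg -ep -E -ec.
Qed.

End GaussianTuples.

Section GaussianTuplesCat.
Variable R : realType.
Local Notation T := (measurableTypeR R).
Local Notation C := R[i].
Local Notation N01 := (normal_prob 0 1 : probability T R).
Local Notation G n := (gauss_tuple R n).

Definition tuple_cat n m (p : n.-tuple T * m.-tuple T) : (n + m).-tuple T :=
  cat_tuple p.1 p.2.

Fact measurable_tuple_cat n m : measurable_fun setT (@tuple_cat n m).
Proof.
apply/measurable_fun_tnthP => j; case: (split_ordP j) => i ->.
  rewrite (_ : _ \o _ = (fun t => tnth t i) \o fst).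
    by apply: measurableT_comp => //; exact: measurable_tnth_tuple.
  by apply/funext => p /=; rewrite tnth_lshift.
rewrite (_ : _ \o _ = (fun t => tnth t i) \o snd).
  by apply: measurableT_comp => //; exact: measurable_tnth_tuple.
by apply/funext => p /=; rewrite tnth_rshift.
Qed.

HB.instance Definition _ n m := isMeasurableFun.Build _ _ _ _ (@tuple_cat n m)
  (@measurable_tuple_cat n m).

Lemma ge0_integral_gauss_tuple_cons n (f : n.+1.-tuple T -> \bar R) :
  measurable_fun setT f -> (forall t, (0 <= f t)%E) ->
  (\int[G n.+1]_t f t = \int[N01]_x \int[G n]_t f (tuple_cons (x, t)))%E.
Proof.
move=> mf f0; rewrite /= ge0_integral_distribution //.
have mg : measurable_fun setT (f \o @tuple_cons R n).
  by apply: measurableT_comp => //; exact: measurable_tuple_cons.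
exact: (fubini_tonelli1 _ mg (fun=> f0 _)).
Qed.

Lemma measurable_integral_cat n m (f : (n + m).-tuple T -> \bar R) :
  measurable_fun setT f -> (forall t, (0 <= f t)%E) ->
  measurable_fun setT (fun s => \int[G m]_t f (tuple_cat (s, t)))%E.
Proof.
move=> mf f0.
have mg : measurable_fun setT (f \o @tuple_cat n m).
  by apply: measurableT_comp => //; exact: measurable_tuple_cat.
exact: (measurable_fun_fubini_tonelli_F _ mg (fun=> f0 _)).
Qed.

(** [gauss_tuple] splits off one coordinate at a time; induction on [n] with Tonelli regroups the
    coordinates into two blocks, which will be those of [A] and [B]. *)
Lemma ge0_integral_gauss_tuple_cat n m (f : (n + m).-tuple T -> \bar R) :
  measurable_fun setT f -> (forall t, (0 <= f t)%E) ->
  (\int[G (n + m)]_t f t = \int[G n]_s \int[G m]_t f (tuple_cat (s, t)))%E.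
Proof.
elim: n f => [|n IH] f mf f0.
  rewrite integral_dirac //; last exact: measurable_integral_cat.
  rewrite diracT mul1e; apply: eq_integral => t _; congr f.
  exact/val_inj.
rewrite ge0_integral_gauss_tuple_cons; last 2 first.
- exact: measurable_integral_cat.
- by move=> s; apply: integral_ge0.
rewrite (@ge0_integral_gauss_tuple_cons (n + m)) //.
apply: eq_integral => x _.
have mfx : measurable_fun setT (fun u => f (tuple_cons (x, u))).
  have mc : measurable_fun setT (fun u : (n + m).-tuple T => tuple_cons (x, u)).
    exact: (measurable_cons (measurable_cst x) (@measurable_id _ _ setT)).
  exact: (measurableT_comp mf mc).
rewrite (IH _ mfx (fun=> f0 _)).
apply: eq_integral => s _; apply: eq_integral => t _; congr f.
exact/val_inj.
Qed.

Lemma gauss_tuple_cat n m (A : set ((n + m).-tuple T)) : measurable A ->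
  distribution (G n \x G m)%E (@tuple_cat n m) A = G (n + m)%N A.
Proof.
move=> mA; pose f := (EFin \o \1_A : (n + m).-tuple T -> \bar R).
have mf : measurable_fun setT f by exact/measurable_EFinP.
have f0 t : (0 <= f t)%E by rewrite lee_fin.
have E (P : {measure set ((n + m).-tuple T) -> \bar R}) : P A = (\int[P]_t f t)%E.
  by rewrite integral_indic // setIT.
rewrite !E ge0_integral_gauss_tuple_cat // ge0_integral_distribution //.
have mg : measurable_fun setT (f \o @tuple_cat n m).
  by apply: measurableT_comp => //; exact: measurable_tuple_cat.
exact: (fubini_tonelli1 _ mg (fun=> f0 _)).
Qed.

Lemma cint_gauss_tuple_cat n m (F : (n + m).-tuple T -> C) : cmfun F ->
  cinteg (G n \x G m)%E (F \o @tuple_cat n m) ->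
  cinteg (G (n + m)%N) F /\ cint (G (n + m)%N) F = cint (G n \x G m)%E (F \o @tuple_cat n m).
Proof.
move=> [mr mi] ic.
have [[ir ii] ec] := cint_distribution mr mi ic.
have E (f : (n + m).-tuple T -> \bar R) :
   (\int[G (n + m)%N]_t f t = \int[distribution (G n \x G m)%E (@tuple_cat n m)]_t f t)%E.
  by apply: eq_measure_integral => A mA _; exact/esym/gauss_tuple_cat.
split; last by rewrite -ec /cint /Rintegral !E.
split; apply/integrableP; split; try exact/measurable_EFinP; rewrite E.
  by have /integrableP[] := ir.
by have /integrableP[] := ii.
Qed.

End GaussianTuplesCat.

Section EuclideanAlgebra.
Variables (R : realType) (V : euclidean R).
Implicit Types (x y z : V) (a : R).

Lemma eipDl x y z : eip (x + y) z = eip x z + eip y z.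
Proof. by have := eip_linear 1 x y z; rewrite scale1r mul1r. Qed.

Lemma eipZl a x z : eip (a *: x) z = a * eip x z.
Proof. by have := eip_linear a x 0 z; rewrite addr0 eip0l addr0. Qed.

Lemma eipDr x y z : eip z (x + y) = eip z x + eip z y.
Proof. by rewrite eipC eipDl !(eipC z). Qed.

Lemma eipZr a x z : eip z (a *: x) = a * eip z x.
Proof. by rewrite eipC eipZl eipC. Qed.

Lemma eip_suml (I : Type) (r : seq I) (P : pred I) (F : I -> V) z :
  eip (\sum_(i <- r | P i) F i) z = \sum_(i <- r | P i) eip (F i) z.
Proof.
elim/big_rec2: _ => [|i u v _ <-]; first exact: eip0l.
exact: eipDl.
Qed.

Lemma eip_sum_basis x y : eip x y = \sum_i eip x (ebasis i) * eip y (ebasis i).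
Proof.
rewrite {1}(ebasis_span x) eip_suml; apply: eq_bigr => i _.
by rewrite eipZl (eipC y).
Qed.

Lemma eip_ge0 x : 0 <= eip x x.
Proof. by rewrite eip_sum_basis sumr_ge0 // => i _; rewrite -expr2 sqr_ge0. Qed.

Lemma eip_evec (t : (edim V).-tuple (measurableTypeR R)) i : eip (evec t : V) (ebasis i) = tnth t i.
Proof. by rewrite -[in RHS](evecK t) tnth_mktuple. Qed.

End EuclideanAlgebra.

(** * The Gaussian measure of a Euclidean space *)

Section GaussianMeasure.
Variables (R : realType) (V : euclidean R).
Local Notation T := (measurableTypeR R).
Local Notation C := R[i].
Local Notation N01 := (normal_prob 0 1 : probability T R).
Local Notation mu := (gauss V).

Lemma measurable_ecoord : measurable_fun setT (@ecoord R V : borel V -> _).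
Proof.
move=> _ A mA; rewrite setTI; exists A => //.
by rewrite setTI.
Qed.

Lemma mfun_eip (y : V) : measurable_fun setT (fun x : borel V => eip (x : V) y).
Proof.
rewrite (funext (fun x => eip_sum_basis x y : eip (x : V) y = _)).
apply: measurable_sum_fun => i _.
apply: measurable_funM => //.
rewrite (_ : (fun x : borel V => eip (x : V) (ebasis i)) =
             (fun t => tnth t i) \o (@ecoord R V : borel V -> _)).
  by apply: measurableT_comp; [exact: measurable_tnth_tuple|exact: measurable_ecoord].
by apply/funext => x /=; rewrite tnth_mktuple.
Qed.

Lemma cint_gauss_prod (phi : 'I_(edim V) -> T -> C) :
  (forall j, cinteg N01 (phi j)) ->
  cinteg mu (fun x : V => \prod_j phi j (eip x (ebasis j))) /\
  cint mu (fun x : V => \prod_j phi j (eip x (ebasis j))) = \prod_j cint N01 (phi j).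
Proof.
move=> h; have [ig eg] := cint_gauss_tuple_prod h.
have E : (fun x : V => \prod_j phi j (eip x (ebasis j))) \o (@evec R V) =
    (fun t => \prod_j phi j (tnth t j)).
  by apply/funext => t; apply: eq_bigr => j _; rewrite eip_evec.
have [mr mi] : cmfun (fun x : borel V => \prod_j phi j (eip (x : V) (ebasis j))).
  apply: cmfun_prod => j; apply: (cmfun_comp (cinteg_mfun (h j))).
  exact: mfun_eip.
have [|ic ec] := @cint_distribution _ _ _ _ _ (gauss_tuple R (edim V)) (@evec R V : _ -> borel V) _ mr mi.
  by rewrite E.
split; first exact: ic.
by rewrite -eg -E -ec.
Qed.

Lemma gauss_mgf (y : V) :
  (\int[mu]_x (expR (eip (x : V) y))%:E = (expR (eip y y / 2))%:E)%E.
Proof.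
pose c j := eip y (ebasis j).
have h1 j : integ N01 (fun a => expR (c j * a)) /\ Rintegral N01 setT (fun a => expR (c j * a)) = expR (c j ^+ 2 / 2).
  have h : (\int[N01]_a (expR (c j * a))%:E = (expR (c j ^+ 2 / 2))%:E)%E.
    have := normal_mgf 0 (c j) (oner_neq0 R); rewrite expr1n mul1r.
    by under eq_integral do rewrite subr0.
  split; last by rewrite /Rintegral h.
  apply: integ_ge0 => [|a|]; last by rewrite h ltry.
    by apply: mfun_expR; exact: mfunZ.
  exact: expR_ge0.
have h2 j := cinteg_real (h1 j).1.
have [ii e] := cint_gauss_prod (fun j => (h2 j).1).
have E : (fun x : V => \prod_j (expR (c j * eip x (ebasis j)))%:C) = (fun x : V => (expR (eip x y))%:C).
  apply/funext => x; rewrite -rmorph_prod -expR_sum; congr (expR _)%:C.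
  by rewrite eip_sum_basis; apply: eq_bigr => j _; rewrite mulrC.
rewrite E in ii e; have ir' : integ mu (fun x : V => expR (eip x y)) := ii.1.
rewrite (Rintegral_EFin ir'); congr EFin; have := congr1 (@complex.Re R) e; rewrite /= => ->.
have -> : \prod_j cint N01 (fun a => (expR (c j * a))%:C) = (\prod_j expR (c j ^+ 2 / 2))%:C.
  by rewrite rmorph_prod; apply: eq_bigr => j _; rewrite (h2 j).2 (h1 j).2.
rewrite /= -expR_sum; congr expR; rewrite eip_sum_basis mulr_suml.
by apply: eq_bigr => j _; rewrite expr2.
Qed.

(** The pairings with [y] and [z] form a Gaussian pair of covariance [eip y z]: their joint moment
    generating function is [gauss_mgf] at [s *: y + t *: z]. *)
Lemma gauss_hcoefM (y z : V) m n :
  integ mu (fun x : V => hcoef (eip x y) (eip y y) m * hcoef (eip x z) (eip z z) n) /\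
  Rintegral mu setT (fun x : V => hcoef (eip x y) (eip y y) m * hcoef (eip x z) (eip z z) n) =
  if m == n then eip y z ^+ m / m`!%:R else 0.
Proof.
apply: E_hcoefM; try exact: mfun_eip; try exact: eip_ge0.
move=> s t; rewrite [LHS](_ : _ = (\int[mu]_x (expR (eip (x : V) (s *: y + t *: z)))%:E)%E).
  rewrite gauss_mgf; congr (expR _)%:E.
  by rewrite !(eipDl, eipDr, eipZl, eipZr) (eipC z y); field.
by apply: eq_integral => x _; rewrite eipDr !eipZr.
Qed.

End GaussianMeasure.

Section GaussianPairIntegral.
Variables (R : realType) (V : euclidean R).
Local Notation T := (measurableTypeR R).
Local Notation C := R[i].
Local Notation N01 := (normal_prob 0 1 : probability T R).
Local Notation W := (euclidean_prod V V).
Local Notation n := (edim V).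

Lemma prod_basis_lshift (i : 'I_n) : @ebasis R W (lshift n i) = ((ebasis i, 0) : W).
Proof. by rewrite /= /prod_basis (unsplitK (inl i)). Qed.

Lemma prod_basis_rshift (i : 'I_n) : @ebasis R W (rshift n i) = ((0, ebasis i) : W).
Proof. by rewrite /= /prod_basis (unsplitK (inr i)). Qed.

(** Factor [j] couples only the [j]-th coordinates of the two halves. The separable majorant [b]
    justifies Fubini; integrating over the second half leaves the product of the [k j], and the
    first half is then a product integral. *)
Lemma cint_gauss_prod2 (h : 'I_n -> T -> T -> C) (k : 'I_n -> T -> C) (b : 'I_n -> T -> R) :
  (forall j, cmfun (fun p : T * T => h j p.1 p.2)) ->
  (forall j a a', normc (h j a a') <= b j a * b j a') ->
  (forall j, integ N01 (b j)) -> (forall j a, 0 <= b j a) ->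
  (forall j a, cinteg N01 (h j a) /\ cint N01 (h j a) = k j a) ->
  (forall j, cinteg N01 (k j)) ->
  cinteg (gauss W) (fun x : W => \prod_j h j (eip x.1 (ebasis j)) (eip x.2 (ebasis j))) /\
  cint (gauss W) (fun x : W => \prod_j h j (eip x.1 (ebasis j)) (eip x.2 (ebasis j))) =
  \prod_j cint N01 (k j).
Proof.
move=> mh hb ib b0 hk ik.
pose F (t : (n + n).-tuple T) := \prod_j h j (tnth t (lshift n j)) (tnth t (rshift n j)).
have mF : cmfun F.
  apply: cmfun_prod => j.
  apply: (@cmfun_comp _ _ _ _ _ (fun p : T * T => h j p.1 p.2)
    (fun t : (n + n).-tuple T => (tnth t (lshift n j), tnth t (rshift n j)))) => //.
  by apply: measurable_fun_pair; exact: measurable_tnth_tuple.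
pose B (t : n.-tuple T) := \prod_j b j (tnth t j).
have iB : integ (gauss_tuple R n) B.
  have [[+ _] _] := cint_gauss_tuple_prod (fun j => (cinteg_real (ib j)).1).
  by congr integ; apply/funext => t; rewrite -rmorph_prod.
have FE s t : (F \o @tuple_cat R n n) (s, t) = \prod_j h j (tnth s j) (tnth t j).
  by apply: eq_bigr => j _; rewrite tnth_lshift tnth_rshift.
have [mFr mFi] := cmfun_comp mF (@measurable_tuple_cat R n n).
have iF : cinteg (gauss_tuple R n \x gauss_tuple R n)%E (F \o @tuple_cat R n n).
  apply: (cinteg_le mFr mFi _ (Rintegral_prod iB iB).1) => -[s t].
  rewrite FE /B -big_split /=.
  rewrite (_ : normc _ = \prod_j normc (h j (tnth s j) (tnth t j))).
    by apply: ler_prod => j _; rewrite normc_ge0 hb.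
  by rewrite (big_morph _ (@normcM R) (@normc1 R)).
have [iG eG] := cint_gauss_tuple_cat mF iF.
have in_ s : cinteg (gauss_tuple R n) (fun t => (F \o @tuple_cat R n n) (s, t)) /\
    cint (gauss_tuple R n) (fun t => (F \o @tuple_cat R n n) (s, t)) = \prod_j k j (tnth s j).
  under [X in cinteg _ X]eq_fun do rewrite FE.
  under [X in cint _ X]eq_fun do rewrite FE.
  have [i e] := cint_gauss_tuple_prod (fun j => (hk j (tnth s j)).1).
  by split=> //; rewrite e; apply: eq_bigr => j _; exact: (hk j _).2.
rewrite (cint_fubini iF (fun s => (in_ s).1)) in eG.
rewrite (eq_cint _ (fun s => (in_ s).2)) (cint_gauss_tuple_prod ik).2 in eG.
have E : (fun x : W => \prod_j h j (eip x.1 (ebasis j)) (eip x.2 (ebasis j))) \o (@evec R W) = F.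
  apply/funext => t; apply: eq_bigr => j _.
  rewrite -(@eip_evec R W t (lshift n j)) -(@eip_evec R W t (rshift n j)) prod_basis_lshift prod_basis_rshift.
  by rewrite /= /prod_ip /= !eip0r addr0 add0r.
have [mr mi] : cmfun (fun x : borel W => \prod_j h j (eip (x : W).1 (ebasis j)) (eip (x : W).2 (ebasis j))).
  have -> : (fun x : borel W => \prod_j h j (eip (x : W).1 (ebasis j)) (eip (x : W).2 (ebasis j))) =
     F \o (@ecoord R W : borel W -> _).
    by rewrite -E; apply/funext => x /=; rewrite ecoordK.
  exact: (cmfun_comp mF (@measurable_ecoord R W)).
have [|ic ec] := @cint_distribution _ _ _ _ _ (gauss_tuple R (edim W)) (@evec R W : _ -> borel W) _ mr mi.
  by rewrite E.
split; first exact: ic.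
by rewrite -eG -E -ec.
Qed.

End GaussianPairIntegral.

Lemma cexp_sum (R : realType) (I : Type) (r : seq I) (P : pred I) (F : I -> R[i]) :
  cexp (\sum_(i <- r | P i) F i) = \prod_(i <- r | P i) cexp (F i).
Proof. by rewrite (big_morph _ (@cexpD R) (cexp0 R)). Qed.

Section GaussianPairQuad.
Variables (R : realType) (V : euclidean R) (e : R).
Hypothesis e0 : 0 < e.
Local Notation T := (measurableTypeR R).
Local Notation C := R[i].
Local Notation N01 := (normal_prob 0 1 : probability T R).
Local Notation W := (euclidean_prod V V).

Let en0 : e != 0. Proof. by rewrite gt_eqF. Qed.
Let q0 : 1 + e ^+ 2 != 0. Proof. by rewrite gt_eqF // ltr_wpDr // sqr_ge0. Qed.

(* For fixed [a], integrating over [b] is a Gaussian Fourier transform with value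
   [k f g a]; the integral over [a] is then again Gaussian, with [p = e + e^-1]. *)
Let h (f g a b : R) : C :=
  ((expR ((1 - e) * (a ^+ 2 / 2)))%:C * cexp ('i%C * (f * a)%:C)) *
  ((expR ((1 - e) * (b ^+ 2 / 2) + 0 * b))%:C * cexp ('i%C * ((a + g) * b)%:C)).

Let k (f g a : R) : C :=
  ((expR ((1 - e) * (a ^+ 2 / 2)))%:C * cexp ('i%C * (f * a)%:C)) *
  (((Num.sqrt e)^-1 * expR (0 ^+ 2 / (2 * e)))%:C *
    cexp ('i%C * ((a + g) * (0 / e))%:C - ((a + g) ^+ 2 / (2 * e))%:C)).

Let mfun_sq : measurable_fun setT (fun a : T => (1 - e) * (a ^+ 2 / 2)).
Proof.
by apply: mfunZ; under eq_fun do rewrite mulrC; apply: mfunZ; exact: measurable_funX.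
Qed.

Let cmfun_i d (U : measurableType d) (f : U -> R) :
  measurable_fun setT f -> cmfun (fun x => cexp ('i%C * (f x)%:C)).
Proof.
move=> mf; apply: cmfun_cexp; apply: cmfunM; first exact: cmfun_cst.
exact: cmfun_real.
Qed.

Let hk f g a : cinteg N01 (h f g a) /\ cint N01 (h f g a) = k f g a.
Proof.
have [i c] := cint_gauss_quad 0 (a + g) e0.
have [i' c'] := cintegZ ((expR ((1 - e) * (a ^+ 2 / 2)))%:C * cexp ('i%C * (f * a)%:C)) i.
by split; [exact: i'|apply: (etrans c'); rewrite c].
Qed.

Let cint_k f g : cinteg N01 (k f g) /\ cint N01 (k f g) =
  (Num.sqrt (1 + e ^+ 2))^-1%:C *
  cexp ((- (e * (f ^+ 2 + g ^+ 2) / (2 * (1 + e ^+ 2))))%:C -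
        'i%C * (f * g / (1 + e ^+ 2))%:C).
Proof.
pose p := e + e^-1; have p0 : 0 < p by rewrite addr_gt0 // invr_gt0.
have pn0 : p != 0 by rewrite gt_eqF.
(* Collects what does not involve [a]: the normalization of the inner integral and the constant term
   of [(a + g) ^+ 2 / (2 * e)]. The cross term of that square becomes the linear coefficient
   [- g / e]. *)
pose K := (Num.sqrt e)^-1 * expR (- (g ^+ 2 / (2 * e))).
have [i c] := cint_gauss_quad (- g / e) f p0.
have [i' c'] := cintegZ K%:C i.
have E : k f g = (fun a => K%:C * ((expR ((1 - p) * (a ^+ 2 / 2) + - g / e * a))%:C * cexp ('i%C * (f * a)%:C))).
  apply/funext => a; rewrite /k /K.
  have -> : 'i%C * ((a + g) * (0 / e))%:C - ((a + g) ^+ 2 / (2 * e))%:C = - ((a + g) ^+ 2 / (2 * e))%:C.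
    by rewrite mul0r mulr0 rmorph0 mulr0 sub0r.
  rewrite expr0n mul0r expR0 mulr1.
  rewrite (rmorphM _ (Num.sqrt e)^-1) /= -!cexp_real.
  rewrite [LHS](_ : _ = (Num.sqrt e)^-1%:C * (cexp ((1 - e) * (a ^+ 2 / 2))%:C *
    cexp ('i * (f * a)%:C) * cexp (- ((a + g) ^+ 2 / (2 * e))%:C))); last by ring.
  rewrite [RHS](_ : _ = (Num.sqrt e)^-1%:C * (cexp (- (g ^+ 2 / (2 * e)))%:C *
    cexp ((1 - p) * (a ^+ 2 / 2) + - g / e * a)%:C * cexp ('i * (f * a)%:C))); last by ring.
  rewrite -!cexpD; congr (_ * cexp _).
  by apply/eqP; rewrite eq_complex /p /=; apply/andP; split; apply/eqP; field.
rewrite E; split; first exact: i'.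
apply: (etrans c'); rewrite c.
(* Because [e * p = 1 + e ^+ 2]. *)
have -> : (Num.sqrt (1 + e ^+ 2))^-1 = (Num.sqrt e)^-1 * (Num.sqrt p)^-1.
  rewrite -invfM -sqrtrM ?(ltW e0) //; congr (Num.sqrt _)^-1.
  by rewrite /p; field.
rewrite /K !(rmorphM _ (Num.sqrt e)^-1) (rmorphM _ (Num.sqrt p)^-1) /= -!cexp_real.
set s := (Num.sqrt e)^-1%:C; set s' := (Num.sqrt p)^-1%:C.
rewrite [LHS](_ : _ = s * s' * (cexp (- (g ^+ 2 / (2 * e)))%:C *
   cexp ((- g / e) ^+ 2 / (2 * p))%:C *
   cexp ('i * (f * (- g / e / p))%:C - (f ^+ 2 / (2 * p))%:C))); last by ring.
rewrite -!cexpD; congr (_ * cexp _).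
by apply/eqP; rewrite eq_complex /p /=; apply/andP; split; apply/eqP; field; rewrite ?q0 ?en0 //= addrC q0.
Qed.

(** The exponent decouples into [edim V] copies of the planar form with matrix [((e, -i), (-i, e))].
    Its determinant [1 + e ^+ 2] gives the prefactor, and its inverse the quadratic form in [y]. *)
Lemma cint_gauss_quad2 (y : W) :
  let F (x : W) := cexp ('i%C * (eip x y)%:C) *
    cexp ((2^-1 * (1 - e) * eip x x)%:C + 'i%C * (eip x.1 x.2)%:C) in
  cinteg (gauss W) F /\
  cint (gauss W) F = ((Num.sqrt (1 + e ^+ 2))^-1 ^+ edim V)%:C *
    cexp ((- (e * eip y y / (2 * (1 + e ^+ 2))))%:C -
          'i%C * (eip y.1 y.2 / (1 + e ^+ 2))%:C).
Proof.
pose f j := eip y.1 (ebasis j); pose g j := eip y.2 (ebasis j).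
pose b (_ : 'I_(edim V)) (a : T) := expR ((1 - e) * (a ^+ 2 / 2)).
have mb j : measurable_fun setT (b j) by exact: mfun_expR.
have mh j : cmfun (fun p : T * T => h (f j) (g j) p.1 p.2).
  have m1 : measurable_fun setT (fst : T * T -> T) by [].
  have m2 : measurable_fun setT (snd : T * T -> T) by [].
  apply: cmfunM; apply: cmfunM.
  - by apply: cmfun_real; exact: (measurableT_comp (mb j) m1).
  - by apply: cmfun_i; exact: mfunZ.
  - apply: cmfun_real; apply: mfun_expR; apply: measurable_funD; last exact: mfunZ.
    exact: (measurableT_comp mfun_sq m2).
  - apply: cmfun_i; apply: measurable_funM => //.
    exact: measurable_funD.
(* The coupling of [a] and [a'] is a pure phase, so the modulus factorizes. *)
have hb j a a' : normc (h (f j) (g j) a a') <= b j a * b j a'.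
  rewrite /h normcM [X in X * _]normcM [X in _ * X]normcM !normc_cexp !normc_real !gtr0_norm ?expR_gt0 //=.
  by rewrite !(mul0r, mulr0, subr0, expR0, mulr1, addr0).
have ib j : integ N01 (b j).
  have [[+ _] _] := cint_gauss_quad 0 0 e0.
  congr integ; apply/funext => a; rewrite complexReM cexp_i !mul0r cos0 sin0 /=.
  by rewrite subr0 mulr1 addr0.
have b0 j a : 0 <= b j a by exact: expR_ge0.
have [ic c] := cint_gauss_prod2 mh hb ib b0 (fun j => hk (f j) (g j)) (fun j => (cint_k (f j) (g j)).1).
move=> F.
have E : F = (fun x : W => \prod_j h (f j) (g j) (eip x.1 (ebasis j)) (eip x.2 (ebasis j))).
  apply/funext => x; rewrite /F -cexpD.
  pose u j := 2^-1 * (1 - e) * (eip x.1 (ebasis j) * eip x.1 (ebasis j) +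
    eip x.2 (ebasis j) * eip x.2 (ebasis j)).
  pose w j := eip x.1 (ebasis j) * f j + eip x.2 (ebasis j) * g j +
    eip x.1 (ebasis j) * eip x.2 (ebasis j).
  rewrite [RHS](eq_bigr (fun j => cexp ((u j)%:C + 'i%C * (w j)%:C))); last first.
    move=> j _; rewrite /h -!cexp_real -!cexpD; congr cexp.
    by apply/eqP; rewrite eq_complex /u /w /=; apply/andP; split; apply/eqP; field.
  rewrite -cexp_sum; congr cexp; rewrite big_split -mulr_sumr /= -!rmorph_sum.
  rewrite addrCA -mulrDr -rmorphD /=; congr (_%:C + _ * _%:C).
    by rewrite /prod_ip !eip_sum_basis -big_split mulr_sumr.
  by rewrite /prod_ip !(eip_sum_basis x.1) !(eip_sum_basis x.2) -!big_split.
rewrite E; split; first exact: ic.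
apply: (etrans c); rewrite (eq_bigr _ (fun j _ => (cint_k (f j) (g j)).2)).
rewrite big_split /= prodr_const card_ord rmorphXn; congr (_ * _).
rewrite -cexp_sum; congr cexp; rewrite sumrB -mulr_sumr -!rmorph_sum.
congr (_%:C - _ * _%:C); last by rewrite eip_sum_basis mulr_suml.
rewrite /= /prod_ip !eip_sum_basis -big_split mulr_sumr mulr_suml sumrN.
by congr (- _); apply: eq_bigr => j _; rewrite !expr2.
Qed.

End GaussianPairQuad.

(** * Wick tensors and chaos decompositions *)

Section TupleSums.
Variables (I : finType) (K : comPzRingType).

Lemma sum_tuple0 (F : 0.-tuple I -> K) : \sum_i F i = F [tuple].
Proof. by rewrite (big_pred1 [tuple]) // => i; rewrite (tuple0 i) /= eqxx. Qed.

Lemma sum_tuple_cons n (F : seq I -> K) :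
  \sum_(i : n.+1.-tuple I) F i = \sum_a \sum_(i : n.-tuple I) F (a :: i).
Proof.
rewrite pair_bigA /= (reindex (fun p : I * n.-tuple I => [tuple of p.1 :: p.2])) //=.
exists (fun t : n.+1.-tuple I => (thead t, [tuple of behead t])) => [[a i]|t] _ /=.
  by congr pair; exact/val_inj.
by rewrite [RHS]tuple_eta; exact/val_inj.
Qed.

Arguments sum_tuple_cons {n} F.

(* The entries of [Q^{(x)m}] for sequences of length [2m]; [0] for odd lengths. *)
Fixpoint qseq (Q : I -> I -> K) (s : seq I) : K :=
  match s with
  | [::] => 1
  | [:: _] => 0
  | a :: b :: s' => Q a b * qseq Q s'
  end.

(* The entries of [x^{(x)k} (x) Q^{(x)m}]. *)
Fixpoint pqseq (x : I -> K) (Q : I -> I -> K) (k : nat) (s : seq I) : K :=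
  match k, s with
  | 0, _ => qseq Q s
  | k'.+1, a :: s' => x a * pqseq x Q k' s'
  | _.+1, [::] => 0
  end.

(** Induction in steps of two: summing over the first two indices splits off one factor [q]. Odd
    lengths end in a one-letter sequence, where [qseq] is [0]. *)
Lemma sum_qseq Q (y : I -> K) n :
  \sum_(i : n.-tuple I) qseq Q i * \prod_(a <- i) y a =
  evencoef (fun m => (\sum_a \sum_b Q a b * y a * y b) ^+ m) n.
Proof.
set q := \sum_a _; have [m] := ubnP n; elim: m n => // m IH [|[|n]] nm.
- by rewrite sum_tuple0 /= big_nil mulr1 /evencoef /= expr0.
- rewrite (sum_tuple_cons (fun s => qseq Q s * \prod_(a <- s) y a)) big1 // => a _.
  by rewrite sum_tuple0 /= mul0r.
rewrite (sum_tuple_cons (fun s => qseq Q s * \prod_(a <- s) y a)).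
under eq_bigr => a _.
  rewrite (sum_tuple_cons (fun s => qseq Q (a :: s) * \prod_(a <- a :: s) y a)).
  under eq_bigr => b _.
    rewrite (eq_bigr (fun i : n.-tuple I =>
      Q a b * y a * y b * (qseq Q i * \prod_(c <- i) y c))); last first.
      by move=> i _; rewrite /= !big_cons; ring.
    rewrite -mulr_sumr IH; last by rewrite -ltnS ltnW.
    over.
  rewrite -mulr_suml.
  over.
rewrite -mulr_suml -/q /evencoef /= negbK; case: (odd n); first by rewrite mulr0.
by rewrite exprS.
Qed.

Lemma sum_pqseq x Q (y : I -> K) k m :
  \sum_(i : (k + m).-tuple I) pqseq x Q k i * \prod_(a <- i) y a =
  (\sum_a x a * y a) ^+ k *
  evencoef (fun m => (\sum_a \sum_b Q a b * y a * y b) ^+ m) m.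
Proof.
elim: k => [|k IH]; first by rewrite expr0 mul1r -sum_qseq.
rewrite (sum_tuple_cons (fun s => pqseq x Q k.+1 s * \prod_(a <- s) y a)) /=.
under eq_bigr => a _.
  under eq_bigr => i _ do rewrite big_cons mulrACA.
  rewrite -mulr_sumr IH; over.
by rewrite -mulr_suml exprS mulrA.
Qed.

End TupleSums.

Arguments sum_tuple_cons {I K n} F.

(** * Polarization by signs *)

Section SignPolarization.
Variable K : comPzRingType.

Definition signb (b : bool) : K := (-1) ^+ b.

(* Averaging over the signs kills the non-bijective maps in the expanded product. *)
Lemma sum_sign_prod n (a : 'I_n -> 'I_n -> K) :
  \sum_(sg : {ffun 'I_n -> bool}) (\prod_l signb (sg l)) *
     \prod_k \sum_l signb (sg l) * a k l =
  2 ^+ n * \sum_(s : 'S_n) \prod_k a k (s k).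
Proof.
have D (F : 'I_n -> 'I_n -> K) :
    \prod_k \sum_l F k l = \sum_(f : {ffun 'I_n -> 'I_n}) \prod_k F k (f k).
  exact: bigA_distr_bigA.
have D2 (sg : {ffun 'I_n -> bool}) : \prod_k \sum_l signb (sg l) * a k l =
    \sum_(f : {ffun 'I_n -> 'I_n}) (\prod_k signb (sg (f k))) * (\prod_k a k (f k)).
  by rewrite D; apply: eq_bigr => f _; rewrite -big_split.
rewrite (eq_bigr (fun sg : {ffun 'I_n -> bool} => \sum_(f : {ffun 'I_n -> 'I_n})
    (\prod_l signb (sg l)) * (\prod_k signb (sg (f k))) * (\prod_k a k (f k)))); last first.
  by move=> sg _; rewrite D2 mulr_sumr; apply: eq_bigr => f _; rewrite mulrA.
rewrite exchange_big /=.
(* Summing over the sign at [l] gives [1 + (-1) ^+ (c f l).+1], which is [2] when [l] has one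
   preimage and [0] when it has none. A map that is not injective misses some [l], so its term
   vanishes. *)
pose c (f : {ffun 'I_n -> 'I_n}) l := #|[pred k | f k == l]|.
have E (f : {ffun 'I_n -> 'I_n}) : \sum_(sg : {ffun 'I_n -> bool})
    (\prod_l signb (sg l)) * (\prod_k signb (sg (f k))) * (\prod_k a k (f k)) =
    (if injectiveb f then 2 ^+ n else 0) * \prod_k a k (f k).
  rewrite -mulr_suml; congr (_ * _).
  transitivity (\sum_(sg : {ffun 'I_n -> bool}) \prod_l signb (sg l) ^+ (c f l).+1).
    apply: eq_bigr => sg _.
    have -> : \prod_k signb (sg (f k)) = \prod_l signb (sg l) ^+ c f l.
      rewrite (partition_big f xpredT) //=; apply: eq_bigr => l _.
      transitivity (\prod_(k | f k == l) signb (sg l)); last by rewrite prodr_const.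
      by apply: eq_bigr => k /eqP ->.
    by rewrite -big_split; apply: eq_bigr => l _; rewrite exprS.
  have D' (F : 'I_n -> bool -> K) :
      \prod_l \sum_b F l b = \sum_(sg : {ffun 'I_n -> bool}) \prod_l F l (sg l).
    exact: bigA_distr_bigA.
  rewrite -(D' (fun l b => signb b ^+ (c f l).+1)).
  under eq_bigr => l _ do rewrite big_bool /signb /= expr1 expr0 expr1n.
  case: ifPn => [/injectiveP finj|].
    rewrite (eq_bigr (fun=> 2)) ?prodr_const ?card_ord // => l _.
    have [g fg gf] := injF_bij finj.
    have -> : c f l = 1%N.
      rewrite /c -(card1 (g l)); apply: eq_card => k; rewrite !inE.
      by apply/eqP/eqP => [<-|->]; rewrite ?fg ?gf.
    by rewrite sqrrN expr1n.
  move=> ninj.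
  have [l cl] : exists l, c f l = 0%N.
    have : ~~ [forall l, [exists k, f k == l]].
      apply: contra ninj => /forallP h; apply/injectiveP.
      have gK : cancel (fun l => xchoose (existsP (h l))) f.
        by move=> l; apply/eqP; exact: (xchooseP (existsP (h l))).
      exact: can_inj (canF_sym gK).
    rewrite negb_forall => /existsP[l]; rewrite negb_exists => /forallP h.
    by exists l; apply: eq_card0 => k; rewrite !inE; apply/negbTE/h.
  by rewrite (bigD1 l) //= cl expr1 addNr mul0r.
rewrite (eq_bigr _ (fun f _ => E f)).
rewrite (bigID (fun f : {ffun 'I_n -> 'I_n} => injectiveb f)) /=.
rewrite [X in _ + X]big1 ?addr0; last by move=> f /negbTE ->; rewrite mul0r.
transitivity (\sum_(f : {ffun 'I_n -> 'I_n} | injectiveb f) 2 ^+ n * \prod_k a k (f k)).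
  by apply: eq_bigr => f ->.
rewrite -mulr_sumr; congr (_ * _).
rewrite (reindex_onto (fun s : 'S_n => pval s) (fun f => insubd (1%g : 'S_n) f)) /=; last first.
  by move=> f hf; rewrite insubdK.
apply: eq_big => [s|s _]; last by apply: eq_bigr => k _; rewrite pvalE.
by rewrite (valP s) /=; apply/eqP; exact: valKd.
Qed.

End SignPolarization.

(** * Symmetric tensors and the explicit Wick tensors *)

Section Tensors.
Variables (R : realType) (V : euclidean R).
Local Notation I := 'I_(edim V).
Local Notation signR := (signb R).
Implicit Types (x y z : V).

Definition tuple_perm n (i : n.-tuple I) (s : 'S_n) : n.-tuple I :=
  [tuple tnth i (s k) | k < n].

Lemma tuple_permM n (i : n.-tuple I) (s s' : 'S_n) : tuple_perm (tuple_perm i s) s' = tuple_perm i (s' * s)%g.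
Proof. by apply: eq_from_tnth => k; rewrite !tnth_mktuple permM. Qed.

Lemma tuple_perm1 n (i : n.-tuple I) : tuple_perm i 1%g = i.
Proof. by apply: eq_from_tnth => k; rewrite tnth_mktuple perm1. Qed.

Lemma sum_tuple_perm (A : nmodType) n (F : n.-tuple I -> A) s :
  \sum_i F (tuple_perm i s) = \sum_i F i.
Proof.
rewrite [RHS](reindex (fun i => tuple_perm i s)) //=.
exists (fun i => tuple_perm i s^-1%g) => i _.
  by rewrite tuple_permM mulVg tuple_perm1.
by rewrite tuple_permM mulgV tuple_perm1.
Qed.

Lemma tpow_tuple_perm n y (i : n.-tuple I) s : tpow n y (tuple_perm i s) = tpow n y i.
Proof.
rewrite !ffunE; rewrite [RHS](reindex_inj (@perm_inj _ s)) /=.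
by apply: eq_bigr => k _; rewrite tnth_mktuple.
Qed.

Lemma tsym_tpow n y : tsym (tpow n y).
Proof. by move=> s i; exact: tpow_tuple_perm. Qed.

Definition tsymz n (t : tensor V R n) : tensor V R n :=
  [ffun i : n.-tuple I => (n`!%:R)^-1 * \sum_(s : 'S_n) t (tuple_perm i s)].

Lemma tsym_tsymz n (t : tensor V R n) : tsym (tsymz t).
Proof.
move=> s i; rewrite -/(tuple_perm i s) !ffunE; congr (_ * _).
rewrite [RHS](reindex_inj (mulIg s)) /=.
by apply: eq_bigr => s' _; rewrite tuple_permM.
Qed.

Lemma fact_neq0 n : (n`!%:R : R) != 0.
Proof. by rewrite pnatr_eq0 -lt0n fact_gt0. Qed.

Lemma tpair_tsymz n (t : tensor V R n) y : tpair (tsymz t) (tpow n y) = tpair t (tpow n y).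
Proof.
rewrite /tpair; under eq_bigr => i _ do rewrite ffunE -mulrA mulr_suml.
rewrite -mulr_sumr exchange_big /= (eq_bigr (fun=> \sum_i t i * tpow n y i)).
  by rewrite sumr_const card_Sn -[X in _ * X]mulr_natl mulKf // fact_neq0.
move=> s _; rewrite -[RHS](sum_tuple_perm _ s).
by apply: eq_bigr => i _; rewrite tpow_tuple_perm.
Qed.

Definition polar n (i : n.-tuple I) (sg : {ffun 'I_n -> bool}) : V :=
  \sum_l signR (sg l) *: ebasis (tnth i l).

Lemma eip_polar n (i : n.-tuple I) sg a :
  eip (polar i sg) (ebasis a) = \sum_l signR (sg l) * (tnth i l == a)%:R.
Proof.
by rewrite /polar eip_suml; apply: eq_bigr => l _; rewrite eipZl ebasis_orthonormal.
Qed.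

Definition psign n (sg : {ffun 'I_n -> bool}) : R := \prod_l signR (sg l).

(** Recovers the symmetrized entry of [t] at [i] from its values on tensor powers of signed sums of
    the basis vectors listed in [i]. *)
Lemma polarization n (t : tensor V R n) i :
  \sum_sg psign sg * tpair t (tpow n (polar i sg)) = 2 ^+ n * \sum_(s : 'S_n) t (tuple_perm i s).
Proof.
transitivity (\sum_j t j * \sum_(sg : {ffun 'I_n -> bool}) psign sg *
    \prod_k \sum_l signR (sg l) * (tnth i l == tnth j k)%:R).
  rewrite /tpair; under eq_bigr => sg _ do rewrite mulr_sumr.
  rewrite exchange_big /=; apply: eq_bigr => j _; rewrite mulr_sumr.
  apply: eq_bigr => sg _; rewrite mulrCA ffunE; congr (_ * (_ * _)).
  by apply: eq_bigr => k _; exact: eip_polar.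
under eq_bigr => j _.
  rewrite (sum_sign_prod (fun k l => (tnth i l == tnth j k)%:R)) mulrCA; over.
rewrite -mulr_sumr; congr (_ * _).
under eq_bigr => j _ do rewrite mulr_sumr.
rewrite exchange_big /=; apply: eq_bigr => s _.
rewrite (bigD1 (tuple_perm i s)) //= [X in X + _](_ : _ = t (tuple_perm i s)); last first.
  by rewrite big1 ?mulr1 // => k _; rewrite tnth_mktuple eqxx.
rewrite [X in _ + X](_ : _ = 0) ?addr0 //; apply: big1 => j ne.
suff [k nk] : exists k, tnth i (s k) != tnth j k.
  by rewrite (bigD1 k) //= (negPf nk) mul0r mulr0.
apply/existsP; apply: contraNT ne; rewrite negb_exists => /forallP h.
by apply/eqP/eq_from_tnth => k; rewrite tnth_mktuple; apply/esym/eqP; rewrite -[_ == _]negbK.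
Qed.

Lemma polarization_sym n (t : tensor V R n) i : tsym t ->
  t i = (2 ^+ n * n`!%:R)^-1 * \sum_sg psign sg * tpair t (tpow n (polar i sg)).
Proof.
move=> ts; rewrite polarization (eq_bigr (fun=> t i)); last by move=> s _; exact: ts.
rewrite sumr_const card_Sn -(mulr_natl (t i)) [X in _ * X]mulrA mulKf //.
Qed.

Lemma tpow_val n y (i : n.-tuple I) : tpow n y i = \prod_(a <- i) eip y (ebasis a).
Proof. by rewrite ffunE big_tuple. Qed.

Lemma tpair_tpow n y z : tpair (tpow n y) (tpow n z) = eip y z ^+ n.
Proof.
rewrite /tpair; under eq_bigr => i _ do rewrite !tpow_val -big_split /=.
elim: n => [|n IH]; first by rewrite sum_tuple0 big_nil expr0.
rewrite (sum_tuple_cons (fun s => \prod_(a <- s) (eip y (ebasis a) * eip z (ebasis a)))).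
under eq_bigr => a _.
  under eq_bigr => i _ do rewrite big_cons.
  rewrite -mulr_sumr IH; over.
by rewrite -mulr_suml -eip_sum_basis exprS.
Qed.

Lemma tpow_scale n (r : R) y : tpow n (r *: y) = [ffun i => r ^+ n * tpow n y i].
Proof.
apply/ffunP => i; rewrite !ffunE.
have -> : r ^+ n = \prod_(k < n) r by rewrite prodr_const card_ord.
by rewrite -big_split; apply: eq_bigr => k _; rewrite eipZl.
Qed.

Lemma tpair_tpow_scale (t : forall n, tensor V R n) n (r : R) y :
  tpair (t n) (tpow n (r *: y)) = r ^+ n * tpair (t n) (tpow n y).
Proof.
rewrite /tpair mulr_sumr; apply: eq_bigr => i _.
by rewrite tpow_scale ffunE mulrCA.
Qed.

(** Degree [n] part of [exp(x) (x) exp(- trace / 2)], where [trace] is the tensor with entries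
    [(a == b)%:R]. It is not symmetric, whence [tsymz] in [is_wick_hermite]. *)
Definition hermite_tensor n x : tensor V R n :=
  [ffun i : n.-tuple I => n`!%:R * \sum_(k < n.+1) k`!%:R^-1 *
    (if odd (n - k) then 0 else exp_coeff (- 1 / 2) (n - k)./2) *
    pqseq (fun a => eip x (ebasis a)) (fun a b => (a == b)%:R) k i].

Lemma tpair_hermite_tensor n x y :
  tpair (hermite_tensor n x) (tpow n y) = n`!%:R * hcoef (eip x y) (eip y y) n.
Proof.
rewrite /tpair; under eq_bigr => i _ do rewrite ffunE -mulrA mulr_suml tpow_val.
rewrite -mulr_sumr exchange_big /=; congr (_ * _); apply: eq_bigr => -[k /= kn] _.
set c := if odd (n - k) then _ else _.
transitivity (k`!%:R^-1 * c * \sum_(i : n.-tuple I)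
    pqseq (fun a => eip x (ebasis a)) (fun a b => (a == b)%:R) k i *
    \prod_(a <- i) eip y (ebasis a)).
  by rewrite mulr_sumr; apply: eq_bigr => i _; rewrite !mulrA.
have := @sum_pqseq _ R (fun a => eip x (ebasis a)) (fun a b => (a == b)%:R)
  (fun a => eip y (ebasis a)) k (n - k)%N.
rewrite (subnKC (kn : (k <= n)%N)) => ->.
have -> : \sum_a \sum_b (a == b)%:R * eip y (ebasis a) * eip y (ebasis b) = eip y y.
  rewrite eip_sum_basis; apply: eq_bigr => a _.
  rewrite (bigD1 a) //= eqxx mul1r big1 ?addr0 // => b ne.
  by rewrite eq_sym (negPf ne) !mul0r.
rewrite -eip_sum_basis /c /evencoef /exp_coeff /=; case: ifP => _.
  by rewrite !(mulr0, mul0r).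
rewrite [X in _ = _ * (X / _)](_ : _ = (- 1 / 2) ^+ (n - k)./2 * eip y y ^+ (n - k)./2).
  by ring.
by rewrite -exprMn; congr (_ ^+ _); ring.
Qed.

Lemma is_wick_hermite x : is_wick x (fun n => tsymz (hermite_tensor n x)).
Proof.
split=> [n|y]; first exact: tsym_tsymz.
have := @ccvg_hcoef_real _ 1 (eip x y) (eip y y).
rewrite mul1r expr1n mul1r.
have -> // : (fun n => 1 ^+ n * hcoef (eip x y) (eip y y) n) =
   (fun n => (n`!%:R)^-1 * tpair (tsymz (hermite_tensor n x)) (tpow n y)).
apply/funext => n; rewrite tpair_tsymz tpair_hermite_tensor expr1n mul1r.
by rewrite mulKf // fact_neq0.
Qed.

(** Evaluated at [t *: y], the generating function becomes a power series in [t], whose coefficients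
    are unique. *)
Lemma is_wick_tpair x w : is_wick x w -> forall n y,
  tpair (w n) (tpow n y) = n`!%:R * hcoef (eip x y) (eip y y) n.
Proof.
move=> [_ h] n y; apply: (mulfI (invr_neq0 (fact_neq0 n))); rewrite mulKf ?fact_neq0 //.
apply: (@power_series_inj _ (fun n => (n`!%:R)^-1 * tpair (w n) (tpow n y))
  (fun n => hcoef (eip x y) (eip y y) n)
  (fun t => expR (t * eip x y - t ^+ 2 * (eip y y / 2)))) => t t0.
  have := h (t *: y); rewrite eipZl !eipZr.
  have -> : t * (t * eip y y) / 2 = t ^+ 2 * (eip y y / 2) by ring.
  have -> // : (fun n => t ^+ n * ((n`!%:R)^-1 * tpair (w n) (tpow n y))) =
     (fun n => (n`!%:R)^-1 * tpair (w n) (tpow n (t *: y))).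
  by apply/funext => m; rewrite tpair_tpow_scale mulrCA.
exact: ccvg_hcoef_real.
Qed.

(** The Hermite tensors show that the set given to [xget] is inhabited, so its default value is
    never taken. *)
Lemma is_wick_wick x : is_wick x (wick x).
Proof.
rewrite /wick; case: xgetP => [w _ //|/(_ (fun n => tsymz (hermite_tensor n x)))].
by move=> h; exfalso; apply: h; exact: is_wick_hermite.
Qed.

Lemma tsym_wick x n : tsym (wick x n).
Proof. by have [h _] := is_wick_wick x; exact: h. Qed.

Lemma tpair_wick x n y :
  tpair (wick x n) (tpow n y) = n`!%:R * hcoef (eip x y) (eip y y) n.
Proof. exact: is_wick_tpair (is_wick_wick x) n y. Qed.

(** Each Wick entry is a combination of Hermite polynomials of linear functionals, which reduces its
    measurability and its moments to those of [hcoef]. *)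
Lemma wickE x n i : wick x n i = (2 ^+ n)^-1 *
  \sum_sg psign sg * hcoef (eip x (polar i sg)) (eip (polar i sg) (polar i sg)) n.
Proof.
rewrite (polarization_sym i (@tsym_wick x n)).
under eq_bigr => sg _ do rewrite tpair_wick mulrCA.
rewrite -mulr_sumr mulrA; congr (_ * _).
by rewrite invfM -mulrA mulVf ?mulr1 // fact_neq0.
Qed.

End Tensors.

(** * Orthogonality of Wick monomials and the chaos isometry *)

Section WickOrthogonality.
Variables (R : realType) (V : euclidean R).
Local Notation C := R[i].
Local Notation I := 'I_(edim V).
Local Notation mu := (gauss V).
Local Notation E f := (Rintegral mu setT f).
Implicit Types (x y z : V).

Definition hc n y : V -> R := fun x => hcoef (eip x y) (eip y y) n.

Lemma integ_hcM n m y z : integ mu (fun x : V => hc n y x * hc m z x).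
Proof. exact: (gauss_hcoefM y z n m).1. Qed.

Lemma wick_hcE n (i : n.-tuple I) x :
  wick x n i = \sum_(sg : {ffun 'I_n -> bool}) (2 ^+ n)^-1 * psign R sg * hc n (polar i sg) x.
Proof.
by rewrite wickE mulr_sumr; apply: eq_bigr => sg _; rewrite mulrA.
Qed.

(** Expanding [wick] by polarization produces powers of [eip (polar i sg) z], and the same
    polarization reassembles them into an entry of the tensor power of [z]. *)
Lemma integ_wick_hc n (i : n.-tuple I) m z :
  integ mu (fun x : V => wick x n i * hc m z x) /\
  E (fun x : V => wick x n i * hc m z x) = if n == m then tpow n z i else 0.
Proof.
have Ef : (fun x : V => wick x n i * hc m z x) = (fun x => \sum_(sg : {ffun 'I_n -> bool})
    ((2 ^+ n)^-1 * psign R sg) * (hc n (polar i sg) x * hc m z x)).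
  apply/funext => x; rewrite wick_hcE mulr_suml.
  by apply: eq_bigr => sg _; rewrite mulrA.
have ii sg : integ mu (fun x : V => ((2 ^+ n)^-1 * psign R sg) * (hc n (polar i sg) x * hc m z x)).
  by apply: integZ; exact: integ_hcM.
rewrite Ef; split; first by apply: integ_sum.
rewrite Rintegral_sum //.
transitivity (\sum_(sg : {ffun 'I_n -> bool}) ((2 ^+ n)^-1 * psign R sg) *
    (if n == m then eip (polar i sg) z ^+ n / n`!%:R else 0)).
  apply: eq_bigr => sg _; rewrite RintegralZl //; last exact: integ_hcM.
  by rewrite (gauss_hcoefM _ z n m).2.
case: eqP => _; last by rewrite big1 // => sg _; rewrite mulr0.
rewrite (polarization_sym i (@tsym_tpow R V n z)) invfM mulr_sumr.
apply: eq_bigr => sg _; rewrite tpair_tpow (eipC z).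
by set a := (2 ^+ n)^-1; set b := n`!%:R^-1; ring.
Qed.

Definition delta_tensor n (i : n.-tuple I) : tensor V R n := [ffun j => (j == i)%:R].

Lemma tpair_delta n (i : n.-tuple I) (t : tensor V R n) : tpair (delta_tensor i) t = t i.
Proof.
rewrite /tpair (bigD1 i) //= ffunE eqxx mul1r big1 ?addr0 // => j /negPf ne.
by rewrite ffunE ne mul0r.
Qed.

Lemma integ_wickM n (i : n.-tuple I) m (j : m.-tuple I) :
  integ mu (fun x : V => wick x n i * wick x m j) /\
  (n != m -> E (fun x : V => wick x n i * wick x m j) = 0).
Proof.
have Ef : (fun x : V => wick x n i * wick x m j) = (fun x => \sum_(sg : {ffun 'I_m -> bool})
    ((2 ^+ m)^-1 * psign R sg) * (wick x n i * hc m (polar j sg) x)).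
  apply/funext => x; rewrite [X in _ * X]wick_hcE mulr_sumr.
  by apply: eq_bigr => sg _; rewrite mulrCA.
have ii sg : integ mu (fun x : V => ((2 ^+ m)^-1 * psign R sg) * (wick x n i * hc m (polar j sg) x)).
  by apply: integZ; exact: (integ_wick_hc _ _ _).1.
rewrite Ef; split; first by apply: integ_sum.
move=> nm; rewrite Rintegral_sum // big1 // => sg _.
rewrite RintegralZl //; last exact: (integ_wick_hc _ _ _).1.
by rewrite (integ_wick_hc _ _ _).2 (negPf nm) mulr0.
Qed.

(** After expanding one factor, the remaining sum is [polarization] applied to the tensor
    concentrated at [i]. *)
Lemma E_wickM n (i j : n.-tuple I) :
  E (fun x : V => wick x n i * wick x n j) = \sum_(s : 'S_n) (tuple_perm j s == i)%:R.
Proof.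
have Ef : (fun x : V => wick x n i * wick x n j) = (fun x => \sum_(sg : {ffun 'I_n -> bool})
    ((2 ^+ n)^-1 * psign R sg) * (wick x n i * hc n (polar j sg) x)).
  apply/funext => x; rewrite [X in _ * X]wick_hcE mulr_sumr.
  by apply: eq_bigr => sg _; rewrite mulrCA.
have ii sg : integ mu (fun x : V => ((2 ^+ n)^-1 * psign R sg) * (wick x n i * hc n (polar j sg) x)).
  by apply: integZ; exact: (integ_wick_hc _ _ _).1.
rewrite Ef Rintegral_sum //.
transitivity ((2 ^+ n)^-1 * \sum_(sg : {ffun 'I_n -> bool})
   psign R sg * tpair (delta_tensor i) (tpow n (polar j sg))).
  rewrite mulr_sumr; apply: eq_bigr => sg _; rewrite mulrA RintegralZl //; last exact: (integ_wick_hc _ _ _).1.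
  by rewrite (integ_wick_hc _ _ _).2 eqxx tpair_delta.
rewrite polarization mulKf ?expf_neq0 //.
by apply: eq_bigr => s _; rewrite ffunE.
Qed.

Definition wp n (a : tensor V R n) : V -> R := fun x => tpair (wick x n) a.

Lemma wpE n m (a : tensor V R n) (b : tensor V R m) x :
  wp a x * wp b x = \sum_i \sum_j a i * b j * (wick x n i * wick x m j).
Proof.
rewrite /wp /tpair mulr_suml; apply: eq_bigr => i _; rewrite mulr_sumr.
by apply: eq_bigr => j _; ring.
Qed.

Lemma integ_wpM n m (a : tensor V R n) (b : tensor V R m) :
  integ mu (fun x : V => wp a x * wp b x).
Proof.
rewrite (funext (wpE a b)).
apply: integ_sum => i _; apply: integ_sum => j _; apply: integZ.
exact: (integ_wickM i j).1.
Qed.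

Lemma E_wpM n m (a : tensor V R n) (b : tensor V R m) :
  E (fun x : V => wp a x * wp b x) =
  \sum_i \sum_j a i * b j * E (fun x : V => wick x n i * wick x m j).
Proof.
rewrite (funext (wpE a b)).
have ii i j : integ mu (fun x : V => a i * b j * (wick x n i * wick x m j)).
  by apply: integZ; exact: (integ_wickM i j).1.
rewrite Rintegral_sum => [|i _]; last by apply: integ_sum.
apply: eq_bigr => i _; rewrite Rintegral_sum //; apply: eq_bigr => j _.
by rewrite RintegralZl //; exact: (integ_wickM i j).1.
Qed.

Lemma E_wpM_neq n m (a : tensor V R n) (b : tensor V R m) : n != m ->
  E (fun x : V => wp a x * wp b x) = 0.
Proof.
move=> nm; rewrite E_wpM big1 // => i _; rewrite big1 // => j _.
by rewrite (integ_wickM i j).2 // mulr0.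
Qed.

(** Symmetry of [b] makes all [n!] permutations of [E_wickM] contribute equally. *)
Lemma E_wpM_eq n (a b : tensor V R n) : tsym b ->
  E (fun x : V => wp a x * wp b x) = n`!%:R * tpair a b.
Proof.
move=> bs; rewrite E_wpM /tpair mulr_sumr; apply: eq_bigr => i _.
transitivity (a i * \sum_(s : 'S_n) \sum_j b (tuple_perm j s) * (tuple_perm j s == i)%:R).
  rewrite mulr_sumr; under [RHS]eq_bigr => s _ do rewrite mulr_sumr.
  rewrite exchange_big /=; apply: eq_bigr => j _; rewrite E_wickM mulr_sumr.
  by apply: eq_bigr => s _; rewrite -mulrA (bs s j).
rewrite mulrCA; congr (_ * _).
rewrite (eq_bigr (fun=> b i)); first by rewrite sumr_const card_Sn mulr_natl.
move=> s _; rewrite (sum_tuple_perm (fun j => b j * (j == i)%:R)).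
rewrite (bigD1 i) //= eqxx mulr1 big1 ?addr0 // => j /negPf ->.
by rewrite mulr0.
Qed.

Definition tnorm2 n (a : tensor V R n) : R := \sum_i a i ^+ 2.

Lemma integ_sum_wp (a : forall n, tensor V R n) M :
  integ mu (fun x : V => (\sum_(n < M) wp (a n) x) ^+ 2).
Proof.
have Ef : (fun x : V => (\sum_(n < M) wp (a n) x) ^+ 2) =
   (fun x : V => \sum_(n < M) \sum_(m < M) wp (a n) x * wp (a m) x).
  apply/funext => x; rewrite expr2 mulr_suml; apply: eq_bigr => n _.
  by rewrite mulr_sumr.
rewrite Ef; apply: integ_sum => n _; apply: integ_sum => m _; exact: integ_wpM.
Qed.

Lemma E_sum_wp (a : forall n, tensor V R n) M : (forall n, tsym (a n)) ->
  E (fun x : V => (\sum_(n < M) wp (a n) x) ^+ 2) = \sum_(n < M) n`!%:R * tnorm2 (a n).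
Proof.
move=> sa.
have Ef : (fun x : V => (\sum_(n < M) wp (a n) x) ^+ 2) =
   (fun x : V => \sum_(n < M) \sum_(m < M) wp (a n) x * wp (a m) x).
  apply/funext => x; rewrite expr2 mulr_suml; apply: eq_bigr => n _.
  by rewrite mulr_sumr.
rewrite Ef Rintegral_sum => [|n _]; last by apply: integ_sum => m _; exact: integ_wpM.
apply: eq_bigr => n _; rewrite Rintegral_sum => [|m _]; last exact: integ_wpM.
rewrite (bigD1 n) //= E_wpM_eq // big1 ?addr0 => [|m ne].
  by congr (_ * _); apply: eq_bigr => i _; rewrite expr2.
by rewrite E_wpM_neq // eq_sym.
Qed.

Definition reT n (k : tensor V C n) : tensor V R n := [ffun i => complex.Re (k i)].
Definition imT n (k : tensor V C n) : tensor V R n := [ffun i => complex.Im (k i)].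

Lemma Re_wick_pair n (k : tensor V C n) x : complex.Re (wick_pair k x) = wp (reT k) x.
Proof.
rewrite /wick_pair /wp /tpair Re_sum; apply: eq_bigr => i _.
by rewrite !ffunE complexReM /= mul0r subr0.
Qed.

Lemma Im_wick_pair n (k : tensor V C n) x : complex.Im (wick_pair k x) = wp (imT k) x.
Proof.
rewrite /wick_pair /wp /tpair Im_sum; apply: eq_bigr => i _.
by rewrite !ffunE complexImM /= mul0r addr0.
Qed.

Lemma sqr_tnorm n (k : tensor V C n) : tnorm k ^+ 2 = tnorm2 (reT k) + tnorm2 (imT k).
Proof.
rewrite /tnorm sqr_sqrtr; last by apply: sumr_ge0 => i _; rewrite sqr_ge0.
by rewrite -big_split; apply: eq_bigr => i _; rewrite sqr_normcE !ffunE.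
Qed.

Definition wsum (k : forall n, tensor V C n) M : V -> C :=
  fun x => \sum_(n < M) wick_pair (k n) x.

(** The chaos isometry for finite sums, from orthogonality of real and imaginary parts separately;
    it yields uniqueness of kernels and the finiteness of L^2 norms. *)
Lemma wsum_L2 (k : forall n, tensor V C n) M : (forall n, tsym (k n)) ->
  (\int[mu]_x (normc (wsum k M x) ^+ 2)%:E)%E = (\sum_(n < M) n`!%:R * tnorm (k n) ^+ 2)%:E.
Proof.
move=> sk.
have sr n : tsym (reT (k n)) by move=> s i; rewrite !ffunE sk.
have si n : tsym (imT (k n)) by move=> s i; rewrite !ffunE sk.
have Ef : (fun x : V => normc (wsum k M x) ^+ 2) = (fun x : V =>
    (\sum_(n < M) wp (reT (k n)) x) ^+ 2 + (\sum_(n < M) wp (imT (k n)) x) ^+ 2).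
  apply/funext => x; rewrite sqr_normcE /wsum Re_sum Im_sum; congr (_ ^+ 2 + _ ^+ 2).
    by apply: eq_bigr => n _; rewrite Re_wick_pair.
  by apply: eq_bigr => n _; rewrite Im_wick_pair.
have ir := integ_sum_wp (fun n => reT (k n)) M.
have ii := integ_sum_wp (fun n => imT (k n)) M.
rewrite (_ : (fun x : V => _) = (fun x : V => ((\sum_(n < M) wp (reT (k n)) x) ^+ 2 +
   (\sum_(n < M) wp (imT (k n)) x) ^+ 2)%:E)); last first.
  by apply/funext => x; rewrite (congr1 (fun f => f x) Ef).
rewrite (Rintegral_EFin (integD ir ii)) RintegralD //.
rewrite (@E_sum_wp (fun n => reT (k n)) M sr) (@E_sum_wp (fun n => imT (k n)) M si).
rewrite -big_split; congr EFin; apply: eq_bigr => n _.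
by rewrite /= -mulrDr sqr_tnorm.
Qed.

Lemma measurable_wick n (i : n.-tuple I) : measurable_fun setT (fun x : borel V => wick (x : V) n i).
Proof.
rewrite (funext (fun x : borel V => wick_hcE i (x : V))).
by apply: measurable_sum_fun => sg _; apply: mfunZ; apply: mfun_hcoef; exact: mfun_eip.
Qed.

Lemma cmfun_wick_pair n (k : tensor V C n) : cmfun (wick_pair k : borel V -> C).
Proof.
have m (a : tensor V R n) : measurable_fun setT (wp a : borel V -> R).
  apply: measurable_sum_fun => i _; apply: measurable_funM => //; exact: measurable_wick.
split; first by rewrite (funext (Re_wick_pair k)); exact: m.
by rewrite (funext (Im_wick_pair k)); exact: m.
Qed.

Lemma cmfun_wsum (k : forall n, tensor V C n) M : cmfun (wsum k M : borel V -> C).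
Proof. by apply: cmfun_sum => n; exact: cmfun_wick_pair. Qed.

End WickOrthogonality.

(** * Uniqueness of chaos kernels, test functions and approximation by Wick polynomials *)

Section ChaosDecomposition.
Variables (R : realType) (V : euclidean R).
Local Notation C := R[i].
Local Notation mu := (gauss V).
Local Notation kernels := (forall n, tensor V C n).
Implicit Types (f g phi psi : V -> C) (k l : kernels).

Definition L2sq f : \bar R := (\int[mu]_x (normc (f x) ^+ 2)%:E)%E.

Lemma measurable_sqr_normc d (T : measurableType d) (h : T -> C) : cmfun h ->
  measurable_fun setT (fun w => normc (h w) ^+ 2).
Proof.
move=> [r i]; rewrite (funext (fun w => sqr_normcE (h w))).
by apply: measurable_funD; exact: measurable_funX.
Qed.

(** Integrated or summed, it does the work of the triangle inequality for finiteness and limits, at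
    the price of a factor [2]. *)
Lemma sqr_normc_lin (a u v : C) :
  normc (a * u + v) ^+ 2 <= (2 * normc a ^+ 2) * normc u ^+ 2 + 2 * normc v ^+ 2.
Proof.
have h := le_normcD (a * u) v; rewrite normcM in h.
apply: (@le_trans _ _ ((normc a * normc u + normc v) ^+ 2)).
  by rewrite lerXn2r ?nnegrE ?addr_ge0 ?mulr_ge0 ?normc_ge0.
rewrite -subr_ge0 [X in _ <= X](_ : _ = (normc a * normc u - normc v) ^+ 2); last by ring.
exact: sqr_ge0.
Qed.

Lemma L2sq_ge0 f : (0 <= L2sq f)%E.
Proof. by apply: integral_ge0 => x _; rewrite lee_fin sqr_ge0. Qed.

Lemma L2sq_lin (a : C) f g : cmfun (f : borel V -> C) -> cmfun (g : borel V -> C) ->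
  (L2sq (fun x => (a * f x + g x)%R) <= (2 * normc a ^+ 2)%:E * L2sq f + 2%:E * L2sq g)%E.
Proof.
move=> mf mg; have nf := measurable_sqr_normc mf; have ng := measurable_sqr_normc mg.
have c0 : 0 <= 2 * normc a ^+ 2 by rewrite mulr_ge0 // sqr_ge0.
have mZ (h : borel V -> C) (c : R) : cmfun h ->
    measurable_fun setT (fun x => (c%:E * (normc (h x) ^+ 2)%:E)%E).
  move=> mh; rewrite (_ : (fun x => _) = EFin \o (fun x => c * normc (h x) ^+ 2)) //.
  by apply/measurable_EFinP/mfunZ/measurable_sqr_normc.
have p0 (h : V -> C) x : (0 <= (normc (h x) ^+ 2)%:E)%E by rewrite lee_fin sqr_ge0.
rewrite /L2sq -!ge0_integralZl //; try exact/measurable_EFinP.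
rewrite -ge0_integralD //; [|by move=> x _; rewrite mule_ge0 // lee_fin|exact: (mZ f)|
  by move=> x _; rewrite mule_ge0 // lee_fin|exact: (mZ g)].
have mh : measurable_fun setT (fun x : borel V => (normc (a * f x + g x) ^+ 2)%:E).
  apply/measurable_EFinP/measurable_sqr_normc.
  by apply: cmfunD => //; apply: cmfunM => //; exact: cmfun_cst.
have mk := emeasurable_funD (mZ f (2 * normc a ^+ 2) mf) (mZ g 2 mg).
have h0 (x : borel V) : setT x -> (0 <= (normc (a * f x + g x) ^+ 2)%:E)%E by move=> _; exact: (p0 (fun x => a * f x + g x)).
refine (ge0_le_integral _ measurableT h0 mh mk _) => x _.
by rewrite -!EFinM -EFinD lee_fin; exact: sqr_normc_lin.
Qed.

Definition klin (a : C) k l : kernels := fun n => [ffun i => a * k n i + l n i].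

Lemma tsym_klin a k l n : tsym (k n) -> tsym (l n) -> tsym (klin a k l n).
Proof. by move=> sk sl s i; rewrite !ffunE sk sl. Qed.

Lemma wick_pair_lin n a (t u : tensor V C n) x :
  wick_pair [ffun i => a * t i + u i] x = a * wick_pair t x + wick_pair u x.
Proof.
rewrite /wick_pair /tpair mulr_sumr -big_split; apply: eq_bigr => i _ /=.
by rewrite !ffunE; ring.
Qed.

Lemma wsum_klin a k l M x : wsum (klin a k l) M x = a * wsum k M x + wsum l M x.
Proof.
rewrite /wsum mulr_sumr -big_split; apply: eq_bigr => n _; exact: wick_pair_lin.
Qed.

Lemma cvge0_lt (u : nat -> \bar R) (e : R) : u @ \oo --> 0%E -> 0 < e ->
  \forall n \near \oo, (u n < e%:E)%E.
Proof.
move=> /fine_cvgP[fu cu] e0; have lu := cvgr_lt _ cu e e0.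
near=> n; have fn : u n \is a fin_num by near: n; exact: fu.
by rewrite -(fineK fn) lte_fin; near: n; exact: lu.
Unshelve. all: by end_near. Qed.

Lemma cvge0_le (u v : nat -> \bar R) : (forall n, (0 <= u n <= v n)%E) ->
  v @ \oo --> 0%E -> u @ \oo --> 0%E.
Proof.
move=> h hv; apply: (squeeze_cvge _ (cvg_cst 0%E) hv).
by near=> n.
Unshelve. all: by end_near. Qed.

Lemma cvge0_lin (a b : R) (u v : nat -> \bar R) : u @ \oo --> 0%E -> v @ \oo --> 0%E ->
  (fun n => (a%:E * u n + b%:E * v n)%E) @ \oo --> 0%E.
Proof.
move=> hu hv.
have -> : 0%E = (a%:E * 0 + b%:E * 0)%E :> \bar R by rewrite !mule0 adde0.
apply: cvgeD; first by rewrite !mule0.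
  exact: cvgeZl.
exact: cvgeZl.
Qed.

Lemma is_chaos_lin a f g k l : cmfun (f : borel V -> C) -> cmfun (g : borel V -> C) ->
  is_chaos f k -> is_chaos g l -> is_chaos (fun x => a * f x + g x) (klin a k l).
Proof.
move=> mf mg [sk ck] [sl cl]; split=> [n|]; first exact: tsym_klin.
apply: cvge0_le (cvge0_lin (2 * normc a ^+ 2) 2 ck cl) => M.
rewrite L2sq_ge0 /=.
have -> : (fun x : V => (normc (a * f x + g x - \sum_(n < M) wick_pair (klin a k l n) x) ^+ 2)%:E) =
   (fun x => (normc (a * (f x - wsum k M x) + (g x - wsum l M x)) ^+ 2)%:E).
  apply/funext => x; congr (normc _ ^+ 2)%:E.
  by rewrite -/(wsum _ _ _) wsum_klin; ring.
have cmB (h : V -> C) (m : kernels) : cmfun (h : borel V -> C) ->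
    cmfun ((fun x => h x - wsum m M x) : borel V -> C).
  move=> mh; have := cmfunD mh (cmfunM (cmfun_cst _ (-1)) (@cmfun_wsum _ V m M)).
  by congr cmfun; apply/funext => x; rewrite mulN1r.
exact: L2sq_lin (cmB _ _ mf) (cmB _ _ mg).
Qed.

(** By the isometry the L^2 norms of the partial sums dominate each [n! |k n|^2] once [M > n], and
    they tend to [0]. *)
Lemma is_chaos0 k : is_chaos (fun=> 0) k -> forall n, k n = [ffun=> 0].
Proof.
move=> [sk ck] n.
have E M : (\int[mu]_x (normc (0 - \sum_(n < M) wick_pair (k n) x) ^+ 2)%:E)%E =
    (\sum_(n < M) n`!%:R * tnorm (k n) ^+ 2)%:E.
  rewrite -(wsum_L2 _ sk); apply: eq_integral => x _.
  by rewrite sub0r normcN.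
have t0 m : 0 <= m`!%:R * tnorm (k m) ^+ 2 by rewrite mulr_ge0 // sqr_ge0.
have le : n`!%:R * tnorm (k n) ^+ 2 <= 0.
  rewrite -lee_fin; apply: (cvge_to_ge ck).
  near=> M; rewrite E lee_fin.
  have nM : (n < M)%N by near: M; exact: nbhs_infty_gt.
  by rewrite (bigD1 (Ordinal nM)) //= lerDl sumr_ge0.
have {le} : tnorm (k n) ^+ 2 = 0.
  have f0 : 0 < n`!%:R :> R by rewrite ltr0n fact_gt0.
  by apply/eqP; rewrite eq_le sqr_ge0 andbT -(pmulr_rle0 _ f0).
rewrite /tnorm sqr_sqrtr; last by apply: sumr_ge0 => i _; rewrite sqr_ge0.
move=> /psumr_eq0P h; apply/ffunP => i; rewrite ffunE; apply: eq0_normc.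
by apply/eqP; rewrite -sqrf_eq0; apply/eqP/h => // j _; rewrite sqr_ge0.
Unshelve. all: by end_near. Qed.

Lemma is_chaos_unique f k l : cmfun (f : borel V -> C) ->
  is_chaos f k -> is_chaos f l -> k = l.
Proof.
move=> mf hk hl; have := is_chaos_lin (-1) mf mf hk hl.
have -> : (fun x => -1 * f x + f x) = (fun=> 0).
  by apply/funext => x; rewrite mulN1r addNr.
move=> /is_chaos0 h; apply: functional_extensionality_dep => n.
apply/ffunP => i; have := congr1 (fun t : tensor V C n => t i) (h n).
by rewrite /klin !ffunE mulN1r addrC => /eqP; rewrite subr_eq0 => /eqP.
Qed.

Lemma chaosE f k : cmfun (f : borel V -> C) -> is_chaos f k -> chaos f = k.
Proof.
move=> mf hk; rewrite /chaos; case: xgetP => [l _ hl|/(_ k)//].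
exact: is_chaos_unique mf hl hk.
Qed.

Definition kweight q k n : R := n`!%:R * 2 ^+ (n * q) * tnorm (k n) ^+ 2.

Lemma kweight_ge0 q k n : 0 <= kweight q k n.
Proof. by apply: mulr_ge0; [rewrite mulr_ge0 // exprn_ge0|exact: sqr_ge0]. Qed.

Lemma chaos_norm2_le q k (B : R) : (forall M, \sum_(n < M) kweight q k n <= B) ->
  (chaos_norm2 q k <= B%:E)%E.
Proof.
move=> h; apply: lime_le.
  by apply: is_cvg_nneseries => n _ _; rewrite lee_fin; exact: kweight_ge0.
by near=> M; rewrite sumEFin lee_fin big_mkord; exact: h.
Unshelve. all: by end_near. Qed.

Lemma chaos_norm2_ge q k M : ((\sum_(n < M) kweight q k n)%:E <= chaos_norm2 q k)%E.
Proof.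
rewrite -(big_mkord xpredT (kweight q k)) -sumEFin.
by apply: nneseries_lim_ge => n _ _; rewrite lee_fin; exact: kweight_ge0.
Qed.

Lemma chaos_norm2_ge0 q k : (0 <= chaos_norm2 q k)%E.
Proof. by apply: nneseries_ge0 => n _ _; rewrite lee_fin; exact: kweight_ge0. Qed.

Lemma test_funP phi : test_fun phi ->
  [/\ cmfun (phi : borel V -> C), is_chaos phi (chaos phi) &
      forall q, (chaos_norm2 q (chaos phi) < +oo)%E].
Proof.
by move=> [[mf _] [k hk nk]]; have e := chaosE mf hk; rewrite e.
Qed.

Lemma sqr_hida_norm q phi : test_fun phi ->
  (hida_norm q phi ^+ 2)%:E = chaos_norm2 q (chaos phi).
Proof.
move=> /test_funP[_ _ /(_ q) h]; rewrite /hida_norm sqr_sqrtr.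
  by rewrite fineK // ge0_fin_numE // chaos_norm2_ge0.
by rewrite fine_ge0 // chaos_norm2_ge0.
Qed.

Lemma hida_norm_ge0 q phi : 0 <= hida_norm q phi.
Proof. exact: sqrtr_ge0. Qed.

Lemma kweight_le_hida_norm q phi n : test_fun phi ->
  kweight q (chaos phi) n <= hida_norm q phi ^+ 2.
Proof.
move=> t; rewrite -lee_fin sqr_hida_norm //; apply: le_trans (chaos_norm2_ge _ _ n.+1).
by rewrite lee_fin big_ord_recr /= lerDr sumr_ge0 // => i _; exact: kweight_ge0.
Qed.

Lemma hida_norm_le q phi (r : R) : 0 <= r ->
  (forall M, \sum_(n < M) kweight q (chaos phi) n <= r ^+ 2) -> hida_norm q phi <= r.
Proof.
move=> r0 /chaos_norm2_le h; rewrite /hida_norm -(ger0_norm r0) -sqrtr_sqr.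
apply: ler_wsqrtr; rewrite -lee_fin fineK // ge0_fin_numE ?chaos_norm2_ge0 //.
by apply: le_lt_trans h _; rewrite ltry.
Qed.

(** Square integrability need not be checked by hand: some partial sum is within distance [1] of
    [phi], and Wick polynomials are in L^2 by the isometry. *)
Lemma test_funI phi k : cmfun (phi : borel V -> C) -> is_chaos phi k ->
  (forall q, exists B, forall M, \sum_(n < M) kweight q k n <= B) ->
  test_fun phi /\ chaos phi = k.
Proof.
move=> mf hk hB; split; last exact: chaosE.
split; last first.
  exists k => // q; have [B h] := hB q.
  by apply: le_lt_trans (chaos_norm2_le h) _; rewrite ltry.
split=> //; rewrite -/(L2sq phi).
have [sk ck] := hk.
have [M hM] : exists M, (L2sq (fun x => (phi x - wsum k M x)%R) < 1)%E.
  have [M _ h] : \forall M \near \oo, (L2sq (fun x => (phi x - wsum k M x)%R) < 1)%E.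
    exact: (cvge0_lt ck ltr01).
  by exists M; exact: (h M (leqnn M)).
have E : phi = (fun x => 1 * (phi x - wsum k M x) + wsum k M x).
  by apply/funext => x; rewrite mul1r subrK.
rewrite E; apply: le_lt_trans (L2sq_lin _ _ _) _.
- have := cmfunD mf (cmfunM (cmfun_cst _ (-1)) (@cmfun_wsum _ V k M)).
  by congr cmfun; apply/funext => x; rewrite mulN1r.
- exact: cmfun_wsum.
rewrite /L2sq (wsum_L2 _ sk) -EFinM; apply: lte_add_pinfty; last by rewrite ltry.
apply: lte_mul_pinfty => //; first by rewrite lee_fin mulr_ge0 // sqr_ge0.
by apply: lt_trans hM _; rewrite ltry.
Qed.

Lemma sqr_tnormE n (t : tensor V C n) : tnorm t ^+ 2 = \sum_i normc (t i) ^+ 2.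
Proof. by rewrite sqr_sqrtr // sumr_ge0 // => i _; rewrite sqr_ge0. Qed.

Lemma kweight_klin q a k l n :
  kweight q (klin a k l) n <= (2 * normc a ^+ 2) * kweight q k n + 2 * kweight q l n.
Proof.
rewrite /kweight; set w := n`!%:R * _; have w0 : 0 <= w by rewrite mulr_ge0 // exprn_ge0.
rewrite [X in _ <= X](_ : _ = w * ((2 * normc a ^+ 2) * tnorm (k n) ^+ 2 + 2 * tnorm (l n) ^+ 2)); last by ring.
apply: ler_wpM2l => //; rewrite !sqr_tnormE !mulr_sumr -big_split.
by apply: ler_sum => i _; rewrite ffunE; exact: sqr_normc_lin.
Qed.

Lemma test_fun_bound phi q : test_fun phi ->
  exists B, forall M, \sum_(n < M) kweight q (chaos phi) n <= B.
Proof.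
move=> t; exists (hida_norm q phi ^+ 2) => M.
by rewrite -lee_fin sqr_hida_norm //; exact: chaos_norm2_ge.
Qed.

Lemma test_fun_lin a phi psi : test_fun phi -> test_fun psi ->
  test_fun (fun x => a * phi x + psi x) /\
  chaos (fun x => a * phi x + psi x) = klin a (chaos phi) (chaos psi).
Proof.
move=> tf tg; have [mf cf _] := test_funP tf; have [mg cg _] := test_funP tg.
apply: test_funI.
- by apply: cmfunD => //; apply: cmfunM => //; exact: cmfun_cst.
- exact: is_chaos_lin.
- move=> q; have [B hB] := test_fun_bound q tf; have [B' hB'] := test_fun_bound q tg.
  exists (2 * normc a ^+ 2 * B + 2 * B') => M.
  apply: (@le_trans _ _ (\sum_(n < M) 2 * normc a ^+ 2 * kweight q (chaos phi) n +
    \sum_(n < M) 2 * kweight q (chaos psi) n)).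
    rewrite -[leRHS]big_split; apply: ler_sum => n _.
    exact: (kweight_klin q a (chaos phi) (chaos psi) n).
  apply: lerD.
    rewrite -[leLHS]mulr_sumr; apply: ler_wpM2l; last exact: hB.
    by rewrite mulr_ge0 // sqr_ge0.
  by rewrite -[leLHS]mulr_sumr; apply: ler_wpM2l; [|exact: hB'].
Qed.

Definition ktrunc M k : kernels := fun n => if (n < M)%N then k n else [ffun=> 0].

Lemma wick_pair0 n x : wick_pair ([ffun=> 0] : tensor V C n) x = 0.
Proof. by rewrite /wick_pair /tpair big1 // => i _; rewrite !ffunE mulr0. Qed.

Lemma tnorm0 n : tnorm ([ffun=> 0] : tensor V C n) = 0.
Proof.
by rewrite /tnorm big1 ?sqrtr0 // => i _; rewrite ffunE normc0 expr0n.
Qed.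

Lemma sum_ktrunc (A : nmodType) (F : forall n, tensor V C n -> A) k M M' :
  (forall n, F n [ffun=> 0] = 0) ->
  \sum_(n < M') F n (ktrunc M k n) = \sum_(n < minn M M') F n (k n).
Proof.
move=> F0; rewrite (big_ord_widen_cond M' xpredT (fun n => F n (k n))) ?geq_minr //.
rewrite [RHS]big_mkcond /=; apply: eq_bigr => n _.
by rewrite /ktrunc leq_min ltn_ord andbT; case: ifP.
Qed.

Lemma wsum_ktrunc k M M' x : wsum (ktrunc M k) M' x = wsum k (minn M M') x.
Proof.
by apply: (@sum_ktrunc C (fun n t => wick_pair t x)) => n; exact: wick_pair0.
Qed.

Lemma test_fun_wsum k M : (forall n, tsym (k n)) ->
  test_fun (wsum k M) /\ chaos (wsum k M) = ktrunc M k.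
Proof.
move=> sk; apply: test_funI.
- exact: cmfun_wsum.
- split=> [n|].
    by rewrite /ktrunc; case: ifP => // _ s i; rewrite !ffunE.
  rewrite -(cvg_shiftn M) (_ : [sequence _]_n = fun=> 0%E); first exact: cvg_cst.
  apply/funext => M' /=; rewrite (_ : (fun x => _) = fun=> 0%E) ?integral0 //.
  apply/funext => x; rewrite -/(wsum (ktrunc M k) (M' + M) x) wsum_ktrunc.
  by rewrite (minn_idPl _) ?leq_addl // subrr normc0 expr0n.
- move=> q; exists (\sum_(n < M) kweight q k n) => M'.
  rewrite (@sum_ktrunc R (fun n t => n`!%:R * 2 ^+ (n * q) * tnorm t ^+ 2)); last first.
    by move=> n; rewrite tnorm0 expr0n mulr0.
  rewrite -!(big_mkord xpredT (kweight q k)).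
  rewrite (@big_cat_nat _ _ _ (minn M M') 0 M) ?geq_minl //= lerDl.
  by apply: sumr_ge0 => n _; exact: kweight_ge0.
Qed.

(** The kernels of the difference are those of [phi] from degree [M] on, up to sign, so its squared
    norm is a tail of a convergent series. *)
Lemma wsum_approx phi q (delta : R) : test_fun phi -> 0 < delta ->
  exists M0, forall M, (M0 <= M)%N ->
    hida_norm q (fun x => wsum (chaos phi) M x - phi x) < delta.
Proof.
move=> t d0; have [mf [sk ck] /(_ q) fin] := test_funP t.
have := nneseries_tail_cvg fin (fun n _ => _ : (0 <= (kweight q (chaos phi) n)%:E)%E).
move=> /(_ (fun n => kweight_ge0 q (chaos phi) n)) ct.
have d2 : 0 < (delta / 2) ^+ 2 by rewrite exprn_gt0 // divr_gt0.
have [M0 _ hM0] : \forall N \near \oo, (\sum_(N <= n <oo) (kweight q (chaos phi) n)%:E < ((delta / 2) ^+ 2)%:E)%E.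
  exact: (cvge0_lt ct d2).
exists M0 => M /hM0 /= tail.
have [tw cw] := test_fun_wsum M sk.
have [td cd] := test_fun_lin (-1) t tw.
have E : (fun x => -1 * phi x + wsum (chaos phi) M x) = (fun x => wsum (chaos phi) M x - phi x).
  by apply/funext => x; rewrite mulN1r addrC.
(* [hida_norm_le] gives only a weak inequality; halving [delta] restores the strict one. *)
rewrite -E; apply: (@le_lt_trans _ _ (delta / 2)); last first.
  by rewrite ltr_pdivrMr // ltr_pMr // ltr1n.
apply: hida_norm_le; first by rewrite divr_ge0 // ltW.
move=> M'; rewrite cd cw -lee_fin; apply: le_trans (ltW tail).
have Ew n : kweight q (klin (-1) (chaos phi) (ktrunc M (chaos phi))) n =
    if (M <= n)%N then kweight q (chaos phi) n else 0.
  rewrite /kweight !sqr_tnormE /klin /ktrunc; case: ltnP => _ /=.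
    by rewrite big1 ?mulr0 // => i _; rewrite ffunE mulN1r addNr normc0 expr0n.
  by congr (_ * _); apply: eq_bigr => i _; rewrite !ffunE addr0 mulN1r normcN.
have -> : \sum_(n < M') kweight q (klin (-1) (chaos phi) (ktrunc M (chaos phi))) n =
    \sum_(0 <= n < M') (if (M <= n)%N then kweight q (chaos phi) n else 0).
  by rewrite big_mkord; apply: eq_bigr => n _; exact: Ew.
apply: (@le_trans _ _ (\sum_(M <= n < M') (kweight q (chaos phi) n)%:E)%E); last first.
  by apply: nneseries_lim_ge => n _ _; rewrite lee_fin; exact: kweight_ge0.
rewrite sumEFin lee_fin -big_mkcond /=.
case: (leqP M M') => MM.
  rewrite (@big_cat_nat _ _ _ M) //= big1_seq ?add0r.
    by rewrite [X in X <= _]big_nat_cond [X in _ <= X]big_nat_cond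
      (eq_bigl (fun n => (M <= n < M')%N && true)) // => n; rewrite andbT; case: (M <= n)%N; rewrite ?andbT ?andbF.
  by move=> n /andP[Mn]; rewrite mem_index_iota /= => nM; move: Mn; rewrite leqNgt nM.
rewrite [X in _ <= X]big_geq; last exact: ltnW.
rewrite big1_seq // => n /andP[Mn]; rewrite mem_index_iota /= => nM.
by have := leq_ltn_trans Mn (ltn_trans nM MM); rewrite ltnn.
Qed.

End ChaosDecomposition.

(** * The exponentials as test functions *)

Section ExponentialTestFunctions.
Variables (R : realType) (V : euclidean R).
Local Notation C := R[i].
Local Notation mu := (gauss V).
Local Notation kernels := (forall n, tensor V C n).
Implicit Types (y : V).

Definition kpow y : kernels :=
  fun n => [ffun i => 'i%C ^+ n * (n`!%:R^-1)%:C * (tpow n y i)%:C].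

Definition kexp y : kernels :=
  fun n => [ffun i => (expR (- (eip y y / 2)))%:C * kpow y n i].

Definition iexp y : V -> C := fun x => cexp ('i%C * (eip x y)%:C).

Lemma tsym_kpow y n : tsym (kpow y n).
Proof.
move=> s i; rewrite [LHS]ffunE [RHS]ffunE; congr (_ * _%:C).
exact: tsym_tpow.
Qed.

Lemma tsym_kexp y n : tsym (kexp y n).
Proof.
move=> s i; rewrite [LHS]ffunE [RHS]ffunE; congr (_ * _).
exact: tsym_kpow.
Qed.

Lemma wick_pairZ n (z : C) (t : tensor V C n) x :
  wick_pair [ffun i => z * t i] x = z * wick_pair t x.
Proof.
rewrite /wick_pair /tpair mulr_sumr; apply: eq_bigr => i _.
by rewrite !ffunE mulrCA.
Qed.

Lemma wick_pair_kpow y n x : wick_pair (kpow y n) x = 'i%C ^+ n * (hc n y x)%:C.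
Proof.
rewrite /wick_pair /tpair.
transitivity ('i%C ^+ n * (n`!%:R^-1)%:C * (tpair (wick x n) (tpow n y))%:C).
  rewrite /tpair rmorph_sum mulr_sumr; apply: eq_bigr => i _.
  by rewrite !ffunE rmorphM /= mulrCA.
by rewrite tpair_wick rmorphM /= -mulrA mulrA -mulrA -rmorphM /= -rmorphM mulKf // fact_neq0.
Qed.

Lemma wick_pair_kexp y n x :
  wick_pair (kexp y n) x = (expR (- (eip y y / 2)))%:C * ('i%C ^+ n * (hc n y x)%:C).
Proof. by rewrite wick_pairZ wick_pair_kpow. Qed.

Lemma cmfun_iexp y : cmfun (iexp y : borel V -> C).
Proof.
apply: cmfun_cexp; apply: cmfunM; first exact: cmfun_cst.
by apply: cmfun_real; exact: mfun_eip.
Qed.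

(** The generating function at [s = i] is [exp(i <x,y> + |y|^2 / 2)]; the scalar in [kexp] removes
    the real factor. *)
Lemma ccvg_wsum_kexp y x : ccvg (fun M => wsum (kexp y) M x) (iexp y x).
Proof.
have h := ccvgMl (expR (- (eip y y / 2)))%:C (ccvg_hcoef 'i%C (eip x y) (eip y y)).
have -> : iexp y x = (expR (- (eip y y / 2)))%:C *
    cexp ('i%C * (eip x y)%:C - 'i%C ^+ 2 * (eip y y / 2)%:C).
  rewrite -cexp_real -cexpD complex.sqr_i mulN1r opprK rmorphN /=.
  by rewrite addrCA addNr addr0.
apply: ccvg_eq h => M; rewrite /csum /wsum mulr_sumr.
by apply: eq_bigr => n _; rewrite wick_pair_kexp.
Qed.

(** The scalar in [kexp] also cancels the factor [exp(|y|^2 / 2)] of [sum_hcoef_le], leaving a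
    majorant uniform in [M]. *)
Lemma normc_wsum_kexp_le y M x : normc (wsum (kexp y) M x) <= expR (1 * `|eip x y|).
Proof.
rewrite /wsum; under eq_bigr do rewrite wick_pair_kexp.
rewrite -mulr_sumr normcM normc_real ger0_norm ?expR_ge0 //.
rewrite mulrC; apply: (@le_trans _ _
  (expR (1 * `|eip x y|) * expR (eip y y / 2) * expR (- (eip y y / 2)))).
  apply: ler_wpM2r; first exact: expR_ge0.
  apply: le_trans (normc_sum _ _ _) _.
  have := @sum_hcoef_le _ 'i%C (eip x y) _ M (eip_ge0 y).
  by rewrite normc_i expr1n !mul1r.
by rewrite -mulrA -expRD subrr expR0 mulr1.
Qed.

Lemma is_chaos_iexp y : is_chaos (iexp y) (kexp y).
Proof.
split=> [n|]; first exact: tsym_kexp.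
pose F M (x : borel V) := normc (iexp y x - wsum (kexp y) M x) ^+ 2.
have mF M : measurable_fun setT (F M).
  apply: measurable_sqr_normc.
  have := cmfunD (cmfun_iexp y) (cmfunM (cmfun_cst _ (-1)) (@cmfun_wsum _ V (kexp y) M)).
  by congr cmfun; apply/funext => x; rewrite mulN1r.
(* The exponential and its partial sums are at most [expR |<x,y>|] in modulus, so their difference
   is at most twice that, and [4] is the square of [2]. The factor with [0] fits the pair form of
   [integ_exp_abs]. *)
pose g (x : borel V) := 4 * (expR (2 * `|eip (x : V) y|) * expR (0 * `|eip (x : V) 0|)).
have ig : integ mu g.
  apply: integZ; apply: (@integ_exp_abs _ _ _ mu _ _ (eip y y) 0 0) => //; try exact: mfun_eip.
  move=> s t; have := gauss_mgf (s *: y).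
  rewrite eipZl eipZr => h; rewrite [RHS](_ : _ = (expR (s * (s * eip y y) / 2))%:E).
    by rewrite -h; apply: eq_integral => x _; rewrite eip0r mulr0 addr0 eipZr.
  by congr (expR _)%:E; ring.
have Fg M x : `|F M x| <= g x.
  rewrite ger0_norm ?sqr_ge0 // /F /g mul0r expR0 mulr1.
  have -> : 4 * expR (2 * `|eip (x : V) y|) = (2 * expR (1 * `|eip (x : V) y|)) ^+ 2 :> R.
    by rewrite exprMn -expRM_natl mul1r; congr (_ * _); rewrite -natrX.
  rewrite lerXn2r ?nnegrE ?normc_ge0 ?mulr_ge0 ?expR_ge0 //.
  apply: (le_trans (le_normcD _ _)); rewrite normcN mulr_natl mulr2n lerD //.
    rewrite /iexp cexp_i /= cos2Dsin2 sqrtr1 mul1r.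
    by rewrite -[leLHS]expR0 ler_expR.
  exact: normc_wsum_kexp_le.
have F0 (x : borel V) : (fun M => F M x) @ \oo --> (0 : R).
  have h := ccvg_wsum_kexp y x.
  have e : (fun M => F M x) = (fun M => normc (wsum (kexp y) M x - iexp y x) *
      normc (wsum (kexp y) M x - iexp y x)).
    by apply/funext => M; rewrite /F normc_distC expr2.
  by rewrite e -(mulr0 (0 : R)); exact: cvgM.
have m1 M : measurable_fun setT (fun x : borel V => (F M x)%:E) by exact/measurable_EFinP.
have m0 : measurable_fun setT (fun x : borel V => 0%E : \bar R) by exact: measurable_cst.
have c1 : {ae mu, forall x, setT x -> (fun M => (F M x)%:E) @ \oo --> (0%E : \bar R)}.
  by apply: aeW => x _; apply: cvg_EFin; [exact: nearW|exact: F0].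
have b1 : {ae mu, forall x M, setT x -> (`|(F M x)%:E| <= (EFin \o g) x)%E}.
  by apply: aeW => x M _; rewrite /= lee_fin.
have [_ _] := dominated_convergence measurableT m1 m0 c1 ig b1.
by rewrite integral0.
Qed.

Lemma kweight_kexp q y n :
  kweight q (kexp y) n = expR (- eip y y) * ((2 ^+ q * eip y y) ^+ n / n`!%:R).
Proof.
have E : tnorm (kexp y n) ^+ 2 = expR (- eip y y) * (n`!%:R^-1) ^+ 2 * eip y y ^+ n.
  rewrite sqr_tnormE -tpair_tpow /tpair mulr_sumr; apply: eq_bigr => i _.
  rewrite !ffunE !normcM !normc_real normcX normc_i expr1n mul1r !exprMn.
  rewrite !real_normK ?num_real // -expRM_natl mulrA -expr2; congr (expR _ * _ * _).
  by field.
rewrite /kweight E exprMn -exprM [(q * n)%N]mulnC.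
have := fact_neq0 R n; move: (n`!%:R) (2 ^+ _) (expR _) (_ ^+ n) => a b c d a0.
by field.
Qed.

Lemma test_fun_iexp y : test_fun (iexp y) /\ chaos (iexp y) = kexp y.
Proof.
apply: test_funI; [exact: cmfun_iexp|exact: is_chaos_iexp|] => q.
exists (expR (- eip y y) * expR (2 ^+ q * eip y y)) => M.
under eq_bigr => n _ do rewrite kweight_kexp.
rewrite -mulr_sumr; apply: ler_wpM2l; first exact: expR_ge0.
by apply: sum_exp_coeff_le; rewrite mulr_ge0 ?exprn_ge0 ?eip_ge0.
Qed.

End ExponentialTestFunctions.

(** * Hida distributions given by kernels *)

Section HidaSums.
Variables (R : realType) (V : euclidean R).
Local Notation C := R[i].
Local Notation I := 'I_(edim V).
Local Notation D := (#|I|%:R : R).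
Local Notation kernels := (forall n, tensor V C n).
Implicit Types (phi psi : V -> C) (G : kernels).

Definition hterm G phi n : C := n`!%:R * tpair (G n) (chaos phi n).

(** Entrywise growth [B * r ^+ n / sqrt(n!)], squared so that no root of a factorial appears. *)
Definition gbound G (B r : R) :=
  forall n i, n`!%:R * normc (G n i) ^+ 2 <= (B * r ^+ n) ^+ 2.

Lemma normc_le_tnorm n (t : tensor V C n) i : normc (t i) ^+ 2 <= tnorm t ^+ 2.
Proof.
by rewrite sqr_tnormE (bigD1 i) //= lerDl sumr_ge0 // => j _; exact: sqr_ge0.
Qed.

Lemma card_tensor n : #|{: n.-tuple I}|%:R = D ^+ n.
Proof. by rewrite card_tuple natrX. Qed.

(** The factor [n!] is shared evenly between [G] and [phi]. The norm of index [p * 2] supplies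
    [(2 ^+ p) ^+ n], which beats the [D ^+ n] entries and the growth [r ^+ n] and still leaves
    [2^-1 ^+ n]. *)
Lemma normc_hterm_le G phi (B r : R) p n : test_fun phi -> gbound G B r ->
  0 <= B -> 0 <= r -> 2 * (D * r) <= 2 ^+ p ->
  normc (hterm G phi n) <= B * hida_norm (p * 2) phi * 2^-1 ^+ n.
Proof.
move=> t hG B0 r0 hp; set h := hida_norm _ _.
have h0 : 0 <= h by exact: hida_norm_ge0.
have P0 : 0 < (2 ^+ p : R) by rewrite exprn_gt0.
have ti i : n`!%:R * (normc (G n i) * normc (chaos phi n i)) * (2 ^+ p) ^+ n <= B * r ^+ n * h.
  rewrite -(@ler_pXn2r _ 2) ?nnegrE //; last 2 first.
  - by rewrite !mulr_ge0 ?normc_ge0 ?exprn_ge0.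
  - by rewrite !mulr_ge0 ?exprn_ge0.
  rewrite [leLHS](_ : _ = (n`!%:R * normc (G n i) ^+ 2) *
    (n`!%:R * ((2 ^+ p) ^+ n) ^+ 2 * normc (chaos phi n i) ^+ 2)); last by ring.
  rewrite [leRHS]exprMn; apply: ler_pM.
  - by rewrite mulr_ge0 // sqr_ge0.
  - by apply: mulr_ge0; [apply: mulr_ge0 => //; exact: sqr_ge0|exact: sqr_ge0].
  - exact: hG.
  apply: le_trans (kweight_le_hida_norm (p * 2) n t); rewrite /kweight.
  rewrite (_ : 2 ^+ (n * (p * 2)) = ((2 ^+ p) ^+ n) ^+ 2 :> R); last first.
    by rewrite -!exprM; congr (_ ^+ _); lia.
  by apply: ler_wpM2l; [rewrite mulr_ge0 // sqr_ge0|exact: normc_le_tnorm].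
have ti' i : n`!%:R * (normc (G n i) * normc (chaos phi n i)) <= B * h * (r / 2 ^+ p) ^+ n.
  rewrite expr_div_n [leRHS]mulrA ler_pdivlMr ?exprn_gt0 //.
  by apply: le_trans (ti i) _; rewrite mulrAC.
rewrite /hterm normcM normc_nat /tpair.
apply: (@le_trans _ _ (n`!%:R * \sum_i normc (G n i) * normc (chaos phi n i))).
  apply: ler_wpM2l => //; apply: (le_trans (normc_sum _ _ _)).
  by apply: ler_sum => i _; rewrite normcM.
rewrite mulr_sumr; apply: (@le_trans _ _ (\sum_(i : n.-tuple I) B * h * (r / 2 ^+ p) ^+ n)).
  by apply: ler_sum => i _; exact: ti'.
rewrite sumr_const -[leLHS]mulr_natl card_tensor mulrCA -exprMn; apply: ler_wpM2l; first by rewrite mulr_ge0.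
rewrite lerXn2r ?nnegrE ?mulr_ge0 ?invr_ge0 ?exprn_ge0 //.
by rewrite mulrA ler_pdivrMr // ler_pdivlMl.
Qed.

Lemma sum_normc_hterm_le G phi (B r : R) p M : test_fun phi -> gbound G B r ->
  0 <= B -> 0 <= r -> 2 * (D * r) <= 2 ^+ p ->
  \sum_(n < M) normc (hterm G phi n) <= 2 * B * hida_norm (p * 2) phi.
Proof.
move=> t hG B0 r0 hp.
apply: (@le_trans _ _ (\sum_(n < M) B * hida_norm (p * 2) phi * 2^-1 ^+ n)).
  by apply: ler_sum => n _; exact: normc_hterm_le hG B0 r0 hp.
rewrite -mulr_sumr -[leRHS]mulrA mulrC ler_wpM2r ?geometric_half_le //.
by rewrite mulr_ge0 // hida_norm_ge0.
Qed.

Lemma hterm_lin G a phi psi n : test_fun phi -> test_fun psi ->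
  hterm G (fun x => a * phi x + psi x) n = a * hterm G phi n + hterm G psi n.
Proof.
move=> tf tg; rewrite /hterm (test_fun_lin a tf tg).2 mulrCA -mulrDr; congr (_ * _).
rewrite /tpair mulr_sumr -big_split; apply: eq_bigr => i _ /=.
by rewrite ffunE; ring.
Qed.

Definition hsum G phi : C :=
  limn (series (fun n => complex.Re (hterm G phi n))) +i*
  limn (series (fun n => complex.Im (hterm G phi n))).

Lemma exists_pow2_ge (x : R) : exists p, x <= 2 ^+ p.
Proof.
exists (Num.bound `|x|); apply: le_trans (ler_norm x) (ltW _).
apply: lt_le_trans (archi_boundP (normr_ge0 x)) _.
by rewrite -natrX ler_nat ltnW // ltn_expl.
Qed.

Lemma ccvg_csum_hsum G phi l : ccvg (csum (hterm G phi)) l -> hsum G phi = l.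
Proof.
by case: l => a b /ccvg_sumP[/= hr hi]; rewrite /hsum (cvg_lim _ hr) // (cvg_lim _ hi).
Qed.

Lemma ccvg_hterm G phi (B r : R) : test_fun phi -> gbound G B r -> 0 <= B -> 0 <= r ->
  ccvg (csum (hterm G phi)) (hsum G phi).
Proof.
move=> t hG B0 r0; have [p hp] := exists_pow2_ge (2 * (D * r)).
have [l hl] := bounded_ccvg_csum (fun M => sum_normc_hterm_le M t hG B0 r0 hp).
by rewrite (ccvg_csum_hsum hl).
Qed.

Lemma normc_hsum_le G phi (B r : R) p : test_fun phi -> gbound G B r ->
  0 <= B -> 0 <= r -> 2 * (D * r) <= 2 ^+ p ->
  normc (hsum G phi) <= 2 * B * hida_norm (p * 2) phi.
Proof.
move=> t hG B0 r0 hp.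
exact: normc_csum_le (fun M => sum_normc_hterm_le M t hG B0 r0 hp) (ccvg_hterm t hG B0 r0).
Qed.

Lemma hsum_lin G (B r : R) a phi psi : gbound G B r -> 0 <= B -> 0 <= r ->
  test_fun phi -> test_fun psi ->
  hsum G (fun x => a * phi x + psi x) = a * hsum G phi + hsum G psi.
Proof.
move=> hG B0 r0 tf tg; apply: ccvg_csum_hsum.
have := ccvgD (ccvgMl a (ccvg_hterm tf hG B0 r0)) (ccvg_hterm tg hG B0 r0).
apply: ccvg_eq => M; rewrite /csum mulr_sumr -big_split; apply: eq_bigr => n _.
by rewrite /= hterm_lin.
Qed.

Lemma hsum_hida G (B r : R) : gbound G B r -> 0 <= B -> 0 <= r ->
  exists Phi : hida_distribution V, forall phi, Phi phi = hsum G phi.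
Proof.
move=> hG B0 r0.
have lin a phi psi : test_fun phi -> test_fun psi ->
    hsum G (fun x => a * phi x + psi x) = a * hsum G phi + hsum G psi.
  exact: hsum_lin.
have [p hp] := exists_pow2_ge (2 * (D * r)).
have cont phi : test_fun phi -> forall e : R, 0 < e ->
   exists q, exists2 delta : R, 0 < delta & forall psi, test_fun psi ->
      hida_norm q (fun x => psi x - phi x) < delta ->
      normc (hsum G psi - hsum G phi) < e.
  move=> tf e e0; exists (p * 2)%N; exists (e / (2 * B + 1)).
    by rewrite divr_gt0 // ltr_wpDl // mulr_ge0.
  move=> psi tg.
  have E : (fun x => psi x - phi x) = (fun x => -1 * phi x + psi x).
    by apply/funext => x; rewrite mulN1r addrC.
  rewrite E => lt.
  have -> : hsum G psi - hsum G phi = hsum G (fun x => -1 * phi x + psi x).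
    by rewrite lin // mulN1r addrC.
  apply: (le_lt_trans (normc_hsum_le (test_fun_lin (-1) tf tg).1 hG B0 r0 hp)).
  rewrite ltr_pdivlMr in lt; last by rewrite ltr_wpDl // mulr_ge0.
  apply: le_lt_trans lt; rewrite mulrC; apply: ler_wpM2l; first exact: hida_norm_ge0.
  by rewrite lerDl.
by exists (HidaDistribution lin cont).
Qed.

(** The weight [n!] in [hterm] cancels the [1 / n!] in the kernels of the exponential. *)
Lemma hsum_iexp G (B r : R) y l : gbound G B r -> 0 <= B -> 0 <= r ->
  ccvg (csum (fun n => 'i%C ^+ n * tpair (G n) [ffun i => (tpow n y i)%:C])) l ->
  hsum G (iexp y) = (expR (- (eip y y / 2)))%:C * l.
Proof.
move=> hG B0 r0 hl; apply: ccvg_csum_hsum.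
apply: ccvg_eq (ccvgMl (expR (- (eip y y / 2)))%:C hl) => M.
rewrite /csum mulr_sumr; apply: eq_bigr => n _; rewrite /hterm (test_fun_iexp y).2.
rewrite /tpair !mulr_sumr; apply: eq_bigr => i _; rewrite !ffunE.
have fn0 : n`!%:R != 0 :> C by rewrite pnatr_eq0 -lt0n fact_gt0.
rewrite fmorphV rmorph_nat; move: fn0; move: (n`!%:R : C) => f f0.
by field.
Qed.

End HidaSums.

(** * Injectivity of the T-transform *)

Section TtransformUniqueness.
Variables (R : realType) (V : euclidean R).
Local Notation C := R[i].
Local Notation I := 'I_(edim V).
Local Notation kernels := (forall n, tensor V C n).
Implicit Types (phi psi : V -> C) (Psi : hida_distribution V) (k : kernels) (y : V).

Lemma test_fun0 : test_fun ((fun=> 0) : V -> C).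
Proof.
have t := (test_fun_iexp (0 : V)).1; have [h _] := test_fun_lin (-1) t t.
rewrite (_ : (fun=> 0) = (fun x : V => -1 * iexp 0 x + iexp 0 x)) //.
by apply/funext => x; rewrite mulN1r addNr.
Qed.

Lemma hida0 Psi : Psi (fun=> 0) = 0.
Proof.
have h := hida_linear Psi (-1) test_fun0 test_fun0.
have e : (fun x : V => -1 * 0 + 0 : C) = fun=> 0 by apply/funext => x; rewrite mulr0 addr0.
by rewrite e in h; rewrite [LHS]h mulN1r addNr.
Qed.

Lemma hidaZ Psi (a : C) phi : test_fun phi -> Psi (fun x => a * phi x) = a * Psi phi.
Proof.
move=> t; have := hida_linear Psi a t test_fun0; rewrite hida0 addr0 => <-.
by congr (hida_pair Psi _); apply/funext => x; rewrite addr0.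
Qed.

Lemma wsumS k M : wsum k M.+1 = (fun x => 1 * wsum k M x + wick_pair (k M) x).
Proof. by apply/funext => x; rewrite /wsum big_ord_recr mul1r. Qed.

Lemma test_fun_wick_pair k n : (forall n, tsym (k n)) -> test_fun (wick_pair (k n)).
Proof.
move=> sk; have [t _] := test_fun_wsum n sk; have [t' _] := test_fun_wsum n.+1 sk.
have [h _] := test_fun_lin (-1) t t'; move: h; congr test_fun; apply/funext => x.
by rewrite wsumS; ring.
Qed.

Lemma hida_wsum Psi k M : (forall n, tsym (k n)) ->
  Psi (wsum k M) = \sum_(n < M) Psi (wick_pair (k n)).
Proof.
move=> sk; elim: M => [|M IH].
  rewrite big_ord0 -(hida0 Psi); congr (hida_pair Psi _).
  by apply/funext => x; rewrite /wsum big_ord0.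
rewrite wsumS hida_linear; [|exact: (test_fun_wsum M sk).1|exact: test_fun_wick_pair].
by rewrite IH mul1r big_ord_recr.
Qed.

Lemma hida_cvg Psi phi : test_fun phi ->
  ccvg (fun M => Psi (wsum (chaos phi) M)) (Psi phi).
Proof.
move=> t; have [_ [sk _] _] := test_funP t.
apply/cvgrPdist_lt => e e0.
have [q [delta d0 h]] := hida_continuous Psi t e0.
have [M0 hM0] := wsum_approx q t d0.
near=> M; rewrite sub0r normrN ger0_norm ?normc_ge0 //.
apply: h; first exact: (test_fun_wsum M sk).1.
by apply: hM0; near: M; exact: nbhs_infty_ge.
Unshelve. all: by end_near. Qed.

Lemma wick_pair_kexp_scale (t : R) y n : wick_pair (kexp (t *: y) n) =
  (fun x => (expR (- (t ^+ 2 * (eip y y / 2))))%:C * t%:C ^+ n * wick_pair (kpow y n) x).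
Proof.
apply/funext => x; rewrite wick_pair_kexp wick_pair_kpow /hc !eipZr eipZl.
rewrite [t * (t * eip y y)](_ : _ = t ^+ 2 * eip y y); last by ring.
rewrite hcoef_scale -(mulrA (t ^+ 2)) rmorphM rmorphXn /= -!mulrA; congr (_ * _).
by rewrite mulrCA.
Qed.

(** At [t *: y] the T-transform is a positive factor times the power series in [t] whose
    coefficients are the values on the Wick powers of [y]; after dividing by the factor,
    coefficients are compared. *)
Lemma hida_kpow Psi Psi' y n : (forall y, Ttransform Psi y = Ttransform Psi' y) ->
  Psi (wick_pair (kpow y n)) = Psi' (wick_pair (kpow y n)).
Proof.
move=> T; apply/eqP; rewrite -subr_eq0; apply/eqP.
apply: (@power_series_eq0 R (fun n => Psi (wick_pair (kpow y n)) - Psi' (wick_pair (kpow y n)))).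
move=> t t0; pose c : C := (expR (- (t ^+ 2 * (eip y y / 2))))%:C.
have c0 : c != 0 by rewrite -(rmorph0 (real_complex R)) (inj_eq (@complexI R)) gt_eqF // expR_gt0.
have [te ce] := test_fun_iexp (t *: y).
have := ccvgMl c^-1 (ccvgB (hida_cvg Psi te) (hida_cvg Psi' te)).
rewrite (T (t *: y) : Psi (iexp _) = Psi' (iexp _)) subrr mulr0; apply: ccvg_eq => M.
rewrite ce !hida_wsum; try exact: tsym_kexp.
rewrite -sumrB mulr_sumr; apply: eq_bigr => m _.
rewrite wick_pair_kexp_scale !hidaZ; try exact: test_fun_wick_pair (@tsym_kpow _ _ y).
by rewrite -mulrBr -mulrA mulKf.
Qed.

Lemma hida_sum_eq Psi Psi' (J : Type) (s : seq J) (z : J -> C) (F : J -> V -> C) :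
  (forall j, test_fun (F j)) -> (forall j, Psi (F j) = Psi' (F j)) ->
  test_fun (fun x => \sum_(j <- s) z j * F j x) /\
  Psi (fun x => \sum_(j <- s) z j * F j x) = Psi' (fun x => \sum_(j <- s) z j * F j x).
Proof.
move=> tF eF; elim: s => [|j s [tI eI]].
  have -> : (fun x => \sum_(j <- [::]) z j * F j x) = (fun=> 0).
    by apply/funext => x; rewrite big_nil.
  by rewrite !hida0; split=> //; exact: test_fun0.
have -> : (fun x => \sum_(j <- j :: s) z j * F j x) =
    (fun x => z j * F j x + \sum_(j <- s) z j * F j x).
  by apply/funext => x; rewrite big_cons.
split; first exact: (test_fun_lin (z j) (tF j) tI).1.
by rewrite !hida_linear // eF eI.
Qed.

(** Polarization in the form needed for linearity of a distribution; dividing by ['i%C ^+ n] undoes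
    the phase built into [kpow]. *)
Lemma wick_pair_kpowE n (t : tensor V C n) x : wick_pair t x =
  \sum_(p : n.-tuple I * {ffun 'I_n -> bool})
    (t p.1 * ((2 ^+ n)^-1 * psign R p.2)%:C / 'i%C ^+ n) *
    wick_pair (kpow (polar p.1 p.2) n) x.
Proof.
rewrite {1}/wick_pair /tpair.
rewrite -(pair_bigA _ (fun i sg => (t i * ((2 ^+ n)^-1 * psign R sg)%:C / 'i%C ^+ n) *
    wick_pair (kpow (polar i sg) n) x)) /=.
apply: eq_bigr => i _; rewrite ffunE wick_hcE rmorph_sum mulr_suml.
apply: eq_bigr => sg _; rewrite wick_pair_kpow rmorphM /=.
have i0 : ('i%C : C) ^+ n != 0.
  by rewrite expf_neq0 // eq_complex /= oner_eq0 andbF.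
move: ('i%C ^+ n) i0 (_%:C) (_%:C) => w w0 a b.
by field.
Qed.

Lemma Ttransform_inj Psi Psi' : (forall y, Ttransform Psi y = Ttransform Psi' y) ->
  forall phi, test_fun phi -> Psi phi = Psi' phi.
Proof.
move=> T phi t; have [_ [sk _] _] := test_funP t.
apply: ccvg_unique (hida_cvg Psi t) _; apply: ccvg_eq (hida_cvg Psi' t) => M.
rewrite !hida_wsum //; apply: eq_bigr => n _.
rewrite (funext (wick_pair_kpowE (chaos phi n))); apply/esym.
pose F (p : n.-tuple I * {ffun 'I_n -> bool}) := wick_pair (kpow (polar p.1 p.2) n).
have tF p : test_fun (F p) by exact: test_fun_wick_pair (@tsym_kpow _ _ _).
have eF p : Psi (F p) = Psi' (F p) by exact: hida_kpow.
exact: (hida_sum_eq (index_enum _) (fun p : n.-tuple I * {ffun 'I_n -> bool} =>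
  chaos phi n p.1 * ((2 ^+ n)^-1 * psign R p.2)%:C / 'i%C ^+ n) tF eF).2.
Qed.

End TtransformUniqueness.

(** * Kernels built from powers of a quadratic form *)

Section QuadraticKernels.
Variables (R : realType) (V : euclidean R).
Local Notation C := R[i].
Local Notation I := 'I_(edim V).
Local Notation kernels := (forall n, tensor V C n).
Implicit Types (c : C) (Q : I -> I -> C).

Definition gcoef n : C := evencoef (cexp_coeff (- 2^-1)) n.

(* [i ^+ n * tpair (gker c Q n) (y^{(x)n})] sums to [c exp (Q(y,y) / 2)]: the
   sign in [gcoef] compensates [i ^+ (2 m)]. *)
Definition gker c Q : kernels := fun n => [ffun i : n.-tuple I => c * gcoef n * qseq Q i].

(** Only half of [size s] factors occur; with [K >= 1] the cruder exponent treats both parities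
    alike. *)
Lemma normc_qseq_le Q (K : R) s : 1 <= K -> (forall a b, normc (Q a b) <= K) ->
  normc (qseq Q s) <= K ^+ size s.
Proof.
move=> K1 hQ; have K0 : 0 <= K := le_trans ler01 K1.
have [m] := ubnP (size s); elim: m s => // m IH [|a [|b s]] sm.
- by rewrite [qseq _ _](_ : _ = 1%:R) // normc_nat expr0.
- by rewrite [qseq _ _](_ : _ = 0%:R) // normc_nat expr1.
rewrite [qseq _ _](_ : _ = Q a b * qseq Q s) // normcM.
apply: (@le_trans _ _ (K * K ^+ size s)).
  apply: ler_pM => //; try exact: normc_ge0.
  by apply: IH; rewrite -ltnS ltnW.
by rewrite -exprS ler_weXn2l.
Qed.

(** Telescoping: the factors of [Q] are replaced by those of [Q'] one at a time, each at cost
    [delta]. *)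
Lemma normc_qseq_sub Q Q' (K delta : R) s : 1 <= K -> 0 <= delta ->
  (forall a b, normc (Q a b) <= K) -> (forall a b, normc (Q' a b) <= K) ->
  (forall a b, normc (Q a b - Q' a b) <= delta) ->
  normc (qseq Q s - qseq Q' s) <= delta * ((size s)%:R * K ^+ size s).
Proof.
move=> K1 d0 hQ hQ' hd; have K0 : 0 <= K := le_trans ler01 K1.
have [m] := ubnP (size s); elim: m s => // m IH [|a [|b s]] sm.
- by rewrite subrr (normc_nat R 0) mul0r mulr0.
- by rewrite subrr (normc_nat R 0) mulr_ge0 // mulr_ge0 // exprn_ge0.
rewrite [qseq Q _](_ : _ = Q a b * qseq Q s) // [qseq Q' _](_ : _ = Q' a b * qseq Q' s) //.
have -> : Q a b * qseq Q s - Q' a b * qseq Q' s =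
    (Q a b - Q' a b) * qseq Q s + Q' a b * (qseq Q s - qseq Q' s) by ring.
apply: (le_trans (le_normcD _ _)); rewrite !normcM.
apply: (@le_trans _ _ (delta * K ^+ size s + K * (delta * ((size s)%:R * K ^+ size s)))).
  apply: lerD; apply: ler_pM; rewrite ?normc_ge0 //.
    exact: normc_qseq_le.
  by apply: IH; rewrite -ltnS ltnW.
rewrite mulrCA -mulrDr; apply: ler_wpM2l => //.
have P0 : 0 <= K ^+ size s by rewrite exprn_ge0.
rewrite (_ : (size s).+2%:R = 2 + (size s)%:R :> R); last by rewrite -natrD.
rewrite mulrDl; apply: lerD.
  rewrite -[leLHS]mul1r; apply: ler_pM => //; first by rewrite ler1n.
  by apply: ler_weXn2l => //; exact: leq_trans (leqnSn _) (leqnSn _).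
rewrite mulrCA; apply: ler_wpM2l => //.
by rewrite -exprS ler_weXn2l.
Qed.

(** In degree [2 m] the left side is the central binomial coefficient over [4^m], and that
    coefficient is one term in the expansion of [(1 + 1)^(2 m)]. *)
Lemma sqr_normc_gcoef_le n : n`!%:R * normc (gcoef n) ^+ 2 <= 1.
Proof.
rewrite /gcoef /evencoef; case: ifPn => on; first by rewrite normc0 expr0n mulr0.
have := odd_double_half n; rewrite (negPf on) add0n => e.
rewrite -[X in X`!]e; move: {e on}(n./2) => m {n}.
rewrite normc_cexp_coeff normcN -(rmorph_nat (real_complex R) 2) -fmorphV normc_real.
rewrite ger0_norm ?invr_ge0 // expr_div_n -exprM exprVn.
have fm0 : 0 < (m`!%:R : R) by rewrite ltr0n fact_gt0.
have -> : (m.*2)`!%:R = 'C(m.*2, m)%:R * m`!%:R * m`!%:R :> R.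
  have le : (m <= m.*2)%N by rewrite -addnn leq_addr.
  rewrite -(bin_fact le) -[in (m.*2 - m)%N]addnn addnK.
  by rewrite !natrM mulrA.
rewrite (_ : _ * _ = 'C(m.*2, m)%:R / 2 ^+ (m * 2)); last first.
  have p0 : 2 ^+ (m * 2) != 0 :> R by rewrite expf_neq0.
  have := lt0r_neq0 fm0; move: p0; move: (2 ^+ (m * 2)) (m`!%:R) => p f p0 f0.
  by field; rewrite p0 f0.
rewrite ler_pdivrMr ?exprn_gt0 // mul1r -natrX ler_nat muln2.
have := expnDn 1 1 m.*2; rewrite addn1 => ->.
under eq_bigr do rewrite !exp1n !muln1.
have lt : (m < m.*2.+1)%N by rewrite ltnS -addnn leq_addr.
by rewrite (bigD1 (Ordinal lt)) //= leq_addr.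
Qed.

Lemma gbound_gker c Q (K : R) : 1 <= K -> (forall a b, normc (Q a b) <= K) ->
  gbound (gker c Q) (normc c) K.
Proof.
move=> K1 hQ n i; have K0 : 0 <= K := le_trans ler01 K1.
rewrite ffunE !normcM !exprMn.
rewrite [leLHS](_ : _ = normc c ^+ 2 * ((n`!%:R * normc (gcoef n) ^+ 2) * normc (qseq Q i) ^+ 2)); last by ring.
apply: ler_wpM2l; first exact: sqr_ge0.
rewrite -[leRHS]mul1r; apply: ler_pM.
- by rewrite mulr_ge0 // sqr_ge0.
- exact: sqr_ge0.
- exact: sqr_normc_gcoef_le.
rewrite lerXn2r ?nnegrE ?normc_ge0 ?exprn_ge0 //.
by have := normc_qseq_le i K1 hQ; rewrite size_tuple.
Qed.

Definition ksub (G G' : kernels) : kernels := fun n => [ffun i => G n i - G' n i].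

(** Written as [(c - c') Q + c' (Q - Q')]. The factor [n] from telescoping is absorbed by
    [n <= 2 ^+ n], which doubles the rate but leaves the constant linear in the perturbation. *)
Lemma gbound_gker_sub c c' Q Q' (K delta : R) : 1 <= K -> 0 <= delta ->
  (forall a b, normc (Q a b) <= K) -> (forall a b, normc (Q' a b) <= K) ->
  (forall a b, normc (Q a b - Q' a b) <= delta) ->
  gbound (ksub (gker c Q) (gker c' Q')) (normc (c - c') + normc c' * delta) (2 * K).
Proof.
move=> K1 d0 hQ hQ' hd n i; have K0 : 0 <= K := le_trans ler01 K1.
rewrite ffunE [gker c Q n i]ffunE [gker c' Q' n i]ffunE.
have -> : c * gcoef n * qseq Q i - c' * gcoef n * qseq Q' i =
   gcoef n * ((c - c') * qseq Q i + c' * (qseq Q i - qseq Q' i)) by ring.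
rewrite normcM exprMn mulrA -[leRHS]mul1r; apply: ler_pM.
- by rewrite mulr_ge0 // sqr_ge0.
- exact: sqr_ge0.
- exact: sqr_normc_gcoef_le.
have B0 : 0 <= normc (c - c') + normc c' * delta by rewrite addr_ge0 ?mulr_ge0 ?normc_ge0.
rewrite lerXn2r ?nnegrE ?normc_ge0 ?mulr_ge0 ?exprn_ge0 ?mulr_ge0 //.
apply: (le_trans (le_normcD _ _)); rewrite !normcM mulrDl.
have n2 : n%:R <= 2 ^+ n :> R by rewrite -natrX ler_nat ltnW // ltn_expl.
have q1 := normc_qseq_le i K1 hQ; have q2 := normc_qseq_sub i K1 d0 hQ hQ' hd.
rewrite size_tuple in q1 q2; rewrite exprMn; apply: lerD.
  apply: ler_wpM2l; first exact: normc_ge0.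
  apply: (le_trans q1); rewrite -[leLHS]mul1r ler_wpM2r ?exprn_ge0 //.
  by rewrite exprn_ege1 // ler1n.
rewrite -mulrA; apply: ler_wpM2l; first exact: normc_ge0.
apply: (le_trans q2); apply: ler_wpM2l => //.
by rewrite ler_wpM2r ?exprn_ge0.
Qed.

Lemma hsum_ksub G G' phi (B B' r r' : R) : test_fun phi -> gbound G B r -> gbound G' B' r' ->
  0 <= B -> 0 <= B' -> 0 <= r -> 0 <= r' -> hsum (ksub G G') phi = hsum G phi - hsum G' phi.
Proof.
move=> t hG hG' B0 B'0 r0 r'0; apply: ccvg_csum_hsum.
apply: ccvg_eq (ccvgB (ccvg_hterm t hG B0 r0) (ccvg_hterm t hG' B'0 r'0)) => M.
rewrite /csum -sumrB; apply: eq_bigr => n _; rewrite /hterm -mulrBr; congr (_ * _).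
by rewrite /tpair -sumrB; apply: eq_bigr => i _; rewrite ffunE mulrBl.
Qed.

Lemma hsum_gker_iexp c Q (K : R) y : 1 <= K -> (forall a b, normc (Q a b) <= K) ->
  hsum (gker c Q) (iexp y) = (expR (- (eip y y / 2)))%:C *
    (c * cexp (2^-1 * \sum_a \sum_b Q a b * (eip y (ebasis a))%:C * (eip y (ebasis b))%:C)).
Proof.
move=> K1 hQ; apply: (hsum_iexp (gbound_gker c K1 hQ) (normc_ge0 _) (le_trans ler01 K1)).
set q := \sum_a _.
apply: ccvg_eq (ccvgMl c (ccvg_evencoef (ccvg_cexp (2^-1 * q)))) => M.
rewrite /csum mulr_sumr; apply: eq_bigr => n _.
have -> : tpair (gker c Q n) [ffun i => (tpow n y i)%:C] =
    c * gcoef n * evencoef (fun m => q ^+ m) n.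
  rewrite -(sum_qseq Q (fun a => (eip y (ebasis a))%:C)) /tpair mulr_sumr.
  by apply: eq_bigr => i _; rewrite ffunE [X in _ * X]ffunE tpow_val rmorph_prod mulrA.
rewrite -mulrA mulrCA; congr (_ * _).
rewrite /gcoef /evencoef; case: ifPn => on; first by rewrite mulr0 mulr0.
have := odd_double_half n; rewrite (negPf on) add0n => e.
rewrite -[X in _ ^+ X * _]e -mul2n exprM complex.sqr_i /cexp_coeff exprMn.
rewrite -[- 2^-1]mulN1r exprMn !mulrA -[(-1) ^+ _ * (-1) ^+ _]exprMn.
rewrite mulrNN mulr1 expr1n mul1r.
by rewrite mulrAC.
Qed.

End QuadraticKernels.

(** * The limit of the Gaussian functions *)

Section GaussianQuadratic.
Variables (R : realType) (V : euclidean R) (c : R).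
Local Notation C := R[i].
Local Notation W := (euclidean_prod V V).
Local Notation I := 'I_(edim W).
Hypothesis c0 : 0 <= c.
Implicit Types (e : R) (x y : W).

Definition swap x : W := (x.2, x.1).

Lemma eip_swap x y : eip (swap x) y = eip x (swap y).
Proof. by rewrite /= /prod_ip /= addrC. Qed.

Lemma eip_swap_diag x : eip (swap x) x = 2 * eip x.1 x.2.
Proof. by rewrite /= /prod_ip /= eipC mulr_natl mulr2n. Qed.

Definition swap_mx (a b : I) : R := eip (swap (ebasis a)) (ebasis b).

(* The identity part is shifted by [1] because the kernels of [iexp y] carry the
   factor [exp (- |y|^2 / 2)]. *)
Definition qmx e (a b : I) : C :=
  ((1 - e / (1 + e ^+ 2)) * (a == b)%:R)%:C - 'i%C * (swap_mx a b / (1 + e ^+ 2))%:C.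

(** [Phi_eps] on a product of two copies of any Euclidean space, with the form of [K_eps] written
    out. *)
Definition gexp e x : C :=
  c%:C * cexp ((2^-1 * (1 - e) * eip x x)%:C + 'i%C * (eip x.1 x.2)%:C).

Definition gnorm e : R := c * (Num.sqrt (1 + e ^+ 2))^-1 ^+ edim V.

Lemma sum_qmx e y :
  \sum_a \sum_b qmx e a b * (eip y (ebasis a))%:C * (eip y (ebasis b))%:C =
  ((1 - e / (1 + e ^+ 2)) * eip y y)%:C - 'i%C * (2 * eip y.1 y.2 / (1 + e ^+ 2))%:C.
Proof.
pose u (a : I) := eip y (ebasis a).
have diag : \sum_a \sum_b (a == b)%:R * u a * u b = eip y y.
  rewrite (eip_sum_basis y y); apply: eq_bigr => a _.
  rewrite (bigD1 a) //= eqxx mul1r big1 ?addr0 // => b.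
  by rewrite eq_sym => /negPf ->; rewrite !mul0r.
have off : \sum_a \sum_b swap_mx a b * u a * u b = 2 * eip y.1 y.2.
  rewrite -eip_swap_diag (eip_sum_basis (swap y) y) exchange_big.
  apply: eq_bigr => b _; rewrite -mulr_suml; congr (_ * _).
  rewrite eip_swap eip_sum_basis; apply: eq_bigr => a _.
  by rewrite mulrC /swap_mx eip_swap; congr (_ * _); exact: eipC.
rewrite -diag -off !(mulr_sumr, mulr_suml, rmorph_sum) -sumrB; apply: eq_bigr => a _.
rewrite !(mulr_sumr, mulr_suml, rmorph_sum) -sumrB; apply: eq_bigr => b _.
rewrite /qmx -/(u a) -/(u b); move: (a == b)%:R (u a) (u b) (swap_mx a b) => p s t m.
by apply/eqP; rewrite eq_complex /=; apply/andP; split; apply/eqP; ring.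
Qed.

Definition qbound : R := 1 + \sum_a \sum_b `|swap_mx a b|.

Lemma swap_mx_le a b : `|swap_mx a b| <= \sum_a \sum_b `|swap_mx a b|.
Proof.
rewrite (bigD1 a) //= (bigD1 b) //= -addrA lerDl addr_ge0 // ?sumr_ge0 // => *.
by rewrite sumr_ge0.
Qed.

Lemma qbound_ge1 : 1 <= qbound.
Proof. by rewrite /qbound lerDl sumr_ge0 // => a _; rewrite sumr_ge0. Qed.

Lemma normc_qmx_le e a b : 0 <= e -> normc (qmx e a b) <= qbound.
Proof.
move=> e0; have p0 : 0 < 1 + e ^+ 2 by rewrite ltr_wpDr // sqr_ge0.
apply: (le_trans (le_normcD _ _)); rewrite normcN normcM normc_i mul1r !normc_real.
apply: lerD.
  case: (a == b); rewrite ?mulr0 ?normr0 // mulr1 ger0_norm.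
    by rewrite gerBl divr_ge0 // ltW.
  by rewrite subr_ge0 ler_pdivrMr // mul1r; nra.
apply: le_trans (swap_mx_le a b); rewrite normrM normfV (gtr0_norm p0).
by rewrite ler_pdivrMr // ler_peMr // lerDl sqr_ge0.
Qed.

(** The coefficients differ by [e / (1 + e ^+ 2)] and [1 - 1 / (1 + e ^+ 2) = e ^+ 2 / (1 + e ^+
    2)], both at most [e] since [e <= 1 + e ^+ 2]. *)
Lemma normc_qmx_sub e a b : 0 <= e -> normc (qmx e a b - qmx 0 a b) <= e * qbound.
Proof.
move=> e0; have p0 : 0 < 1 + e ^+ 2 by rewrite ltr_wpDr // sqr_ge0.
have pn := lt0r_neq0 p0.
have e1 : e / (1 + e ^+ 2) <= e by rewrite ler_pdivrMr //; nra.
have e2 : e ^+ 2 / (1 + e ^+ 2) <= e by rewrite ler_pdivrMr //; nra.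
have -> : qmx e a b - qmx 0 a b = - (e / (1 + e ^+ 2) * (a == b)%:R)%:C +
    'i%C * (swap_mx a b * (e ^+ 2 / (1 + e ^+ 2)))%:C.
  rewrite /qmx; move: (a == b)%:R (swap_mx a b) => p m.
  by apply/eqP; rewrite eq_complex /=; apply/andP; split; apply/eqP; field.
apply: (le_trans (le_normcD _ _)); rewrite normcN normcM normc_i mul1r !normc_real.
rewrite /qbound mulrDr mulr1; apply: lerD.
  case: (a == b); rewrite ?mulr0 ?normr0 // mulr1 ger0_norm //.
  by rewrite divr_ge0 // ltW.
rewrite normrM [leLHS]mulrC (ger0_norm (divr_ge0 (sqr_ge0 e) (ltW p0))).
apply: ler_pM => //; first by rewrite divr_ge0 ?sqr_ge0 // ltW.
exact: swap_mx_le.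
Qed.

Lemma hsum_qmx e y : 0 <= e -> hsum (gker (gnorm e)%:C (qmx e)) (iexp y) =
  (gnorm e)%:C * cexp ((- (e * eip y y / (2 * (1 + e ^+ 2))))%:C -
    'i%C * (eip y.1 y.2 / (1 + e ^+ 2))%:C).
Proof.
move=> e0; have p0 : 0 < 1 + e ^+ 2 by rewrite ltr_wpDr // sqr_ge0.
have pn := lt0r_neq0 p0.
rewrite (hsum_gker_iexp _ y qbound_ge1 (fun a b => normc_qmx_le a b e0)).
rewrite sum_qmx mulrCA -cexp_real -cexpD; congr (_ * cexp _).
rewrite -(rmorph_nat (real_complex R) 2) -fmorphV.
move: (eip y y) (eip _ _) => s t.
by apply/eqP; rewrite eq_complex /=; apply/andP; split; apply/eqP; field.
Qed.

Lemma gnorm_ge0 e : 0 <= gnorm e.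
Proof. by rewrite mulr_ge0 // exprn_ge0 // invr_ge0 sqrtr_ge0. Qed.

Lemma gnorm0 : gnorm 0 = c.
Proof. by rewrite /gnorm expr0n addr0 sqrtr1 invr1 expr1n mulr1. Qed.

Lemma gbound_qmx e : 0 <= e -> gbound (gker (gnorm e)%:C (qmx e)) (gnorm e) qbound.
Proof.
move=> e0; rewrite -[X in gbound _ X](ger0_norm (gnorm_ge0 e)) -normc_real.
by apply: gbound_gker => [|a b]; [exact: qbound_ge1|exact: normc_qmx_le].
Qed.

Lemma qmx_hida e : 0 <= e -> exists Psi : hida_distribution W,
  forall phi, Psi phi = hsum (gker (gnorm e)%:C (qmx e)) phi.
Proof.
move=> e0; apply: hsum_hida (gbound_qmx e0) (gnorm_ge0 e) _.
exact: le_trans ler01 qbound_ge1.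
Qed.

Lemma gexp_cint e y : 0 < e ->
  let F x := cexp ('i%C * (eip x y)%:C) * gexp e x in
  cinteg (gauss W) F /\ cint (gauss W) F = hsum (gker (gnorm e)%:C (qmx e)) (iexp y).
Proof.
move=> e0 F; have [i1 e1] := cint_gauss_quad2 e0 y.
have [i2 e2] := cintegZ c%:C i1.
have E : F = (fun x => c%:C * (cexp ('i%C * (eip x y)%:C) *
    cexp ((2^-1 * (1 - e) * eip x x)%:C + 'i%C * (eip x.1 x.2)%:C))).
  by apply/funext => x; rewrite /F /gexp mulrCA.
rewrite E; split; first exact: i2.
by apply: (etrans e2); rewrite e1 (hsum_qmx _ (ltW e0)) mulrA -rmorphM.
Qed.

Lemma represents_gexp e (Psi : hida_distribution W) : 0 < e ->
  (forall phi, Psi phi = hsum (gker (gnorm e)%:C (qmx e)) phi) -> represents Psi (gexp e).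
Proof.
move=> e0 h; split=> [|y].
  (* Integrability is the case [y = 0], where the exponential is [1]. *)
  have [[ir ii] _] := gexp_cint (0 : W) e0.
  have E : gexp e = (fun x => cexp ('i%C * (eip x (0 : W))%:C) * gexp e x).
    by apply/funext => x; rewrite eip0r mulr0 cexp0 mul1r.
  by rewrite E; split.
by have [_ /esym] := gexp_cint y e0; rewrite /Ttransform h.
Qed.

(** Bernoulli: [1 - s ^+ n <= n * (1 - s)] on the unit interval, together with [1 - s <= e]. *)
Lemma gnorm_sub e : 0 <= e -> `|gnorm e - gnorm 0| <= c * (edim V)%:R * e.
Proof.
move=> e0; rewrite gnorm0 /gnorm; set s := (Num.sqrt _)^-1.
have p0 : 0 < 1 + e ^+ 2 by rewrite ltr_wpDr // sqr_ge0.
have q0 : 0 < Num.sqrt (1 + e ^+ 2) by rewrite sqrtr_gt0.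
have s0 : 0 <= s by rewrite invr_ge0 ltW.
have q1 : 1 <= Num.sqrt (1 + e ^+ 2).
  by rewrite -[leLHS]sqrtr1; apply: ler_wsqrtr; rewrite lerDl sqr_ge0.
have s1 : s <= 1 by rewrite invf_le1.
have qe : Num.sqrt (1 + e ^+ 2) <= 1 + e.
  rewrite -(ger0_norm (addr_ge0 ler01 e0)) -sqrtr_sqr; apply: ler_wsqrtr; nra.
(* With [q] the root, [q * s = 1] gives [1 - s = (q - 1) * s <= e * s]. *)
have se : 1 - s <= e.
  have qs : Num.sqrt (1 + e ^+ 2) * s = 1 by rewrite divff // gt_eqF.
  nra.
have bern n : 0 <= 1 - s ^+ n <= n%:R * e.
  elim: n => [|n /andP[h1 h2]]; first by rewrite expr0 subrr mul0r lexx.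
  have sn0 : 0 <= s ^+ n by rewrite exprn_ge0.
  by rewrite exprS -natr1; apply/andP; split; nra.
have /andP[h1 h2] := bern (edim V).
have -> : c * s ^+ edim V - c = - (c * (1 - s ^+ edim V)) by ring.
by rewrite normrN ger0_norm ?mulr_ge0 // -mulrA ler_wpM2l.
Qed.

Lemma strong_cvg_gexp (Psi : R -> hida_distribution W) (Phi : hida_distribution W) :
  (forall e, 0 < e -> represents (Psi e) (gexp e)) ->
  (forall phi, Phi phi = hsum (gker (gnorm 0)%:C (qmx 0)) phi) ->
  strong_cvg 0^'+ Psi Phi.
Proof.
move=> rep hPhi B [Bt Bb] eps eps0.
have K1 := qbound_ge1; have K0 : 0 <= qbound := le_trans ler01 K1.
(* [p] depends only on the dimension and on [qbound], not on [t], so one norm, bounded on [B],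
   serves for all small [t]. The rate [2 * qbound] is that of the difference of kernels. *)
have [p hp] := exists_pow2_ge (2 * (#|I|%:R * (2 * qbound))).
have [M hM] := Bb (p * 2)%N.
(* Lipschitz constant at [0]: the first summand for [gnorm], the second for the entries of [qmx]. *)
pose L := c * (edim V)%:R + c * qbound.
have L0 : 0 <= L by rewrite addr_ge0 // mulr_ge0.
pose A := 2 * L * `|M|.
have A0 : 0 <= A by rewrite !mulr_ge0.
have A1 : 0 < A + 1 by rewrite ltr_wpDl.
near=> t; have t0 : 0 < t by near: t; exact: nbhs_right_gt.
have tA : t < eps / (A + 1) by near: t; apply: nbhs_right_lt; rewrite divr_gt0.
move=> phi Bphi; have tphi := Bt _ Bphi.
have t0' := ltW t0; have [Psi' hPsi'] := qmx_hida t0'.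
have [_ T] := rep t t0; have [_ T'] := represents_gexp t0 hPsi'.
(* [Psi t] is any distribution representing the function; having the T-transform of the kernel
   functional [Psi'], it takes the same values on test functions. *)
rewrite (@Ttransform_inj _ _ (Psi t) Psi' _ phi tphi) => [|y]; last by rewrite T T'.
rewrite hPsi' hPhi.
rewrite -(hsum_ksub tphi (gbound_qmx t0') (gbound_qmx (lexx 0))); try exact: gnorm_ge0; try by [].
have hb := gbound_gker_sub (gnorm t)%:C (gnorm 0)%:C K1 (mulr_ge0 t0' K0)
  (fun a b => normc_qmx_le a b t0') (fun a b => normc_qmx_le a b (lexx 0))
  (fun a b => normc_qmx_sub a b t0').
set b := _ + _ in hb.
have b0 : 0 <= b by rewrite addr_ge0 ?mulr_ge0 ?normc_ge0.
have bL : b <= L * t.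
  rewrite /b -rmorphB !normc_real mulrDl; apply: lerD; first exact: gnorm_sub.
  by rewrite gnorm0 ger0_norm // mulrA mulrAC.
apply: (le_lt_trans (normc_hsum_le tphi hb b0 (mulr_ge0 (ler0n _ 2) K0) hp)).
apply: (@le_lt_trans _ _ (A * t)).
  rewrite [leRHS](_ : _ = 2 * (L * t) * `|M|); last by rewrite /A; ring.
  apply: ler_pM; rewrite ?mulr_ge0 ?hida_norm_ge0 //.
    by apply: ler_wpM2l.
  by apply: le_trans (hM _ Bphi) (ler_norm M).
rewrite ltr_pdivlMr // in tA; apply: le_lt_trans tA.
by rewrite mulrC; apply: ler_wpM2l => //; rewrite lerDl.
Unshelve. all: by end_near. Qed.

End GaussianQuadratic.

(** * Specialization to Hermitian matrices *)

Section MatrixSpaces.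
Variables (R : realType) (N d : nat).
Local Notation C := R[i].
Implicit Types (X Y : Math2 R N d).

Definition phi_cst : R := 2 ^+ (d * N)%N * pi ^+ (d * N ^ 2)%N.

Lemma phi_cst_ge0 : 0 <= phi_cst.
Proof. by rewrite mulr_ge0 // exprn_ge0 // pi_ge0. Qed.

Lemma Matc2_formDr (X Y Z : Matc2 R N d) :
  Matc2_form X (Y + Z) = Matc2_form X Y + Matc2_form X Z.
Proof.
rewrite /Matc2_form addrACA.
by congr (_ + _); rewrite -big_split; apply: eq_bigr => mu _; rewrite ffunE mulmxDr mxtraceD.
Qed.

Lemma Matc2_formZr (z : C) (X Y : Matc2 R N d) :
  Matc2_form X (z *: Y) = z * Matc2_form X Y.
Proof.
rewrite /Matc2_form mulrDr !mulr_sumr.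
by congr (_ + _); apply: eq_bigr => mu _; rewrite ffunE -scalemxAr mxtraceZ.
Qed.

(** The off-diagonal block pairs [(A, B)] with [(B, A)] and gives [2 (A, B)], whose factor [2]
    cancels the [1/2] in front; the two minus signs cancel. *)
Lemma Phi_epsE (eps : R) X : Phi_eps eps X = gexp phi_cst eps X.
Proof.
rewrite /Phi_eps /gexp; congr (_ * cexp _).
rewrite /K_eps -scaleN1r Matc2_formZr Matc2_formDr !Matc2_formZr Matc2_formE.
have -> : ((complexify X).2, (complexify X).1) = complexify ((X.2, X.1) : Math2 R N d) by [].
rewrite Matc2_formE.
have -> : eip X ((X.2, X.1) : Math2 R N d) = 2 * eip X.1 X.2.
  by rewrite eipC -eip_swap_diag.
rewrite -(rmorph_nat (real_complex R) 2) -fmorphV.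
move: (eip X X) (eip _ _) => s t.
by apply/eqP; rewrite eq_complex /=; apply/andP; split; apply/eqP; field.
Qed.

Lemma sum_trace_mul (F G : Math R N d) :
  \sum_mu \tr (mx_of_herm (F mu) *m mx_of_herm (G mu)) = (eip F G)%:C.
Proof.
rewrite /= /pow_ip rmorph_sum; apply: eq_bigr => mu _.
by rewrite /= herm_ipE mxtrace_mulC.
Qed.

End MatrixSpaces.

(** The first conjunct shows that [Phi_eps] really defines a distribution, so the convergence
    clause, which ranges over all representing families, is not vacuous. *)
Theorem proposition3p4 (R : realType) (N d : nat) :
  (forall eps : R, 0 < eps ->
     exists Psi : hida_distribution (Math2 R N d),
       represents Psi (@Phi_eps R N d eps)) /\
  exists Phi : hida_distribution (Math2 R N d),
    (forall Psi : R -> hida_distribution (Math2 R N d),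
       (forall eps : R, 0 < eps -> represents (Psi eps) (@Phi_eps R N d eps)) ->
       strong_cvg 0^'+ Psi Phi) /\
    (forall F G : Math R N d,
       Ttransform Phi ((F, G) : Math2 R N d) =
         (2 ^+ (d * N)%N * pi ^+ (d * N ^ 2)%N)%:C *
         cexp (- 'i%C * \sum_mu \tr (mx_of_herm (F mu) *m mx_of_herm (G mu)))).
Proof.
have c0 := phi_cst_ge0 R N d; have E eps := funext (@Phi_epsE R N d eps).
split=> [eps e0|].
  have [Psi h] := @qmx_hida _ (Math R N d) _ c0 eps (ltW e0).
  by exists Psi; rewrite E; exact: represents_gexp h.
(* The kernels still make sense at [eps = 0], where the integral representation breaks down. *)
have [Phi h] := @qmx_hida _ (Math R N d) _ c0 0 (lexx 0).
exists Phi; split=> [Psi rep|F G].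
  by apply: (@strong_cvg_gexp _ (Math R N d) _ c0 Psi Phi _ h) => e e0; rewrite -E; exact: rep.
rewrite /Ttransform h sum_trace_mul (hsum_qmx _ _ (lexx 0)) gnorm0.
congr (_ * cexp _); rewrite expr0n addr0 !mul0r oppr0 divr1 sub0r.
by rewrite mulNr.
Qed.
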